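(* Let $\tau>0$ and consider the homogeneous DDAE $E\dot x(t)=Ax(t)+Bx(t-\tau)$, $t\in[0,\infty)$, where $$E=\begin{bmatrix}I&E_2\\0&N\end{bmatrix},\quad A=\begin{bmatrix}A_1&A_2\\0&I\end{bmatrix},\quad B=\begin{bmatrix}B_1&B_2\\0&B_4\end{bmatrix}$$ are real square matrices partitioned conformably, $N$ is nilpotent with nilpotency index $\nu$, and $NB_4=B_4N$. Then the DDAE is $C^\nu$-weakly exponentially stable if and only if $\sigma(E,A,B)=\{\lambda\in\mathbb{C}:\det(\lambda E-A-e^{-\lambda\tau}B)=0\}\subseteq\mathbb{C}_-=\{\lambda:\mathrm{Re}\,\lambda<0\}$.
   Context: Solutions are piecewise differentiable: continuous $x:[-\tau,\infty)\to\mathbb{R}^n$ with $Ex$ piecewise continuously differentiable satisfying the equation for all $t\in[0,\infty)\setminus\bigcup_{j\in\mathbb{N}_0}\{j\tau\}$, with initial condition $x|_{[-\tau,0]}=\varphi$; $\varphi$ is consistent if this initial value problem has a solution. For $0\le p\le\infty$, $C^p([-\tau,0],\mathbb{R}^n)$ carries the norm $\|\varphi\|_{C^p}=\sum_{i=0}^p\sup_{t\in[-\tau,0]}\|\varphi^{(i)}(t)\|$. The null solution is $C^p$-weakly exponentially stable if there are $\delta,\gamma>0$ such that for every consistent $\varphi\in C^p([-\tau,0],\mathbb{R}^n)$ the solution satisfies $\|x(t)\|\le\delta e^{-\gamma t}\|\varphi\|_{C^p}$ for all $t\ge0$. *)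

(* Defs.v *)
From HB Require Import structures.
From mathcomp Require Import all_boot all_order all_algebra.
From mathcomp Require Import all_classical all_reals all_analysis.
From mathcomp Require Import complex.
Set Implicit Arguments. Unset Strict Implicit. Unset Printing Implicit Defensive.
Import Order.TTheory GRing.Theory Num.Theory.
Import numFieldNormedType.Exports.
Local Open Scope classical_set_scope.
Local Open Scope ring_scope.

Section DDAE.
Variable R : realType.

Definition cexp (z : complex R) : complex R :=
  ((expR (complex.Re z))%:C * ((cos (complex.Im z)) +i* (sin (complex.Im z))))%C.

Definition nilpotency_index (m : nat) (N : 'M[R]_m) (nu : nat) : Prop :=
  N ^+ nu = 0 /\ forall k, (k < nu)%N -> N ^+ k <> 0.

(* f is p times differentiable on R with continuous derivatives up to
   order p (a C^p function on R; its restriction to [-tau,0] is an element of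
   C^p([-tau,0],R^n), and every such element arises in this way). *)
Definition Cp_fun (n p : nat) (f : R -> 'cV[R]_n) : Prop :=
  (forall i, (i < p)%N -> forall t, derivable (derive1n i f) t 1) /\
  (forall i, (i <= p)%N -> continuous (derive1n i f)).

Definition Cp_norm (n p : nat) (tau : R) (phi : R -> 'cV[R]_n) : R :=
  \sum_(i < p.+1) sup [set `|derive1n i phi t| | t in `[- tau, 0]].

Definition pw_C1 (n : nat) (g : R -> 'cV[R]_n) : Prop :=
  exists S : set R,
    (forall b : R, finite_set (S `&` `[0, b])) /\
    (forall t, 0 < t -> ~ S t ->
        derivable g t 1 /\ {for t, continuous (derive1 g)}) /\
    (forall s, (S s \/ s = 0) -> 0 <= s ->
        cvg ((derive1 g) x @[x --> s^'+])) /\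
    (forall s, S s -> 0 < s -> cvg ((derive1 g) x @[x --> s^'-])).

Definition is_solution (n : nat) (E A B : 'M[R]_n) (tau : R)
    (phi x : R -> 'cV[R]_n) : Prop :=
  {within `[- tau, +oo[, continuous x} /\
  pw_C1 (fun t => E *m x t) /\
  (forall t, 0 <= t -> (forall j : nat, t != j%:R * tau) ->
     derivable (fun s => E *m x s) t 1 /\
     derive1 (fun s => E *m x s) t = A *m x t + B *m x (t - tau)) /\
  (forall t, - tau <= t <= 0 -> x t = phi t).

Definition consistent (n : nat) (E A B : 'M[R]_n) (tau : R)
    (phi : R -> 'cV[R]_n) : Prop :=
  exists x, is_solution E A B tau phi x.

Definition Cp_weakly_exp_stable (n p : nat) (E A B : 'M[R]_n) (tau : R) : Prop :=
  exists delta gamma : R, 0 < delta /\ 0 < gamma /\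
    forall phi : R -> 'cV[R]_n, Cp_fun p phi -> consistent E A B tau phi ->
    forall x, is_solution E A B tau phi x ->
    forall t, 0 <= t -> `|x t| <= delta * expR (- gamma * t) * Cp_norm p tau phi.

Definition ddae_spectrum (n : nat) (E A B : 'M[R]_n) (tau : R) : set (complex R) :=
  [set lam | \det (lam *: map_mx (fun r => r%:C%C) E - map_mx (fun r => r%:C%C) A
                   - cexp (- lam * (tau%:C)%C) *: map_mx (fun r => r%:C%C) B) = 0].

End DDAE.

(* Main.v *)
(** Necessity: if lam is in the spectrum and v is a null vector, the real parts of
    exp(lam t) v and -i exp(lam t) v are smooth solutions, and both decay only if
    Re lam < 0.

    Sufficiency: the characteristic determinant is the product of
    det(lam - A1 - exp(-lam tau) B1) and det(lam N - I - exp(-lam tau) B4). A common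
    eigenvector of N and B4 shows that the zeros of the second factor lie in the
    left half plane only if the spectral radius of B4 is less than 1. The algebraic
    part satisfies x2(t) = (N x2)'(t) - B4 x2(t - tau), whence, for t = u + j tau
    with -tau < u < 0,
      x2(t) = \sum_k C(j+k-1, k) N^k (-B4)^j phi2^(k)(u),
    which decays exponentially and is controlled by the C^nu norm of phi. Then
    y = x1 + E2 x2 solves a retarded equation with exponentially small forcing
    y' = A1 y + B1 y(t - tau) + g. Its fundamental matrix is the inverse Laplace
    transform of (s - A1 - exp(-s tau) B1)^-1 along a vertical line which, because
    the resolvent is bounded on the closed right half plane, can be taken to the
    left of the imaginary axis; hence it decays exponentially, and variation of
    constants carries the decay over to y. *)
Require Import Defs.
From HB Require Import structures.
From mathcomp Require Import all_boot all_order all_algebra.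
From mathcomp Require Import all_classical all_reals all_analysis.
From mathcomp Require Import measurable_realfun lebesgue_integrable.
From mathcomp Require Import complex perm.
From mathcomp Require Import ring lra.
Import Order.TTheory GRing.Theory Num.Theory.
Import numFieldNormedType.Exports.
Set Implicit Arguments. Unset Strict Implicit. Unset Printing Implicit Defensive.
Local Open Scope classical_set_scope.
Local Open Scope ring_scope.

(** The inversion integral is identified by the equation that it satisfies. All integrals over
    vertical lines converge absolutely, with 1/(1 + w^2) as majorant. The transform of the
    fundamental matrix is only O(1/s), so 1/s + M/s^2 is split off and inverted in closed form; the
    remainder satisfies a delay equation, found by inverting the resolvent identity term by term,
    and its initial value comes from pushing the line to infinity for t < 0. The parts split off
    have a pole at 0, which blocks a line to the left of the imaginary axis. Hence solutions are
    multiplied by exp(a t), which moves everything to the right of Re s = 1, and the factor is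
    removed at the end. The equation and its forcing are controlled only away from the multiples of
    [tau], so the forcing enters through a mean value inequality with finitely many exceptional
    points; at the multiples of [tau] the bounds follow from continuity. Forcing and fundamental
    matrix are estimated at the same rate, which produces t exp(-gam t); half of the rate is spent
    on the factor t. *)

(* The library gives [complex R] its topology but no normed module structure
   over itself, without which a function of a complex variable has no derivative. *)
HB.instance Definition _ (R : realType) :=
  NormedModule.copy (complex R) ((complex R : numFieldType)^o).

Lemma scalerE (K : numFieldType) (a b : K) : a *: b = a * b.
Proof. by []. Qed.

(** * Modulus and topology of the complex numbers *)

Section ComplexCalculus.
Variable R : realType.
Local Notation C := (complex R).
Import ComplexField.Normc.

Lemma normc_normE (z : C) : `|z| = (normc z)%:C%C.
Proof. by []. Qed.

Lemma normc_ge0 (z : C) : 0 <= normc z.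
Proof. by case: z => a b /=; exact: sqrtr_ge0. Qed.

Lemma normc_gt0 (z : C) : z != 0 -> 0 < normc z.
Proof.
by move=> z0; rewrite lt_neqAle normc_ge0 andbT eq_sym; apply: contraNneq z0 => /eq0_normc ->.
Qed.

Lemma normcX (z : C) n : normc (z ^+ n) = normc z ^+ n.
Proof. by elim: n => [|n IH]; rewrite ?normc1 // !exprS normcM IH. Qed.

Lemma normc_real (r : R) : normc r%:C%C = `|r|.
Proof. by rewrite /= expr0n addr0 sqrtr_sqr. Qed.

Lemma normc_re (z : C) : `|complex.Re z| <= normc z.
Proof. by have := normc_ge_Re z; rewrite normc_normE lecR. Qed.

Lemma normc_im (z : C) : `|complex.Im z| <= normc z.
Proof.
case: z => a b /=; rewrite -sqrtr_sqr ler_wsqrtr // lerDr; exact: sqr_ge0.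
Qed.

Lemma normc_le_reim (z : C) : normc z <= `|complex.Re z| + `|complex.Im z|.
Proof.
case: z => a b /=.
rewrite -[leRHS]ger0_norm ?addr_ge0 // -[leRHS]sqrtr_sqr ler_wsqrtr // sqrrD !real_normK ?num_real //.
by rewrite -addrA [X in _ <= _ + X]addrC addrA lerDl mulrn_wge0 // mulr_ge0.
Qed.

Lemma normc_sum (I : Type) (r : seq I) (P : pred I) (F : I -> C) :
  normc (\sum_(i <- r | P i) F i) <= \sum_(i <- r | P i) normc (F i).
Proof.
elim/big_ind2: _ => [|x1 x2 y1 y2 h1 h2|//]; first by rewrite normc0.
by apply: le_trans (le_normcD _ _) _; exact: lerD.
Qed.

(** Balls of [complex R] have complex radii; a positive complex number is real, so real radii
    suffice. *)
Lemma complex_nbhs (z : C) (P : set C) :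
  nbhs z P <-> exists2 e : R, 0 < e & forall y, normc (z - y) < e -> P y.
Proof.
split=> [/nbhs_ballP [e /= e0 H]|[e e0 H]].
  move: e e0 H => [e f]; rewrite ltcE /= => /andP[/eqP -> e0] H.
  exists e => // y Hy; apply: H; rewrite /ball /= normc_normE.
  by rewrite [(e +i* 0)%C]complexr0 ltcR.
apply/nbhs_ballP; exists e%:C%C; first by rewrite /= ltcR.
by move=> y; rewrite /ball /= normc_normE ltcR => /H.
Qed.

Lemma continuous_Re : continuous (fun z : C => complex.Re z).
Proof.
move=> z; apply/(@cvgrPdist_lt _ _ _ _ (nbhs_filter z)) => e e0; apply/complex_nbhs; exists e => // y.
by apply: le_lt_trans; rewrite -raddfB; exact: normc_re.
Qed.

Lemma continuous_Im : continuous (fun z : C => complex.Im z).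
Proof.
move=> z; apply/(@cvgrPdist_lt _ _ _ _ (nbhs_filter z)) => e e0; apply/complex_nbhs; exists e => // y.
by apply: le_lt_trans; rewrite -raddfB; exact: normc_im.
Qed.

Lemma continuous_complex (T : topologicalType) (f g : T -> R) (x : T) :
  {for x, continuous f} -> {for x, continuous g} ->
  {for x, continuous (fun y => (f y +i* g y)%C : C)}.
Proof.
move=> cf cg; rewrite /prop_for /continuous_at.
move=> P /complex_nbhs[e e0 HP].
have e20 : 0 < e / 2 by rewrite divr_gt0.
have /cvgrPdist_lt /(_ _ e20) Hf := cf.
have /cvgrPdist_lt /(_ _ e20) Hg := cg.
near=> y; apply: HP; apply: le_lt_trans (normc_le_reim _) _ => /=.
rewrite [e]splitr; apply: ltrD; first by near: y.
by near: y.
Unshelve. all: by end_near. Qed.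

End ComplexCalculus.

(** * Differentiation over the reals and the complex numbers *)

Section ComplexDerivative.
Import ComplexField.Normc.

(** Division-free first-order expansion. Stated through moduli, it passes from the field [C] to real
    parameters, where no chain rule over a common field applies. *)
Lemma is_derive1_normP (K : numFieldType) (f : K -> K) (s d : K) :
  is_derive s 1 f d <->
  forall e, 0 < e -> \forall z \near (0:K), `|f (s + z) - f s - d * z| <= e * `|z|.
Proof.
split=> [[df dE] e e0|H].
  have : h^-1 *: ((f \o shift s) (h *: (1:K)) - f s) @[h --> 0^'] --> d by rewrite -dE.
  move/cvgrPdist_le => /(_ _ e0); rewrite near_withinE => He.
  near=> z.
  have [->|z0] := eqVneq z 0; first by rewrite addr0 subrr mulr0 subr0 normr0 mulr0.
  have : z != 0 -> `|d - z^-1 *: ((f \o shift s) (z *: 1) - f s)| <= e by near: z.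
  move=> /(_ z0) /= Hz.
  rewrite -ler_pdivrMr ?normr_gt0 // -normf_div mulrBl mulfK // distrC mulrC.
  by move: Hz; rewrite !scalerE mulr1 [z + s]addrC.
have Hc : h^-1 *: ((f \o shift s) (h *: (1:K)) - f s) @[h --> 0^'] --> d.
  apply/cvgrPdist_le => e e0; rewrite near_withinE; have He := H _ e0.
  near=> z => z0; have : `|f (s + z) - f s - d * z| <= e * `|z| by near: z.
  rewrite -ler_pdivrMr ?normr_gt0 // -normf_div mulrBl mulfK // distrC mulrC /=.
  by rewrite !scalerE mulr1 [z + s]addrC.
apply: DeriveDef; first by apply/cvg_ex; exists d.
exact/cvg_lim.
Unshelve. all: by end_near. Qed.

Variable R : realType.
Local Notation C := (complex R).

Lemma is_derive1_realP (f : R -> R) (s d : R) :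
  is_derive s 1 f d <->
  forall e, 0 < e -> exists2 del, 0 < del & forall z, `|z| < del ->
    `|f (s + z) - f s - d * z| <= e * `|z|.
Proof.
split=> [/is_derive1_normP H e /H /nbhs_ballP[del /= d0 Hd]|H].
  by exists del => // z zd; apply: Hd; rewrite /ball /= sub0r normrN.
apply/is_derive1_normP => e /H [del d0 Hd]; apply/nbhs_ballP; exists del => //= z.
by rewrite /ball /= sub0r normrN; exact: Hd.
Qed.

Lemma is_derive1_complexP (f : C -> C) (s d : C) :
  is_derive s 1 f d <->
  forall e : R, 0 < e -> exists2 del : R, 0 < del & forall z, normc z < del ->
    normc (f (s + z) - f s - d * z) <= e * normc z.
Proof.
split=> [/is_derive1_normP H e e0|H].
  have /H /complex_nbhs[del d0 Hd] : (0 : C) < e%:C%C by rewrite ltcR.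
  exists del => // z zd; have := Hd z; rewrite sub0r normcN => /(_ zd).
  by rewrite !normc_normE -rmorphM lecR.
apply/is_derive1_normP => -[e f0]; rewrite ltcE /= => /andP[/eqP -> /H[del d0 Hd]].
apply/complex_nbhs; exists del => // z; rewrite sub0r normcN => /Hd.
by rewrite !normc_normE [(e +i* 0)%C]complexr0 -rmorphM lecR.
Qed.

(** A chain rule across base fields: the expansion of [F] is taken at increments [z * h] with [z]
    real and then projected to the real part. *)
Lemma is_derive_Re_line (F : C -> C) (s0 h d : C) (r : R) :
  is_derive (s0 + r%:C%C * h) 1 F d ->
  is_derive r 1 (fun u : R => complex.Re (F (s0 + u%:C%C * h))) (complex.Re (d * h)).
Proof.
move=> /is_derive1_complexP H; apply/is_derive1_realP => e e0.
(* Adding 1 keeps the divisor positive when [h] is zero. *)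
have h0 : 0 < normc h + 1 by rewrite ltr_wpDl // normc_ge0.
have [del d0 Hd] := H _ (divr_gt0 e0 h0).
exists (del / (normc h + 1)); first exact: divr_gt0.
move=> z; rewrite ltr_pdivlMr // => zd.
have zn : normc (z%:C%C * h) < del.
  apply: le_lt_trans zd; rewrite normcM normc_real ler_wpM2l //; lra.
have -> : s0 + (r + z)%:C%C * h = s0 + r%:C%C * h + z%:C%C * h.
  by rewrite rmorphD mulrDl addrA.
have -> : complex.Re (d * h) * z = complex.Re (d * (z%:C%C * h)).
  by case: d h {H Hd h0 zd zn} => a b [c f] /=; ring.
rewrite -!raddfB; apply: le_trans (normc_re _) _; apply: le_trans (Hd _ zn) _.
rewrite normcM normc_real -mulrA ler_pM2l // ler_pdivrMl //.
by have := normc_ge0 h; have := normr_ge0 z; nra.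
Qed.

Lemma is_derive_Im_line (F : C -> C) (s0 h d : C) (r : R) :
  is_derive (s0 + r%:C%C * h) 1 F d ->
  is_derive r 1 (fun u : R => complex.Im (F (s0 + u%:C%C * h))) (complex.Im (d * h)).
Proof.
move=> H.
have H2 : is_derive (s0 + r%:C%C * h) 1 (fun z => (- 'i%C) *: F z : C) ((- 'i%C) *: d).
  exact: is_deriveZ.
have E z : complex.Im z = complex.Re ((- 'i%C) *: z).
  by case: z => a b /=; ring.
have := is_derive_Re_line H2.
by rewrite scalerE -mulrA -scalerE -E; under eq_fun do rewrite -E.
Qed.

Lemma cexpD (a b : C) : cexp (a + b) = cexp a * cexp b.
Proof.
case: a b => a1 a2 [b1 b2]; rewrite /cexp /= expRD cosD sinD.
apply/eqP; rewrite eq_complex /=; apply/andP; split; apply/eqP; ring.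
Qed.

Lemma cexp0 : cexp (0 : C) = 1.
Proof. by rewrite /cexp /= expR0 cos0 sin0 mul1r. Qed.

Lemma normc_cexp (a : C) : normc (cexp a) = expR (complex.Re a).
Proof.
rewrite /cexp normcM normc_real ger0_norm ?expR_ge0 //= cos2Dsin2 sqrtr1 mulr1 //.
Qed.

Lemma cexp_neq0 (a : C) : cexp a != 0.
Proof.
apply/eqP => /(congr1 (@normc R)); rewrite normc_cexp normc0 => /eqP.
by rewrite (gt_eqF (expR_gt0 _)).
Qed.

Lemma is_derive_cexp0 : is_derive (0 : C) 1 (@cexp R) 1.
Proof.
apply/is_derive1_complexP => e e0.
have e4 : 0 < e / 8 by lra.
have em : 0 < Num.min (e / 8) 1 by rewrite lt_min e4 /=.
have /is_derive1_realP /(_ _ em) [d1 d10 H1] := is_derive_expR (0:R).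
have /is_derive1_realP /(_ _ em) [d2 d20 H2] := is_derive_sin (0:R).
have /is_derive1_realP /(_ _ em) [d3 d30 H3] := is_derive_cos (0:R).
(* For z = a + ib of modulus n, the real part of the error costs three and the imaginary part four
   units [e / 8 * n]. The condition [n < e / 8] pays for the quadratic term [a * sin b]. *)
exists (Num.min (Num.min d1 d2) (Num.min d3 (Num.min 1 (e/8)))).
  by rewrite !lt_min d10 d20 d30 e4 ltr01.
move=> z; rewrite !lt_min => /andP[/andP[z1 z2] /andP[z3 /andP[z4 z5]]].
rewrite add0r cexp0 mul1r.
have Ha := normc_re z; have Hb := normc_im z.
have {}H1 := H1 _ (le_lt_trans Ha z1).
have {}H2 := H2 _ (le_lt_trans Hb z2).
have {}H3 := H3 _ (le_lt_trans Hb z3).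
have cosl := cos_max (complex.Im z).
move: H1 H2 H3; rewrite !add0r expR0 sin0 cos0 subr0 mul1r oppr0 mul0r subr0 mul1r.
set m := Num.min _ _ => H1 H2 H3.
have m1 : m <= e / 8 by rewrite /m ge_min lexx.
have m2 : m <= 1 by rewrite /m ge_min lexx orbT.
apply: le_trans (normc_le_reim _) _.
case: z Ha Hb z1 z2 z3 z4 z5 H1 H2 H3 cosl => a b /=; set n := Num.sqrt _ => Ha Hb z1 z2 z3 z4 z5 H1 H2 H3 cosl.
have -> : expR a * cos b - 0 * sin b - 1 - a = (expR a - 1 - a) * cos b + a * (cos b - 1) + (cos b - 1) by ring.
have -> : expR a * sin b + 0 * cos b - 0 - b = (expR a - 1 - a) * sin b + a * sin b + (sin b - b) by ring.
have H1' : `|expR a - 1 - a| <= e / 8 * n by apply: le_trans H1 _; apply: ler_pM => //; rewrite le_min (ltW e4) ler01.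
have H2' : `|sin b - b| <= e / 8 * n by apply: le_trans H2 _; apply: ler_pM => //; rewrite le_min (ltW e4) ler01.
have H3' : `|cos b - 1| <= e / 8 * n by apply: le_trans H3 _; apply: ler_pM => //; rewrite le_min (ltW e4) ler01.
have sinl : `|sin b| <= 1 by apply: sin_max.
have n0 : 0 <= n by exact: sqrtr_ge0.
have P1 : `|(expR a - 1 - a) * cos b| <= e / 8 * n.
  by rewrite normrM -[leRHS]mulr1 ler_pM.
have P2 : `|(expR a - 1 - a) * sin b| <= e / 8 * n.
  by rewrite normrM -[leRHS]mulr1 ler_pM.
have P3 : `|a * (cos b - 1)| <= e / 8 * n.
  by rewrite normrM -[leRHS]mul1r ler_pM // (le_trans Ha) // ltW.
have P4 : `|a * sin b| <= 2 * (e / 8 * n).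
  have sb : `|sin b| <= 2 * n.
    rewrite (_ : sin b = (sin b - b) + b); last by ring.
    apply: le_trans (ler_normD _ _) _.
    have : `|sin b - b| <= 1 * n by apply: le_trans H2 _; apply: ler_pM => //; rewrite le_min (ltW e4) ler01.
    lra.
  rewrite normrM; have := ler_pM (normr_ge0 _) (normr_ge0 _) Ha sb.
  have : 0 <= (e / 8 - n) * n by rewrite mulr_ge0 // subr_ge0 ltW.
  lra.
have T (x y z : R) : `|x + y + z| <= `|x| + `|y| + `|z|.
  by apply: le_trans (ler_normD _ _) _; rewrite lerD2r ler_normD.
have en : 0 <= e * n by rewrite mulr_ge0 // ltW.
apply: le_trans (lerD (T _ _ _) (T _ _ _)) _; lra.
Qed.

Lemma is_derive_cexp (z : C) : is_derive z 1 (@cexp R) (cexp z).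
Proof.
apply/is_derive1_complexP => e e0.
have nz := normc_gt0 (cexp_neq0 z).
have /is_derive1_complexP /(_ _ (divr_gt0 e0 nz)) [del d0 Hd] := is_derive_cexp0.
exists del => // h /Hd; rewrite add0r cexp0 mul1r => Hh.
rewrite cexpD (_ : _ - _ - _ = cexp z * (cexp h - 1 - h)); last by ring.
by rewrite normcM mulrC -ler_pdivlMr // mulrAC.
Qed.

Lemma is_derive_cexpM (t : C) (z : C) :
  is_derive z 1 (fun s => cexp (s * t)) (t * cexp (z * t)).
Proof.
apply/is_derive1_complexP => e e0.
have t0 : 0 < normc t + 1 by rewrite ltr_wpDl // normc_ge0.
have /is_derive1_complexP /(_ _ (divr_gt0 e0 t0)) [del d0 Hd] := is_derive_cexp (z * t).
exists (del / (normc t + 1)); first exact: divr_gt0.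
move=> h; rewrite ltr_pdivlMr // => hd.
have hn : normc (h * t) < del.
  by apply: le_lt_trans hd; rewrite normcM ler_wpM2l ?normc_ge0 //; lra.
rewrite mulrDl (_ : t * _ * h = cexp (z * t) * (h * t)); last by ring.
apply: le_trans (Hd _ hn) _.
rewrite normcM -mulrA ler_pM2l // ler_pdivrMl //.
by have := normc_ge0 h; have := normc_ge0 t; nra.
Qed.

End ComplexDerivative.

(** * Derivatives of products, determinants and inverse matrices *)

Section Differentiation.
Variable R : realType.

Lemma is_derive_continuous (K : numFieldType) (W : normedModType K) (F : K -> W) (s : K) (d : W) :
  is_derive s 1 F d -> {for s, continuous F}.
Proof. by case=> dF _; apply: differentiable_continuous; apply/derivable1_diffP. Qed.

Lemma is_derive1_Mr (K : numFieldType) (F G : K -> K) (s a b c : K) :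
  is_derive s 1 F a -> is_derive s 1 G b -> c = a * G s + F s * b ->
  is_derive s 1 (fun z => F z * G z) c.
Proof.
move=> HF HG ->; have := is_deriveM HF HG.
by rewrite !scalerE addrC [G s * _]mulrC.
Qed.

Lemma is_derive1_V (K : numFieldType) (F : K -> K) (s a : K) :
  F s != 0 -> is_derive s 1 F a ->
  is_derive s 1 (fun z => (F z)^-1) (- a / F s ^+ 2).
Proof.
move=> F0 [dF <-]; apply: DeriveDef; first exact: derivableV.
by rewrite deriveV // scalerE; ring.
Qed.

Lemma is_derive1_sum (K : numFieldType) (I : Type) (r : seq I) (P : pred I)
    (F : I -> K -> K) (d : I -> K) (s : K) :
  (forall i, P i -> is_derive s 1 (F i) (d i)) ->
  is_derive s 1 (fun z => \sum_(i <- r | P i) F i z) (\sum_(i <- r | P i) d i).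
Proof.
move=> H; elim: r => [|i r IH].
  by rewrite big_nil; under eq_fun do rewrite big_nil; exact: is_derive_cst.
rewrite big_cons; under eq_fun do rewrite big_cons.
by case: ifP => // Pi; apply: is_deriveD; exact: H.
Qed.

Lemma derivable1_prod (K : numFieldType) (I : Type) (r : seq I) (P : pred I)
    (F : I -> K -> K) (s : K) :
  (forall i, P i -> derivable (F i) s 1) ->
  derivable (fun z => \prod_(i <- r | P i) F i z) s 1.
Proof.
move=> H; elim: r => [|i r IH].
  by under eq_fun do rewrite big_nil; exact: derivable_cst.
under eq_fun do rewrite big_cons.
by case: ifP => // Pi; apply: derivableM => //; exact: H.
Qed.

Lemma derivable1_det (K : numFieldType) (n : nat) (M : K -> 'M[K]_n) (s : K) :
  (forall i j, derivable (fun z => M z i j) s 1) ->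
  derivable (fun z => \det (M z)) s 1.
Proof.
move=> H; rewrite /determinant.
have h (sg : 'S_n) : is_derive s 1 (fun z => (-1) ^+ sg * \prod_i M z i (sg i))
    ('D_1 (fun z => (-1) ^+ sg * \prod_i M z i (sg i)) s).
  apply/derivableP; apply: derivableM; first exact: derivable_cst.
  refine (@derivable1_prod K _ _ _ (fun i z => M z i (sg i)) s (fun i _ => H _ _)).
by case: (@is_derive1_sum K _ (index_enum 'S_n) xpredT
  (fun sg z => (-1) ^+ sg * \prod_i M z i (sg i)) _ s (fun sg _ => h sg)).
Qed.

Lemma derivable1_adj (K : numFieldType) (n : nat) (M : K -> 'M[K]_n) (s : K) i j :
  (forall i j, derivable (fun z => M z i j) s 1) ->
  derivable (fun z => (\adj (M z)) i j) s 1.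
Proof.
move=> H; under eq_fun do rewrite mxE /cofactor.
apply: derivableM; first exact: derivable_cst.
apply: (@derivable1_det K _ (fun z => row' j (col' i (M z)))) => k l.
by under eq_fun do rewrite !mxE; exact: H.
Qed.

Lemma derivable1_invmx (K : numFieldType) (n : nat) (M : K -> 'M[K]_n) (s : K) i j :
  (forall i j, derivable (fun z => M z i j) s 1) -> \det (M s) != 0 ->
  derivable (fun z => invmx (M z) i j) s 1.
Proof.
move=> H d0.
have dd := derivable1_det H.
have : derivable (fun z => (\det (M z))^-1 * (\adj (M z)) i j) s 1.
  by apply: derivableM; [exact: derivableV|exact: derivable1_adj].
apply: near_eq_derivable.
have cd : {for s, continuous (fun z => \det (M z))}.
  by apply: differentiable_continuous; apply/derivable1_diffP.
have : \forall z \near s, \det (M z) != 0.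
  exact: (@cvgr_neq0 K K _ (nbhs s) _ (fun z => \det (M z)) _ cd d0).
apply: filterS => z z0.
by rewrite /invmx unitmxE unitfE z0 !mxE.
Qed.

Lemma continuous1_sum (T : topologicalType) (K : numFieldType) (V : normedModType K)
    (I : Type) (r : seq I) (P : pred I) (f : I -> T -> V) (x : T) :
  (forall i, P i -> {for x, continuous (f i)}) ->
  {for x, continuous (fun y => \sum_(i <- r | P i) f i y)}.
Proof.
rewrite /prop_for /continuous_at => h; elim: r => [|i r IH].
  by rewrite big_nil; under eq_fun do rewrite big_nil; exact: cvg_cst.
rewrite big_cons; under eq_fun do rewrite big_cons.
by case: ifP => // Pi; apply: cvgD => //; exact: h.
Qed.

Lemma is_derive_expRM (k u : R) :
  is_derive u 1 (fun v => expR (k * v)) (k * expR (k * u)).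
Proof.
have hl : is_derive u 1 (fun v : R => k * v) k.
  have := is_deriveZ k (is_derive_id u (1 : R)).
  by rewrite (_ : k *: (1 : R) = k) // /GRing.scale /= mulr1.
have := is_derive1_comp (is_derive_expR (k * u)) hl.
by rewrite /GRing.scale /= [_ * k]mulrC.
Qed.

End Differentiation.

(** * Inverse Laplace transforms on vertical lines *)

Section RealLineIntegral.
Variable R : realType.
Local Notation mu := (@lebesgue_measure R).

Lemma oneDsqr_gt0 (w : R) : 0 < oneDsqr w.
Proof. by rewrite (lt_le_trans _ (oneDsqr_ge1 w)). Qed.

Lemma oneDsqrV_ge0 (w : R) : 0 <= (oneDsqr w)^-1.
Proof. by rewrite invr_ge0 ltW // oneDsqr_gt0. Qed.

Lemma integrable_oneDsqrV : mu.-integrable setT (EFin \o (fun w => (oneDsqr w)^-1)).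
Proof.
apply/integrableP; split.
  apply/measurable_EFinP; apply: continuous_measurable_fun => w; exact: continuous_oneDsqrV.
under eq_integral => w _ do rewrite /= ger0_norm ?oneDsqrV_ge0 //.
rewrite ge0_symfun_integralT.
- rewrite -set_itvcy integral0y_oneDsqr -EFinM; exact: ltry.
- by move=> w; exact: oneDsqrV_ge0.
- exact: continuous_oneDsqrV.
- by move=> w /=; rewrite /oneDsqr sqrrN.
Qed.

Lemma integrable_oneDsqrVZ (c : R) :
  mu.-integrable setT (EFin \o (fun w => c * (oneDsqr w)^-1)).
Proof.
have := integrableZl measurableT c integrable_oneDsqrV.
by apply: eq_integrable => // w _ /=; rewrite EFinM.
Qed.

(** With one fixed majorant for all integrands, only the factor [c] has to be tracked to obtain
    integrability, dominated convergence and differentiation under the integral. *)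
Definition cauchy_dominated (c : R) (f : R -> R) :=
  continuous f /\ forall w, `|f w| <= c * (oneDsqr w)^-1.

Definition lineint (f : R -> R) : R := \int[mu]_(w in setT) f w.

Lemma cauchy_dominated_integrable c f : cauchy_dominated c f ->
  mu.-integrable setT (EFin \o f).
Proof.
move=> [cf hf].
have gi := integrable_oneDsqrVZ c.
apply: (le_integrable measurableT _ _ gi).
- by apply/measurable_EFinP; exact: continuous_measurable_fun.
- by move=> w _ /=; rewrite lee_fin (le_trans (hf w)) // ler_norm.
Qed.

Lemma lineint_le c f : cauchy_dominated c f ->
  `|lineint f| <= c * lineint (fun w => (oneDsqr w)^-1).
Proof.
move=> df; have := cauchy_dominated_integrable df => fi.
apply: le_trans (le_normr_Rintegral measurableT fi) _.
rewrite /lineint -RintegralZl //; last exact: integrable_oneDsqrV.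
apply: le_Rintegral => //; last by move=> w _; case: df.
- by have := integrable_abse fi; apply: eq_integrable.
- exact: integrable_oneDsqrVZ.
Qed.

Lemma lineintD c1 c2 f g : cauchy_dominated c1 f -> cauchy_dominated c2 g ->
  lineint (fun w => f w + g w) = lineint f + lineint g.
Proof.
by move=> /cauchy_dominated_integrable fi /cauchy_dominated_integrable gi; rewrite /lineint RintegralD.
Qed.

Lemma lineintZ c k f : cauchy_dominated c f ->
  lineint (fun w => k * f w) = k * lineint f.
Proof. by move=> /cauchy_dominated_integrable fi; rewrite /lineint RintegralZl. Qed.

Lemma cauchy_dominated_sum (I : Type) (r : seq I) (P : pred I) (c : I -> R) (f : I -> R -> R) :
  (forall i, P i -> cauchy_dominated (c i) (f i)) ->
  cauchy_dominated (\sum_(i <- r | P i) c i) (fun w => \sum_(i <- r | P i) f i w).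
Proof.
move=> H; elim: r => [|i r [IH1 IH2]].
  split; first by under eq_fun do rewrite big_nil; move=> w; exact: cvg_cst.
  by move=> w; rewrite !big_nil normr0 mul0r.
rewrite big_cons; under [X in cauchy_dominated _ X]eq_fun do rewrite big_cons.
case: ifP => // Pi; have [h1 h2] := H _ Pi; split.
  by move=> w; apply: cvgD; [exact: h1|exact: IH1].
move=> w; rewrite mulrDl; apply: le_trans (ler_normD _ _) _; exact: lerD.
Qed.

Lemma lineint_sum (I : Type) (r : seq I) (P : pred I) (c : I -> R) (f : I -> R -> R) :
  (forall i, P i -> cauchy_dominated (c i) (f i)) ->
  lineint (fun w => \sum_(i <- r | P i) f i w) = \sum_(i <- r | P i) lineint (f i).
Proof.
move=> H; elim: r => [|i r IH].
  rewrite big_nil /lineint; under eq_Rintegral do rewrite big_nil.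
  by rewrite Rintegral_cst // mul0r.
rewrite big_cons; under [X in lineint X]eq_fun do rewrite big_cons.
case: ifP => // Pi.
by rewrite (lineintD (H _ Pi) (cauchy_dominated_sum r H)) IH.
Qed.

(** The fundamental theorem on [-n, n] leaves boundary terms that tend to 0 by the bound on [h],
    while the truncated integrals converge to the full one by domination. *)
Lemma lineint_derive1_eq0 (c1 c2 : R) (h h' : R -> R) :
  (forall w : R, is_derive w 1 h (h' w)) ->
  cauchy_dominated c1 h -> cauchy_dominated c2 h' -> lineint h' = 0.
Proof.
move=> dh [_ hb] dh'.
have [ch' bh'] := dh'.
have ih' := cauchy_dominated_integrable dh'.
pose I n : set R := `[- n%:R, n%:R]%classic.
have E n : (0 < n)%N -> \int[mu]_(x in I n) h' x = h n%:R - h (- n%:R).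
  move=> n0; rewrite /Rintegral (@continuous_FTC2 _ h' h) //.
  - by rewrite gtrN // ltr0n.
  - exact: continuous_subspaceT.
  - split; first by move=> w _; case: (dh w).
    + by apply: cvg_at_right_filter; exact: is_derive_continuous (dh _).
    + by apply: cvg_at_left_filter; exact: is_derive_continuous (dh _).
  - by move=> w _; rewrite derive1E; case: (dh w).
have C1 : (\int[mu]_(x in setT) (EFin \o (h' \_ (I n))) x)%E @[n --> \oo] -->
    (\int[mu]_(x in setT) (h' x)%:E)%E.
  apply: (@dominated_cvg _ _ _ mu setT measurableT _ _ (EFin \o (fun w => c2 * (oneDsqr w)^-1))).
  - move=> n; apply/measurable_EFinP.
    have mI : measurable (I n) by exact: measurable_itv.
    apply/(measurable_restrictT _ mI).
    by apply: measurable_funTS; exact: continuous_measurable_fun.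
  - move=> w _; have F : \forall n \near \oo, (EFin \o (h' \_ (I n))) w = (h' w)%:E.
      near=> n => /=.
      rewrite patchE ifT // inE /I /= in_itv /= -ler_norml.
      by near: n; exact: nbhs_infty_ger.
    apply: cvg_near_cst; exact: F.
  - by [].
  - exact: integrable_oneDsqrVZ.
  - move=> n w _ /=; rewrite lee_fin patchE; case: ifP => _ //.
    by rewrite normr0; apply: le_trans (bh' w).
have C2 : \int[mu]_(x in I n) h' x @[n --> \oo] --> lineint h'.
  rewrite /lineint /Rintegral; apply: fine_cvg; rewrite fineK; last exact: integrable_fin_num.
  rewrite (_ : (fun n => _) = (fun n => \int[mu]_(x in setT) (EFin \o (h' \_ (I n))) x)%E).
    exact: C1.
  apply/funext => n; rewrite integral_mkcond.
  by apply: eq_integral => w _; rewrite /= !patchE; case: ifP.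
have C3 : \int[mu]_(x in I n) h' x @[n --> \oo] --> 0.
  have c10 : 0 <= c1 by have := hb 0; rewrite /oneDsqr expr0n addr0 invr1 mulr1; exact: le_trans.
  apply: norm_cvg0.
  apply: (@squeeze_cvgr _ _ _ _ (cst 0) (fun n => 2 * c1 * n.+1%:R^-1)).
  - near=> n; rewrite normr_ge0 /= E; last by near: n; exact: nbhs_infty_gt.
    apply: le_trans (ler_normB _ _) _.
    (* Since n + 1 <= 1 + n^2 for n >= 1, the boundary terms are dominated by the harmonic
       sequence. *)
    have bnd (w : R) : `|w| = n%:R -> `|h w| <= c1 * n.+1%:R^-1.
      move=> wn; apply: le_trans (hb w) _; rewrite ler_wpM2l // lef_pV2 ?posrE ?oneDsqr_gt0 ?ltr0n //.
      rewrite /oneDsqr -[w ^+ 2]real_normK ?num_real // wn -natr1 addrC lerD2l -natrX ler_nat.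
      by rewrite -{1}(expn1 n) leq_pexp2l //; near: n; exact: nbhs_infty_gt.
    rewrite -mulrA mulr_natl mulr2n; apply: lerD; apply: bnd; rewrite ?normrN ger0_norm //.
  - exact: cvg_cst.
  - rewrite -[X in _ --> X](mulr0 (2 * c1)); apply: cvgMr.
    exact: cvg_harmonic.
exact: (cvg_unique _ C2 C3).
Unshelve. all: by end_near. Qed.

Lemma is_derive_lineint (u v a c1 c2 : R) (f d : R -> R -> R) :
  u < a < v ->
  (forall x, u < x < v -> cauchy_dominated c1 (f x)) ->
  (forall x w : R, u < x < v -> is_derive x 1 (fun y => f y w) (d x w)) ->
  (forall x w, u < x < v -> `|d x w| <= c2 * (oneDsqr w)^-1) ->
  is_derive a 1 (fun x => lineint (f x)) (lineint (d a)).
Proof.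
move=> auv cf df db.
have c20 : 0 <= c2 by have := db a 0 auv; rewrite /oneDsqr expr0n addr0 invr1 mulr1; exact: le_trans.
have p1 x w : u < x < v -> partial1of2 f x w = d x w.
  by move=> xuv; rewrite partial1of2E; case: (df x w xuv).
have -> : lineint (d a) = \int[mu]_(y in setT) (partial1of2 f) a y.
  by apply: eq_Rintegral => w _; rewrite p1.
pose G w := c2 * (oneDsqr w)^-1.
have G0 w : 0 <= G w by rewrite mulr_ge0 // oneDsqrV_ge0.
have iG : mu.-integrable setT (EFin \o G).
  exact: integrable_oneDsqrVZ.
have Ia : [set` `]u, v[ ] a by rewrite /= in_itv.
have H1 x : [set` `]u, v[ ] x -> mu.-integrable setT (EFin \o f x).
  by rewrite /= in_itv => /cf /cauchy_dominated_integrable.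
have H2 x y : [set` `]u, v[ ] x -> setT y -> derivable (f^~ y) x 1.
  by rewrite /= in_itv => xuv _; case: (df x y xuv).
have H3 x y : [set` `]u, v[ ] x -> setT y -> `|partial1of2 f x y| <= G y.
  by rewrite /= in_itv => xuv _; rewrite p1 //; exact: db.
apply: DeriveDef.
  exact: (derivable_under_integral measurableT Ia H1 H2 G0 iG H3).
rewrite -derive1E.
exact: (differentiation_under_integral measurableT Ia H1 H2 G0 iG H3).
Qed.

Lemma lineint_gt0 (f : R -> R) (c m : R) : 0 < m -> cauchy_dominated c f ->
  (forall w, 0 <= f w) -> (forall w, 0 <= w <= 1 -> m <= f w) -> 0 < lineint f.
Proof.
move=> m0 df f0 f1; have fi := cauchy_dominated_integrable df.
have m01 : measurable (`[0, 1]%classic : set R) by exact: measurable_itv.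
rewrite /lineint -(setUv `[0, 1]%classic) Rintegral_setU //.
- apply: (@lt_le_trans _ _ m) => //.
  rewrite -[leLHS]addr0; apply: lerD; last by apply: Rintegral_ge0.
  have -> : m = \int[mu]_(w in `[0, 1]) (m : R).
    have m1 : mu `[0, 1]%classic = 1%:E :> \bar R.
      by rewrite lebesgue_measure_itv /= lte_fin ltr01 oppr0 adde0.
    by rewrite Rintegral_cst // [X in fine X](_ : _ = 1%:E) ?mulr1 //.
  apply: le_Rintegral => //.
  - by apply: continuous_compact_integrable; [exact: segment_compact|apply: continuous_subspaceT => x; exact: cvg_cst].
  - exact: integrableS fi.
- exact: measurableC.
- by rewrite setUv.
- exact/disj_setPCl.
Qed.

End RealLineIntegral.

(** * The inversion integral on a vertical line *)

Section LineTransform.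
Import ComplexField.Normc.
Variable R : realType.
Local Notation C := (complex R).
Local Notation P := (lineint (fun w : R => (oneDsqr w)^-1)).

Lemma normc_sqr (z : C) : normc z ^+ 2 = complex.Re z ^+ 2 + complex.Im z ^+ 2.
Proof. by case: z => a b /=; rewrite sqr_sqrtr // addr_ge0 // sqr_ge0. Qed.

Lemma normc_ge1 (s : C) : 1 <= complex.Re s -> 1 <= normc s.
Proof. by move=> h; apply: le_trans (normc_re s); rewrite ger0_norm // (le_trans ler01). Qed.

Lemma normc_pow_le (s : C) n : 1 <= complex.Re s -> (1 < n)%N ->
  normc (s ^- n) <= (oneDsqr (complex.Im s))^-1.
Proof.
move=> s1 n2; have h := normc_ge1 s1.
have s0 : 0 < normc s by rewrite (lt_le_trans ltr01).
rewrite normcV normcX lef_pV2 ?posrE ?exprn_gt0 ?oneDsqr_gt0 //.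
apply: (@le_trans _ _ (normc s ^+ 2)); last by rewrite ler_weXn2l.
rewrite normc_sqr /oneDsqr lerD2r; nra.
Qed.

Lemma Re_gt0_neq0 (s : C) : 0 < complex.Re s -> s != 0.
Proof. by move=> h; apply: contraTneq h => ->; rewrite /= ltxx. Qed.

Definition line_bounded (b c : R) (H : C -> C) :=
  (forall w : R, {for (b +i* w)%C, continuous H}) /\
  (forall w, normc (H (b +i* w)%C) <= c * (oneDsqr w)^-1).

(** Inverse Laplace transform along Re s = b, without the factor 1/(2 pi). For symbols with real
    coefficients the values at conjugate points are conjugate, so the real part carries the whole
    integral. *)
Definition line_transform (b : R) (H : C -> C) (t : R) : R :=
  lineint (fun w => complex.Re (cexp ((b +i* w)%C * t%:C%C) * H (b +i* w)%C)).

Lemma continuous_line (F : C -> C) (b : R) :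
  (forall w : R, {for (b +i* w)%C, continuous F}) ->
  continuous (fun w : R => complex.Re (F (b +i* w)%C)) /\
  continuous (fun w : R => complex.Im (F (b +i* w)%C)).
Proof.
move=> cF.
have cl (w : R) : {for w, continuous (fun w : R => (b +i* w)%C : C)}.
  by apply: continuous_complex; [exact: cvg_cst|exact: cvg_id].
by split=> w; apply: (continuous_comp (continuous_comp (cl w) (cF w)));
  [exact: continuous_Re|exact: continuous_Im].
Qed.

Lemma continuous_cexpM (t s : C) : {for s, continuous (fun z : C => cexp (z * t))}.
Proof. exact: is_derive_continuous (is_derive_cexpM t s). Qed.

Lemma continuous1_M (K : numFieldType) (F G : K -> K) (s : K) :
  {for s, continuous F} -> {for s, continuous G} ->
  {for s, continuous (fun z => F z * G z)}.
Proof. by move=> cF cG; have := cvgM cF cG; apply. Qed.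

Lemma line_transform_dominated b c H t : line_bounded b c H ->
  cauchy_dominated (expR (b * t) * c)
    (fun w => complex.Re (cexp ((b +i* w)%C * t%:C%C) * H (b +i* w)%C)).
Proof.
move=> [cH bH]; split.
  have cc (w : R) : {for (b +i* w)%C, continuous (fun s : C => cexp (s * t%:C%C) * H s)}.
    exact: (@continuous1_M C _ H (b +i* w)%C (@continuous_cexpM t%:C%C (b +i* w)%C) (cH w)).
  exact: (continuous_line cc).1.
move=> w; apply: le_trans (normc_re _) _.
rewrite normcM normc_cexp -mulrA /= mulr0 subr0.
by rewrite ler_wpM2l // expR_ge0.
Qed.

Lemma line_transform_le b c H t : line_bounded b c H ->
  `|line_transform b H t| <= expR (b * t) * c * P.
Proof. by move=> /line_transform_dominated => /(_ t)/lineint_le. Qed.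

Lemma line_transformD b c1 c2 H1 H2 t : line_bounded b c1 H1 -> line_bounded b c2 H2 ->
  line_transform b (fun s => H1 s + H2 s) t = line_transform b H1 t + line_transform b H2 t.
Proof.
move=> h1 h2; rewrite /line_transform.
rewrite -(lineintD (line_transform_dominated t h1) (line_transform_dominated t h2)).
by apply: eq_Rintegral => w _; rewrite mulrDr raddfD.
Qed.

Lemma line_transformZ b c (k : R) H t : line_bounded b c H ->
  line_transform b (fun s => k%:C%C * H s) t = k * line_transform b H t.
Proof.
move=> h; rewrite /line_transform -(lineintZ k (line_transform_dominated t h)).
apply: eq_Rintegral => w _; case: (cexp _) => x y; case: (H _) => z u /=; ring.
Qed.

Lemma line_transform_sum b (I : Type) (r : seq I) (p : pred I) (c : I -> R) (H : I -> C -> C) t :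
  (forall i, p i -> line_bounded b (c i) (H i)) ->
  line_transform b (fun s => \sum_(i <- r | p i) H i s) t =
  \sum_(i <- r | p i) line_transform b (H i) t.
Proof.
move=> h; rewrite /line_transform.
rewrite -(lineint_sum r (fun i pi => line_transform_dominated t (h i pi))).
by apply: eq_Rintegral => w _; rewrite mulr_sumr raddf_sum.
Qed.

Lemma eq_line_transform b H1 H2 t : (forall w, H1 (b +i* w)%C = H2 (b +i* w)%C) ->
  line_transform b H1 t = line_transform b H2 t.
Proof. by move=> E; apply: eq_Rintegral => w _; rewrite E. Qed.

Lemma line_transform_shift b H t u :
  line_transform b (fun s => cexp (- s * u%:C%C) * H s) t = line_transform b H (t - u).
Proof.
apply: eq_Rintegral => w _; rewrite mulrA -cexpD; congr (complex.Re (cexp _ * _)).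
by rewrite rmorphB; ring.
Qed.

Lemma line_boundedZ b c k H : line_bounded b c H ->
  line_bounded b (normc k * c) (fun s => k * H s).
Proof.
move=> [cH bH]; split => w.
  have ck : {for (b +i* w)%C, continuous (fun _ : C => k)} by exact: cst_continuous.
  exact: (@continuous1_M C (fun=> k) H (b +i* w)%C ck (cH w)).
by rewrite normcM -mulrA ler_wpM2l // normc_ge0.
Qed.

(** The demand that [s * H s] again decay like 1/s^2 is what forces the slowly decaying part of a
    transform to be split off beforehand. *)
Lemma is_derive_line_transform (b c1 c2 t0 : R) H :
  line_bounded b c1 H -> line_bounded b c2 (fun s => s * H s) ->
  is_derive t0 1 (line_transform b H) (line_transform b (fun s => s * H s) t0).
Proof.
move=> h1 h2.
pose f t w := complex.Re (cexp ((b +i* w)%C * t%:C%C) * H (b +i* w)%C).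
pose d t w := complex.Re (cexp ((b +i* w)%C * t%:C%C) * ((b +i* w)%C * H (b +i* w)%C)).
pose E := expR (`|b| * (`|t0| + 1)).
have Eb t : t0 - 1 < t < t0 + 1 -> expR (b * t) <= E.
  move=> /andP[t1 t2]; rewrite ler_expR; apply: le_trans (ler_norm _) _.
  rewrite normrM ler_wpM2l // ler_norml; have := ler_norm t0.
  have := ler_norm (- t0); rewrite normrN; lra.
have dom c H0 t : line_bounded b c H0 -> t0 - 1 < t < t0 + 1 ->
    cauchy_dominated (E * c) (fun w => complex.Re (cexp ((b +i* w)%C * t%:C%C) * H0 (b +i* w)%C)).
  move=> h0 ht; have [k1 k2] := line_transform_dominated t h0; split=> // w.
  apply: le_trans (k2 w) _; rewrite -!mulrA ler_wpM2r ?Eb //.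
  by case: h0 => _ /(_ w); apply: le_trans; exact: normc_ge0.
apply: (@is_derive_lineint _ (t0 - 1) (t0 + 1) t0 (E * c1) (E * c2) f d).
- lra.
- by move=> t ht; exact: dom.
- move=> t w _; rewrite /f /d.
  pose K := H (b +i* w)%C.
  have hd : is_derive (0 + t%:C%C * (b +i* w)%C : C) 1 (fun z => K *: cexp z) (K *: cexp (0 + t%:C%C * (b +i* w)%C)).
    by apply: is_deriveZ; exact: is_derive_cexp.
  have := is_derive_Re_line hd; rewrite !scalerE add0r.
  have e1 (u : R) : u%:C%C * (b +i* w)%C = (b +i* w)%C * u%:C%C :> C by rewrite mulrC.
  under eq_fun do rewrite add0r scalerE e1 mulrC.
  rewrite e1 (_ : K * _ * _ = cexp ((b +i* w)%C * t%:C%C) * ((b +i* w)%C * K)) //; ring.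
- by move=> t w ht; have [_] := dom _ _ t h2 ht; apply.
Qed.

End LineTransform.

(** * Vanishing of the inversion integral at negative times *)

Section ContourShift.
Import ComplexField.Normc.
Variable R : realType.
Local Notation C := (complex R).
Local Notation P := (lineint (fun w : R => (oneDsqr w)^-1)).

Lemma is_derive_horizontal (F : C -> C) (d : C) (x w : R) :
  is_derive (x +i* w)%C 1 F d ->
  is_derive x 1 (fun y : R => complex.Re (F (y +i* w)%C)) (complex.Re d).
Proof.
have E (y : R) : (0 +i* w)%C + y%:C%C * 1 = (y +i* w)%C :> C.
  by apply/eqP; rewrite eq_complex /=; apply/andP; split; apply/eqP; ring.
rewrite -{1}E => /is_derive_Re_line; rewrite mulr1.
by under eq_fun do rewrite E.
Qed.

Lemma is_derive_vertical (F : C -> C) (d : C) (x w : R) :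
  is_derive (x +i* w)%C 1 F d ->
  is_derive w 1 (fun v : R => complex.Im (F (x +i* v)%C)) (complex.Re d).
Proof.
have E (v : R) : x%:C%C + v%:C%C * 'i%C = (x +i* v)%C :> C.
  by apply/eqP; rewrite eq_complex /=; apply/andP; split; apply/eqP; ring.
rewrite -{1}E => /is_derive_Im_line; rewrite ImiRe.
by under eq_fun do rewrite E.
Qed.

Lemma lineint_oneDsqrV_ge0 : 0 <= P.
Proof. by apply: Rintegral_ge0 => w _; exact: oneDsqrV_ge0. Qed.

(* With [F s = cexp (s t) H s], Cauchy-Riemann gives d/dx \int Re F(x+iw) dw =
   \int d/dw Im F(x+iw) dw = 0, so the integral does not depend on the abscissa;
   since [t < 0], it vanishes as the abscissa tends to infinity. *)
Lemma line_transform_eq0 (b0 c t : R) (H H' : C -> C) :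
  (forall s : C, b0 < complex.Re s -> is_derive s 1 H (H' s)) ->
  (forall s : C, b0 < complex.Re s -> {for s, continuous H'}) ->
  (forall s : C, b0 < complex.Re s -> normc (H s) <= c * (oneDsqr (complex.Im s))^-1) ->
  (forall s : C, b0 < complex.Re s -> normc (H' s) <= c * (oneDsqr (complex.Im s))^-1) ->
  t < 0 -> forall b, b0 < b -> line_transform b H t = 0.
Proof.
move=> dH cH' bH bH' t0.
pose F (s : C) := cexp (s * t%:C%C) * H s.
pose F' (s : C) := t%:C%C * cexp (s * t%:C%C) * H s + cexp (s * t%:C%C) * H' s.
have dF (s : C) : b0 < complex.Re s -> is_derive s 1 F (F' s).
  move=> hs; apply: (@is_derive1_Mr C _ _ s _ _ _ (is_derive_cexpM _ s) (dH s hs)) => //.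
have cF' (s : C) : b0 < complex.Re s -> {for s, continuous F'}.
  move=> hs.
  have ce := @continuous_cexpM R t%:C%C s.
  have cH : {for s, continuous H} by exact: is_derive_continuous (dH s hs).
  have ct : {for s, continuous (fun _ : C => t%:C%C : C)} by exact: cst_continuous.
  have h1 := @continuous1_M C _ _ s ce (cH' s hs).
  have h2 := @continuous1_M C _ _ s (@continuous1_M C _ _ s ct ce) cH.
  exact: (@continuousD C C C _ _ s h2 h1).
have ebnd (s : C) : b0 < complex.Re s -> normc (cexp (s * t%:C%C)) <= expR (b0 * t).
  move=> hs; rewrite normc_cexp ler_expR; case: s hs => a b /= hs; nra.
have c0 (s : C) : b0 < complex.Re s -> 0 <= c * (oneDsqr (complex.Im s))^-1.
  by move=> /bH; apply: le_trans; exact: normc_ge0.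
have bF (s : C) : b0 < complex.Re s -> normc (F s) <= expR (b0 * t) * c * (oneDsqr (complex.Im s))^-1.
  move=> hs; rewrite normcM -mulrA.
  by apply: ler_pM; rewrite ?normc_ge0 ?ebnd ?bH.
have bF' (s : C) : b0 < complex.Re s ->
    normc (F' s) <= (`|t| + 1) * (expR (b0 * t) * c) * (oneDsqr (complex.Im s))^-1.
  move=> hs; apply: le_trans (le_normcD _ _) _.
  rewrite mulrDl mul1r mulrDl; apply: lerD.
    rewrite -mulrA normcM normc_real -!mulrA ler_wpM2l // mulrA.
    by have := bF s hs; rewrite /F -!mulrA.
  by rewrite normcM -mulrA; apply: ler_pM; rewrite ?normc_ge0 ?ebnd ?bH'.
have dj (x : R) : b0 < x -> is_derive x 1 (fun x => line_transform x H t) 0.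
  move=> xb.
  have E0 : lineint (fun w => complex.Re (F' (x +i* w)%C)) = 0.
    apply: (@lineint_derive1_eq0 _ (expR (b0 * t) * c) ((`|t| + 1) * (expR (b0 * t) * c))
      (fun w => complex.Im (F (x +i* w)%C))).
    - by move=> w; apply: is_derive_vertical; exact: dF.
    - split; first by apply: (continuous_line _).2 => w; exact: is_derive_continuous (dF _ _).
      by move=> w; apply: le_trans (normc_im _) _; exact: bF.
    - split; first by apply: (continuous_line _).1 => w; exact: cF'.
      by move=> w; apply: le_trans (normc_re _) _; exact: bF'.
  rewrite -E0.
  apply: (@is_derive_lineint _ b0 (x + 1) x (expR (b0 * t) * c) ((`|t| + 1) * (expR (b0 * t) * c))
    (fun x w => complex.Re (F (x +i* w)%C)) (fun x w => complex.Re (F' (x +i* w)%C))).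
  - by rewrite xb ltrDl ltr01.
  - move=> y /andP[yb _]; split.
      by apply: (continuous_line _).1 => w; exact: is_derive_continuous (dF _ _).
    by move=> w; apply: le_trans (normc_re _) _; exact: bF.
  - by move=> y w /andP[yb _]; apply: is_derive_horizontal; exact: dF.
  - by move=> y w /andP[yb _]; apply: le_trans (normc_re _) _; exact: bF'.
move=> b bb.
have Jc x : b < x -> line_transform x H t = line_transform b H t.
  move=> bx.
  have [||z _] := @MVT R (fun x => line_transform x H t) (fun=> 0) b x bx.
  - by move=> y /[!in_itv] /= /andP[yb _]; apply: dj; exact: lt_trans yb.
  - apply: derivable_within_continuous => y /[!in_itv] /= /andP[yb _].
    by case: (dj y) => //; exact: lt_le_trans yb.
  by rewrite mul0r => /eqP; rewrite subr_eq0 => /eqP.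
have Jb x : b < x -> `|line_transform b H t| <= expR (x * t) * c * P.
  move=> bx; rewrite -(Jc x bx); apply: line_transform_le; split.
    by move=> w; apply: is_derive_continuous (dH _ _) => /=; exact: lt_trans bx.
  by move=> w; apply: bH => /=; exact: lt_trans bx.
apply/eqP; rewrite -normr_le0 leNgt; apply/negP => J0.
set K := `|_| in J0 Jb.
have cP0 : 0 < c * P.
  have := Jb (b + 1); rewrite ltrDl ltr01 -mulrA => /(_ isT) h.
  by have := lt_le_trans J0 h; rewrite pmulr_rgt0 // expR_gt0.
(* So large that exp(-x t) >= 1 - x t > c P / K, against the bound for the line of abscissa [x]. *)
pose x := Num.max (b + 1) ((c * P / K) / (- t)).
have bx : b < x by rewrite lt_max ltrDl ltr01.
have := Jb x bx; apply/negP; rewrite -ltNge -mulrA.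
have ht : 0 < - t by rewrite oppr_gt0.
have : c * P / K <= x * - t by rewrite -ler_pdivrMr // le_max lexx orbT.
rewrite mulrN => hx.
have := expR_ge1Dx (- (x * t)); rewrite expRN => he.
rewrite -ltr_pdivlMl ?expR_gt0 //.
have : c * P / K < (expR (x * t))^-1 by lra.
by rewrite ltr_pdivrMr // mulrC.
Qed.

End ContourShift.

(** * The inverse transform of 1/s^2 *)

Section RampKernel.
Import ComplexField.Normc.
Variable R : realType.
Local Notation C := (complex R).
Local Notation P := (lineint (fun w : R => (oneDsqr w)^-1)).

Lemma is_derive1_exp (K : numFieldType) (n : nat) (x : K) :
  is_derive x 1 (fun z : K => z ^+ n.+1) (n.+1%:R * x ^+ n).
Proof.
apply: DeriveDef; first exact: exprn_derivable.
by rewrite exp_derive /= !scalerE mulr1.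
Qed.

Lemma is_derive_expVn (n : nat) (s : C) : s != 0 ->
  is_derive s 1 (fun z : C => z ^- n.+1) (- n.+1%:R * s ^- n.+2).
Proof.
move=> s0.
have h : is_derive s 1 (fun z : C => z ^+ n.+1) (n.+1%:R * s ^+ n).
  exact: is_derive1_exp.
have s1 : s ^+ n.+1 != 0 by rewrite expf_neq0.
have := @is_derive1_V C _ s _ s1 h.
rewrite (_ : - (n.+1%:R * s ^+ n) / (s ^+ n.+1) ^+ 2 = - n.+1%:R * s ^- n.+2) //.
have sn : s ^+ n != 0 by rewrite expf_neq0.
by rewrite !exprS; field; rewrite s0 sn.
Qed.

Lemma line_bounded_expVn (b : R) n : 1 <= b -> (1 < n)%N ->
  line_bounded b 1 (fun s : C => s ^- n).
Proof.
case: n => [//|n] b1 n1; split=> w.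
  have s0 : (b +i* w)%C != 0 by apply: Re_gt0_neq0 => /=; exact: lt_le_trans b1.
  exact: is_derive_continuous (is_derive_expVn n s0).
by rewrite mul1r; exact: (@normc_pow_le R (b +i* w)%C).
Qed.

(** All left difference quotients at 0 vanish. This settles the corner of the ramp, where the value
    of the transform of 1/s^2 is a derivative of that of 1/s^3. *)
Lemma is_derive_left0_eq0 (f : R -> R) (d : R) :
  is_derive (0 : R) 1 f d -> (forall t, t <= 0 -> f t = 0) -> d = 0.
Proof.
move=> /is_derive1_realP h f0; apply/eqP; rewrite -normr_le0.
apply/ler_addgt0Pl => e e0; rewrite addr0.
have [del d0 hd] := h e e0.
have d2 : 0 < del / 2 by lra.
have := hd (- (del / 2)); rewrite normrN (gtr0_norm d2) add0r => /(_ ltac:(lra)).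
rewrite !f0 //; last by lra.
by rewrite subrr sub0r mulrN opprK normrM (gtr0_norm d2) ler_pM2r.
Qed.

Variable b : R.
Hypothesis b1 : 1 < b.
(** The transform [k2] cannot be differentiated under the integral, as 1/s is not dominated, but
    [k3' = k2]. Together with [t k2 = 2 k3] this is Euler's equation [t k3' = 2 k3], so [k3] is a
    multiple of t^2 for t > 0, and [k2] is a ramp. *)
Let k2 := line_transform b (fun s : C => s ^- 2).
Let k3 := line_transform b (fun s : C => s ^- 3).

Let b_neq0 w : (b +i* w)%C != 0 :> C.
Proof. by apply: Re_gt0_neq0 => /=; exact: lt_trans b1. Qed.

Let bnd2 : line_bounded b 1 (fun s : C => s ^- 2).
Proof. exact: line_bounded_expVn (ltW b1) _. Qed.
Let bnd3 : line_bounded b 1 (fun s : C => s ^- 3).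
Proof. exact: line_bounded_expVn (ltW b1) _. Qed.

Lemma line_bounded_eq (c : R) (H1 H2 : C -> C) :
  (forall s : C, 0 < complex.Re s -> H1 s = H2 s) -> 0 < c ->
  forall c', line_bounded c c' H1 -> line_bounded c c' H2.
Proof.
move=> E c0 c' [h1 h2]; split=> w; last by rewrite -E.
have n : \forall s \near (c +i* w)%C, H1 s = H2 s.
  apply/complex_nbhs; exists c => // y hy; apply: E.
  have := le_lt_trans (normc_re _) hy; rewrite raddfB /= => /ltr_normlP[]; lra.
have := h1 w; rewrite /prop_for /continuous_at -(E (c +i* w)%C) //.
move=> h; apply: (cvg_trans _ h).
exact: (@near_eq_cvg C C _ (nbhs_filter (c +i* w)%C) H1 H2 n).
Qed.

Let dk3 (t : R) : is_derive t 1 k3 (k2 t).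
Proof.
have h : line_bounded b 1 (fun s : C => s * s ^- 3).
  apply: line_bounded_eq bnd2; last by rewrite (lt_trans _ b1).
  move=> s /Re_gt0_neq0 s0; field; exact: s0.
have := is_derive_line_transform t bnd3 h.
rewrite (@eq_line_transform R b (fun s : C => s * s ^- 3) (fun s => s ^- 2)) // => w.
by have := b_neq0 w => s0; field.
Qed.

(* Integrate d/dw of [Im (cexp (s t) / s^2)] along the line. *)
Let tk2 t : t * k2 t = 2 * k3 t.
Proof.
pose H (s : C) := t%:C%C * s ^- 2 + (- 2)%:C%C * s ^- 3.
have bt := line_boundedZ t%:C%C bnd2; have b3 := line_boundedZ (- 2)%:C%C bnd3.
have bH : line_bounded b (normc t%:C%C * 1 + normc (- 2)%:C%C * 1) H.
  case: bt b3 => [h1 h2] [h3 h4]; split=> w.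
    exact: (@continuousD C C C _ _ _ (h1 w) (h3 w)).
  by rewrite mulrDl; apply: le_trans (le_normcD _ _) _; exact: lerD.
have := line_transformD t bt b3; rewrite (line_transformZ _ _ bnd2) (line_transformZ _ _ bnd3).
suff -> : line_transform b (fun s => t%:C%C * s ^- 2 + (- 2)%:C%C * s ^- 3) t = 0.
  by rewrite -/k2 -/k3; lra.
rewrite -/H.
pose h (w : R) := complex.Im (cexp ((b +i* w)%C * t%:C%C) * (b +i* w)%C ^- 2).
pose h' (w : R) := complex.Re (cexp ((b +i* w)%C * t%:C%C) * H (b +i* w)%C).
suff [d1 d2 d3] : [/\ forall w : R, is_derive w 1 h (h' w),
    cauchy_dominated (expR (b * t) * 1) h &
    cauchy_dominated (expR (b * t) * (normc t%:C%C * 1 + normc (- 2)%:C%C * 1)) h'].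
  exact: (lineint_derive1_eq0 d1 d2 d3).
split.
- move=> w; apply: (@is_derive_vertical _ (fun s : C => cexp (s * t%:C%C) * s ^- 2)).
  apply: (@is_derive1_Mr C _ _ _ _ _ _ (is_derive_cexpM _ _) (is_derive_expVn 1 (b_neq0 w))).
  by rewrite /H !rmorphN /= rmorph_nat; ring.
- split.
    apply: (continuous_line (F := fun s : C => cexp (s * t%:C%C) * s ^- 2) _).2 => w.
    exact: (@continuous1_M C _ _ _ (@continuous_cexpM R t%:C%C _) (bnd2.1 w)).
  move=> w; apply: le_trans (normc_im _) _; rewrite normcM normc_cexp /= -mulrA mulr0 subr0.
  by rewrite ler_wpM2l ?expR_ge0 //; exact: bnd2.2.
- exact: line_transform_dominated.
Qed.

Let k2neg t : t < 0 -> k2 t = 0.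
Proof.
move=> t0.
apply: (@line_transform_eq0 R 1 2 t (fun s : C => s ^- 2) (fun s : C => - 2%:R * s ^- 3)) => //.
- move=> s s1; apply: is_derive_expVn; apply: Re_gt0_neq0; exact: lt_trans s1.
- move=> s s1.
  have s0 : s != 0 by apply: Re_gt0_neq0; exact: lt_trans s1.
  have c2 : {for s, continuous (fun _ : C => - 2%:R : C)} by exact: cst_continuous.
  exact: (@continuous1_M C _ _ s c2 (is_derive_continuous (is_derive_expVn 2 s0))).
- move=> s s1; apply: le_trans (normc_pow_le (ltW s1) _) _ => //.
  by rewrite ler_peMl ?oneDsqrV_ge0 // ler1n.
- move=> s s1; rewrite normcM normcN -[2%:R](rmorph_nat (real_complex R)) normc_real ger0_norm //.
  by rewrite ler_wpM2l //; exact: normc_pow_le (ltW s1) _.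
Qed.

Let k3neg t : t <= 0 -> k3 t = 0.
Proof.
rewrite le_eqVlt => /orP[/eqP->|t0].
  by have := tk2 0; rewrite mul0r; lra.
by have := tk2 t; rewrite k2neg // mulr0; lra.
Qed.

Let k3pos t : 0 < t -> k3 t = k3 1 * t ^+ 2.
Proof.
move=> t0.
pose f t := k3 t * t ^- 2.
have df (u : R) : 0 < u -> is_derive u 1 f 0.
  move=> u0.
  have h2 : is_derive u 1 (fun z : R => (z ^+ 2)^-1) (- (2 * u) / (u ^+ 2) ^+ 2).
    apply: is_derive1_V; first by rewrite expf_neq0 // gt_eqF.
    exact: (is_derive1_exp 1 u).
  apply: (@is_derive1_Mr R _ _ u _ _ _ (dk3 u) h2).
  have := tk2 u => E.
  have -> : k3 u = u * k2 u / 2 by rewrite E; field.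
  by field; rewrite gt_eqF.
have fc x y : 0 < x -> x < y -> f y = f x.
  move=> x0 xy.
  have [||z _] := @MVT R f (fun=> 0) x y xy.
  - by move=> z /[!in_itv] /= /andP[xz _]; apply: df; exact: lt_trans xz.
  - apply: derivable_within_continuous => z /[!in_itv] /= /andP[xz _].
    by case: (df z) => //; exact: lt_le_trans xz.
  by rewrite mul0r => /eqP; rewrite subr_eq0 => /eqP.
have ft : f t = f 1 by have [h|h|->//] := ltgtP t 1; [rewrite (fc t 1)|rewrite (fc 1 t)].
have f1 : f 1 = k3 1 by rewrite /f expr1n invr1 mulr1.
by rewrite -f1 -ft /f; field; rewrite gt_eqF.
Qed.

(* This replaces the evaluation of the integral by residues. If the constant
   were zero, the transform of 1/s^2 would vanish identically, and the transform
   [q] of 1/(s^2 (2b - s)) would satisfy q' = 2b q; but [q 0 > 0], while the line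
   of abscissa [b] only allows growth of order exp(b t). *)
Let k3_1_neq0 : k3 1 != 0.
Proof.
apply/eqP => k31.
have k30 t : k3 t = 0.
  by have [t0|t0] := lerP t 0; [exact: k3neg|rewrite k3pos // k31 mul0r].
have k20 t : k2 t = 0.
  have := dk3 t; rewrite (_ : k3 = fun=> 0); last exact/funext.
  by case=> _ <-; rewrite derive_cst.
have Lre (s : C) : complex.Re s = b -> 1 <= complex.Re ((2 * b)%:C%C - s).
  by case: s => x y /= ->; have := b1; lra.
have Lne w : (2 * b)%:C%C - (b +i* w)%C != 0.
  by apply: Re_gt0_neq0; exact: lt_le_trans ltr01 (Lre (b +i* w)%C erefl).
pose H (s : C) := s ^- 2 * ((2 * b)%:C%C - s)^-1.
have cl w : {for (b +i* w)%C, continuous (fun s : C => ((2 * b)%:C%C - s)^-1)}.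
  have d : is_derive (b +i* w)%C 1 (fun s : C => (2 * b)%:C%C - s) (0 - 1).
    by apply: is_deriveB.
  apply: is_derive_continuous (@is_derive1_V C _ _ _ _ d).
  exact: Lne.
have nl w : normc (((2 * b)%:C%C - (b +i* w)%C)^-1) <= 1.
  rewrite normcV invf_le1; first by apply: normc_ge1; exact: Lre.
  by apply: lt_le_trans (normc_ge1 (Lre (b +i* w)%C erefl)).
have bH : line_bounded b 1 H.
  split=> w; first exact: (@continuous1_M C _ _ _ (bnd2.1 w) (cl w)).
  by rewrite normcM -[leRHS]mulr1; apply: ler_pM (bnd2.2 w) (nl w); exact: normc_ge0.
have bH2 := line_boundedZ (2 * b)%:C%C bH.
have bm := line_boundedZ ((-1)%:C%C : C) bnd2.
(* The identity [(2b - s) H = 1/s^2]. After inversion it reads [q' = 2b q - k2], and [k2] vanishes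
   here. *)
have sHE (s : C) : s != 0 -> (2 * b)%:C%C - s != 0 -> (2 * b)%:C%C * H s + (-1)%:C%C * s ^- 2 = s * H s.
  rewrite /H; move: (2 * b)%:C%C => z _ s1.
  have e := mulfV s1.
  have -> : s * (s ^- 2 * (z - s)^-1) = s ^- 2 * (z * (z - s)^-1 - (z - s) * (z - s)^-1).
    by ring.
  rewrite e !rmorphN rmorph1; ring.
have bsH : line_bounded b (normc (2 * b)%:C%C * 1 + normc ((-1)%:C%C : C) * 1) (fun s => s * H s).
  split=> w.
    have cid : {for (b +i* w)%C, continuous (fun s : C => s : C)} by move=> A; exact.
    exact: (@continuous1_M C _ _ _ cid (bH.1 w)).
  rewrite -(sHE _ (b_neq0 w) (Lne w)); apply: le_trans (le_normcD _ _) _.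
  rewrite [leRHS]mulrDl; exact: (lerD (bH2.2 w) (bm.2 w)).
pose q := line_transform b H.
have dq (t : R) : is_derive t 1 q (2 * b * q t).
  have := is_derive_line_transform t bH bsH.
  rewrite -(@eq_line_transform R b (fun s => (2 * b)%:C%C * H s + (-1)%:C%C * s ^- 2)).
    by rewrite (line_transformD _ bH2 bm) (line_transformZ _ _ bH) (line_transformZ _ _ bnd2) -/k2 k20 mulr0 addr0.
  by move=> w; exact: sHE (b_neq0 w) (Lne w).
have qE t : 0 < t -> q t = q 0 * expR (2 * b * t).
  move=> t0; pose g t := q t * expR (- (2 * b) * t).
  have dg (u : R) : is_derive u 1 g 0.
    have he := is_derive_expRM (- (2 * b)) u.
    apply: (@is_derive1_Mr R _ _ u _ _ _ (dq u) he); ring.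
  have cg : {within `[0, t], continuous g}.
    by apply: derivable_within_continuous => z _; case: (dg z).
  have [z _] := MVT t0 (fun z _ => dg z) cg.
  rewrite mul0r => /eqP; rewrite subr_eq0 /g mulr0 expR0 mulr1 => /eqP <-.
  by rewrite -mulrA -expRD mulNr addNr expR0 mulr1.
have q0 : 0 < q 0.
  pose m := b * (b ^+ 2 + 1) ^- 2.
  (* On the line, [2b - s] is the conjugate of [s], so [H s] is that conjugate divided by the fourth
     power of the modulus, with positive real part. *)
  have E w : complex.Re (cexp ((b +i* w)%C * 0%:C%C) * H (b +i* w)%C) = b * (b ^+ 2 + w ^+ 2) ^- 2.
    rewrite mulr0 cexp0 mul1r /H (_ : (2 * b)%:C%C - (b +i* w)%C = (b -i* w)%C); last first.
      by apply/eqP; rewrite eq_complex /=; apply/andP; split; apply/eqP; ring.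
    have n0 : (b ^+ 2 + w ^+ 2) != 0 by rewrite gt_eqF // ltr_wpDr ?sqr_ge0 // exprn_gt0 // (lt_trans _ b1).
    have ss : (b +i* w)%C * (b -i* w)%C = (b ^+ 2 + w ^+ 2)%:C%C :> C.
      by apply/eqP; rewrite eq_complex /=; apply/andP; split; apply/eqP; ring.
    have c0 : (b -i* w)%C != 0 :> C by apply: Re_gt0_neq0 => /=; exact: lt_trans b1.
    rewrite (_ : _ ^- 2 * _ = (b -i* w)%C * ((b ^+ 2 + w ^+ 2) ^- 2)%:C%C).
      by rewrite /=; ring.
    move: (b ^+ 2 + w ^+ 2) ss => n ss; rewrite fmorphV rmorphXn /= -ss.
    move: (b_neq0 w) c0; move: (b +i* w)%C (b -i* w)%C => s s' n1 n2.
    by field; rewrite n1 n2.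
  have := line_transform_dominated 0 bH => dH.
  rewrite /q; apply: (lineint_gt0 (m := m) _ dH).
  - by rewrite mulr_gt0 ?invr_gt0 ?exprn_gt0 ?ltr_wpDl ?sqr_ge0 // (lt_trans _ b1).
  - move=> w; rewrite E mulr_ge0 ?invr_ge0 ?exprn_ge0 ?addr_ge0 ?sqr_ge0 //.
    by rewrite ltW // (lt_trans _ b1).
  - move=> w /andP[w0 w1]; rewrite E /m ler_wpM2l //; first by rewrite ltW // (lt_trans _ b1).
    have b0 : 0 < b by exact: lt_trans b1.
    rewrite lef_pV2 ?posrE ?exprn_gt0 ?ltr_wpDr ?sqr_ge0 ?exprn_gt0 //.
    by rewrite lerXn2r ?nnegrE ?addr_ge0 ?sqr_ge0 // lerD2l expr_le1.
have hb t : 0 < t -> q 0 * expR (b * t) <= P.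
  move=> t0; have := line_transform_le t bH; rewrite -/q qE // mulr1.
  rewrite ger0_norm ?mulr_ge0 ?expR_ge0 ?(ltW q0) //.
  rewrite (_ : 2 * b * t = b * t + b * t); last by ring.
  by rewrite expRD mulrA mulrC ler_pM2l ?expR_gt0.
have b0 : 0 < b by exact: lt_trans b1.
have P0 := lineint_oneDsqrV_ge0 R.
have t0 : 0 < (P / q 0) / b + 1 by rewrite ltr_wpDl ?divr_ge0 // ltW.
have := hb _ t0; apply/negP; rewrite -ltNge -ltr_pdivrMl //.
apply: lt_le_trans (expR_ge1Dx _).
have -> : b * (P / q 0 / b + 1) = P / q 0 + b by field; rewrite !gt_eqF.
by rewrite mulrC; lra.
Qed.

(** Classically [kap] is 2 pi. Being nonzero is enough for normalising the fundamental matrix by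
    [kap^-1]. *)
Lemma line_transform_expV2 : exists2 kap : R, kap != 0 &
  forall t, line_transform b (fun s : C => s ^- 2) t = kap * Num.max t 0.
Proof.
exists (2 * k3 1); first by rewrite mulf_neq0 // pnatr_eq0.
move=> t; rewrite -/k2.
have [t0|t0|->] := ltgtP t 0.
- by rewrite k2neg // mulr0.
- have := tk2 t; rewrite k3pos // => E.
  have : t * k2 t = t * (2 * k3 1 * t) by rewrite E; ring.
  by apply: mulfI; rewrite gt_eqF.
- by rewrite mulr0; exact: is_derive_left0_eq0 (dk3 0) k3neg.
Qed.

End RampKernel.

(** * The fundamental matrix of a retarded equation *)

Section MatrixNorm.
Import ComplexField.Normc.
Variable R : realType.
Local Notation C := (complex R).

(** The entrywise l1 norm: submultiplicative, real-valued, and a bound for the modulus of every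
    entry. *)
Definition mxsum m n (X : 'M[C]_(m, n)) : R := \sum_i \sum_j normc (X i j).

Lemma mxsum_ge0 m n (X : 'M[C]_(m, n)) : 0 <= mxsum X.
Proof. by apply: sumr_ge0 => i _; apply: sumr_ge0 => j _; exact: normc_ge0. Qed.

Lemma normc_le_mxsum m n (X : 'M[C]_(m, n)) i j : normc (X i j) <= mxsum X.
Proof.
rewrite /mxsum (bigD1 i) //= (bigD1 j) //= -addrA lerDl addr_ge0 //.
  by apply: sumr_ge0 => k _; exact: normc_ge0.
by apply: sumr_ge0 => k _; apply: sumr_ge0 => l _; exact: normc_ge0.
Qed.

Lemma mxsum_eq0 m n (X : 'M[C]_(m, n)) : mxsum X = 0 -> X = 0.
Proof.
move=> X0; apply/matrixP => i j; rewrite mxE; apply: eq0_normc.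
by apply/eqP; rewrite -normr_le0 ger0_norm ?normc_ge0 // -X0; exact: normc_le_mxsum.
Qed.

Lemma mxsumD m n (X Y : 'M[C]_(m, n)) : mxsum (X + Y) <= mxsum X + mxsum Y.
Proof.
rewrite /mxsum -big_split; apply: ler_sum => i _; rewrite -big_split.
by apply: ler_sum => j _; rewrite mxE; exact: le_normcD.
Qed.

Lemma mxsumZ m n (a : C) (X : 'M[C]_(m, n)) : mxsum (a *: X) = normc a * mxsum X.
Proof.
rewrite /mxsum mulr_sumr; apply: eq_bigr => i _; rewrite mulr_sumr.
by apply: eq_bigr => j _; rewrite mxE normcM.
Qed.

Lemma mxsumM m n p (X : 'M[C]_(m, n)) (Y : 'M[C]_(n, p)) :
  mxsum (X *m Y) <= mxsum X * mxsum Y.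
Proof.
rewrite /mxsum mulr_suml; apply: ler_sum => i _.
apply: (@le_trans _ _ (\sum_j \sum_k normc (X i k) * normc (Y k j))).
  apply: ler_sum => j _; rewrite mxE; apply: le_trans (normc_sum _ _ _) _.
  by apply: ler_sum => k _; rewrite normcM.
rewrite exchange_big mulr_suml; apply: ler_sum => k _ /=.
rewrite -mulr_sumr ler_wpM2l ?normc_ge0 // [leRHS](bigD1 k) //= lerDl.
by apply: sumr_ge0 => l _; apply: sumr_ge0 => j _; exact: normc_ge0.
Qed.

Lemma mxsum1 n : mxsum (1%:M : 'M[C]_n) = n%:R.
Proof.
rewrite /mxsum (eq_bigr (fun=> 1)); first by rewrite sumr_const card_ord.
move=> i _; rewrite (bigD1 i) //= big1 ?mxE ?eqxx ?normc1 ?addr0 // => j ji.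
by rewrite mxE eq_sym (negbTE ji) normc0.
Qed.

End MatrixNorm.

(** * The resolvent of the characteristic matrix on a half plane *)

Section Resolvent.
Import ComplexField.Normc.
Variable R : realType.
Local Notation C := (complex R).
Variables (n : nat) (A B : 'M[R]_n) (tau : R).
Hypothesis tau0 : 0 < tau.
Local Notation AC := (map_mx (fun r : R => r%:C%C) A).
Local Notation BC := (map_mx (fun r : R => r%:C%C) B).

Definition delay_symbol (s : C) : 'M[C]_n := AC + cexp (- s * tau%:C%C) *: BC.
Definition delay_symbol' (s : C) : 'M[C]_n := (- tau%:C%C * cexp (- s * tau%:C%C)) *: BC.
Definition delay_resolvent (s : C) : 'M[C]_n := invmx (s%:M - delay_symbol s).
Local Notation M := delay_symbol.
Local Notation G := delay_resolvent.

Lemma is_derive_cexpN (s : C) :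
  is_derive s 1 (fun z : C => cexp (- z * tau%:C%C)) (- tau%:C%C * cexp (- s * tau%:C%C)).
Proof.
have E (z : C) : z * - tau%:C%C = - z * tau%:C%C by rewrite mulrN mulNr.
have := is_derive_cexpM (- tau%:C%C) s; rewrite E.
by under eq_fun do rewrite E.
Qed.

Lemma is_derive_delay_symbol (s : C) i j :
  is_derive s 1 (fun z => M z i j) (delay_symbol' s i j).
Proof.
rewrite (_ : (fun z => M z i j) = fun z => AC i j + cexp (- z * tau%:C%C) * BC i j); last first.
  by apply/funext => z; rewrite mxE [X in _ + X]mxE.
rewrite [delay_symbol' s i j]mxE; move: (AC i j) (BC i j) => a k.
have hk : is_derive s 1 (fun z : C => cexp (- z * tau%:C%C) * k) (- tau%:C%C * cexp (- s * tau%:C%C) * k).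
  have hc : is_derive s 1 (fun _ : C => k) (0 : C) by exact: is_derive_cst.
  by apply: (@is_derive1_Mr C _ _ s _ _ _ (is_derive_cexpN s) hc); rewrite mulr0 addr0.
have ha : is_derive s 1 (fun _ : C => a) (0 : C) by exact: is_derive_cst.
by have := @is_deriveD C C C _ _ _ _ _ _ ha hk; rewrite add0r.
Qed.

Lemma delay_symbol_bound (b : R) (s : C) : b <= complex.Re s ->
  mxsum (M s) <= mxsum AC + expR (- (b * tau)) * mxsum BC.
Proof.
move=> bs; apply: le_trans (mxsumD _ _) _; rewrite lerD2l mxsumZ ler_wpM2r ?mxsum_ge0 //.
rewrite normc_cexp ler_expR; case: s bs => x y /= bs; have := ler_wpM2r (ltW tau0) bs; lra.
Qed.

Lemma delay_symbol'_bound (b : R) (s : C) : b <= complex.Re s ->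
  mxsum (delay_symbol' s) <= tau * expR (- (b * tau)) * mxsum BC.
Proof.
move=> bs; rewrite mxsumZ ler_wpM2r ?mxsum_ge0 // normcM normcN normc_real gtr0_norm //.
rewrite ler_wpM2l ?(ltW tau0) // normc_cexp ler_expR; case: s bs => x y /= bs; have := ler_wpM2r (ltW tau0) bs; lra.
Qed.

Lemma delay_resolventP (s : C) : \det (s%:M - M s) != 0 ->
  s *: G s = 1%:M + G s *m M s.
Proof.
move=> d0; have u : s%:M - M s \in unitmx by rewrite unitmxE unitfE.
have := mulVmx u; rewrite -/(G s) mulmxBr mul_mx_scalar => <-.
by rewrite subrK.
Qed.

Lemma derivable_delay_resolvent (s : C) i j : \det (s%:M - M s) != 0 ->
  derivable (fun z => G z i j) s 1.
Proof.
move=> d0; apply: (@derivable1_invmx C n (fun z => z%:M - M z) s i j) => // k l.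
under eq_fun do rewrite mxE [X in _ + X]mxE.
apply: derivableB; last by case: (is_derive_delay_symbol s k l).
under eq_fun do rewrite mxE.
case: (k == l); last by under eq_fun do rewrite mulr0n; exact: derivable_cst.
by under eq_fun do rewrite mulr1n; exact: derivable_id.
Qed.

Lemma continuous_normc : continuous (fun z : C => normc z : R).
Proof.
move=> z; apply/(@cvgrPdist_le _ _ _ _ (nbhs_filter z)) => e e0; apply/complex_nbhs.
exists e => // y hy; rewrite ler_norml; apply/andP; split.
  have := le_normcD (y - z) z; rewrite subrK -[y - z]opprB normcN; lra.
have := le_normcD (z - y) y; rewrite subrK; lra.
Qed.

Variable b : R.
Hypothesis Hdet : forall s : C, b <= complex.Re s -> \det (s%:M - M s) != 0.

(* The resolvent is continuous on a compact rectangle, and outside of it [norm s]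
   is so large that s G = 1 + G M bounds G. *)
Lemma delay_resolvent_bound : exists2 K : R, 0 < K &
  forall s : C, b <= complex.Re s -> mxsum (G s) <= K.
Proof.
pose m := mxsum AC + expR (- (b * tau)) * mxsum BC.
have m0 : 0 <= m by rewrite addr_ge0 ?mulr_ge0 ?expR_ge0 ?mxsum_ge0.
(* Points of the half plane outside the rectangle of size [r] have modulus at least [m + 1]. *)
pose r := Num.max `|b| (m + 1).
have r1 : m + 1 <= r by rewrite le_max lexx orbT.
have r2 : b <= r by rewrite le_max ler_norm.
pose f (z : R * R) := mxsum (G (z.1 +i* z.2)%C).
pose K : set (R * R) := (`[b, r]%classic `*` `[- r, r]%classic).
have cK : compact K by apply: compact_setX; exact: segment_compact.
have cf : {within K, continuous f}.
  apply: continuous_in_subspaceT => z /set_mem [/= /[!in_itv] /= /andP[bz _] _].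
  rewrite /f /mxsum.
  have cz : {for z, continuous (fun z : R * R => (z.1 +i* z.2)%C : C)}.
    by apply: continuous_complex; [exact: cvg_fst|exact: cvg_snd].
  apply: continuous1_sum => i _; apply: continuous1_sum => j _.
  have cG : {for (z.1 +i* z.2)%C, continuous (fun s => G s i j)}.
    apply: differentiable_continuous; apply/derivable1_diffP.
    by apply: derivable_delay_resolvent; exact: Hdet.
  exact: (continuous_comp (continuous_comp cz cG) (@continuous_normc _)).
have K0 : K !=set0.
  by exists (r, r); split; rewrite /= in_itv /= lexx ?r2 // andbT; lra.
have [c _ Hc] := compact_EVT_max K0 cK cf.
exists (Num.max (f c) n%:R + 1).
  by rewrite ltr_pwDr // le_max ler0n orbT.
move=> s bs; case: (lerP (m + 1) (normc s)) => [ms|ms].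
  have := congr1 (@mxsum R n n) (delay_resolventP (Hdet bs)); rewrite mxsumZ => E.
  have := mxsumD 1%:M (G s *m M s); rewrite -E mxsum1 => h1.
  have h2 := mxsumM (G s) (M s).
  have h3 := delay_symbol_bound bs; rewrite -/m in h3.
  have g0 := mxsum_ge0 (G s).
  (* With g the norm of [G s], the inequality [normc s * g <= n + g * m] and [normc s >= m + 1]
     leave [g <= n]. *)
  have h4 : mxsum (G s) <= n%:R by nra.
  by apply: le_trans h4 _; apply: (@le_trans _ _ (Num.max (f c) n%:R)); rewrite ?lerDl ?ler01 // le_max lexx orbT.
have := Hc (complex.Re s, complex.Im s).
have -> : f (complex.Re s, complex.Im s) = mxsum (G s) by rewrite /f /=; case: s {bs ms}.
move=> h; apply: (@le_trans _ _ (f c)); last first.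
  by apply: (@le_trans _ _ (Num.max (f c) n%:R)); rewrite ?lerDl ?ler01 // le_max lexx.
apply: h; apply: mem_set; split; rewrite /= in_itv /= ?bs.
  by apply: le_trans (le_trans (ler_norm _) (normc_re s)) _; lra.
by rewrite -ler_norml (le_trans (normc_im s)) //; lra.
Qed.

(* Perturbation: a left null vector of s - M(s) is a fixed point of a map whose
   norm is less than 1 when s is close to the half plane where the resolvent is
   bounded. *)
Lemma delay_resolvent_gap : exists2 gam : R, 0 < gam &
  forall s : C, b - gam <= complex.Re s -> \det (s%:M - M s) != 0.
Proof.
have [K K0 HK] := delay_resolvent_bound.
(* This bounds [K] times the norm of the change of s - M(s) when s moves by [g]. It is continuous
   and vanishes at 0, so some positive [g] makes it less than 1. *)
pose f (g : R) := K * (g * n%:R + expR (- (b * tau)) * (expR (tau * g) - 1) * mxsum BC).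
have cf : {for 0, continuous f}.
  have ce := is_derive_continuous (is_derive_expRM tau 0).
  rewrite /prop_for /continuous_at /f; apply: cvgM; first exact: cvg_cst.
  apply: cvgD; first by apply: cvgM; [exact: cvg_id|exact: cvg_cst].
  apply: cvgM; last exact: cvg_cst.
  apply: cvgM; first exact: cvg_cst.
  by apply: cvgB; [exact: ce|exact: cvg_cst].
have f0 : f 0 = 0 by rewrite /f mulr0 expR0 subrr; ring.
have fn : \forall g \near (0 : R), f g < 1.
  have lt1 : f 0 < 1 by rewrite f0 ltr01.
  exact: (@cvgr_lt R R (nbhs (0 : R)) _ f (f 0) cf 1 lt1).
have [e /= e0 He] := (nbhs_ballP _ _).1 fn.
pose g := e / 2.
have g0 : 0 < g by rewrite /g; lra.
have fg : f g < 1 by apply: He; rewrite /ball /= sub0r normrN gtr0_norm // /g; lra.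
exists g => // s bs; apply/negP => /det0P [v v0 hv].
pose q := s + g%:C%C.
have bq : b <= complex.Re q by rewrite /q raddfD /=; lra.
have uq : q%:M - M q \in unitmx by rewrite unitmxE unitfE Hdet.
pose Pt := g%:C%C%:M + (cexp (- q * tau%:C%C) * (cexp (g%:C%C * tau%:C%C) - 1)) *: BC.
have E : q%:M - M q = (s%:M - M s) + Pt.
  have ec : cexp (- s * tau%:C%C) = cexp (- q * tau%:C%C) * cexp (g%:C%C * tau%:C%C).
    by rewrite -cexpD; congr cexp; rewrite /q; ring.
  apply/matrixP => i j; rewrite /Pt !mxE ec {1}/q mulrnDl.
  by move: (cexp _) (cexp _) => c1 c2; ring.
have vE : v = v *m Pt *m G q.
  have -> : v *m Pt = v *m (q%:M - M q) by rewrite E [RHS]mulmxDr hv add0r.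
  by rewrite -mulmxA mulmxV // mulmx1.
have vn : 0 < mxsum v.
  rewrite lt_neqAle mxsum_ge0 andbT eq_sym; apply: contraNneq v0 => /mxsum_eq0 ->.
  exact: eqxx.
have hP : mxsum Pt * K <= f g.
  rewrite mulrC /f ler_wpM2l ?(ltW K0) //.
  apply: le_trans (mxsumD _ _) _; rewrite mxsumZ -scalemx1 mxsumZ mxsum1 normc_real gtr0_norm //.
  rewrite lerD2l ler_wpM2r ?mxsum_ge0 // normcM.
  have e1 : cexp (g%:C%C * tau%:C%C) - 1 = (expR (tau * g) - 1)%:C%C.
    rewrite -rmorphM /= [g * tau]mulrC /cexp /= cos0 sin0.
    by rewrite (_ : (1 +i* 0)%C = 1) // mulr1 rmorphB rmorph1.
  have eg : 0 <= expR (tau * g) - 1.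
    by have := expR_ge1Dx (tau * g); have := mulr_gt0 tau0 g0; lra.
  rewrite e1 normc_real ger0_norm // ler_wpM2r //.
  rewrite normc_cexp ler_expR; case: (q) bq => x y /= bq; have := ler_wpM2r (ltW tau0) bq; lra.
have : mxsum v <= mxsum v * f g.
  rewrite {1}vE; apply: le_trans (mxsumM _ _) _.
  apply: (@le_trans _ _ (mxsum v * mxsum Pt * K)).
    by apply: ler_pM; rewrite ?mxsum_ge0 ?HK ?mxsumM.
  by rewrite -mulrA ler_wpM2l ?mxsum_ge0.
by apply/negP; rewrite -ltNge gtr_pMr.
Qed.

End Resolvent.

Section MatrixCalculus.
Variable K : numFieldType.

Lemma is_derive_mulmx m n p (F : K -> 'M[K]_(m, n)) (H : K -> 'M[K]_(n, p))
    (F' : 'M[K]_(m, n)) (H' : 'M[K]_(n, p)) (s : K) :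
  (forall i j, is_derive s 1 (fun z => F z i j) (F' i j)) ->
  (forall i j, is_derive s 1 (fun z => H z i j) (H' i j)) ->
  forall i j, is_derive s 1 (fun z => (F z *m H z) i j) ((F' *m H s + F s *m H') i j).
Proof.
move=> dF dH i j; rewrite !mxE -big_split /=; under eq_fun do rewrite mxE.
exact: (@is_derive1_sum K _ _ xpredT (fun k z => F z i k * H z k j)
  (fun k => F' i k * H s k j + F s i k * H' k j) s
  (fun k _ => is_derive1_Mr (dF i k) (dH k j) erefl)).
Qed.

Lemma is_derive_scalemx m n (f : K -> K) (F : K -> 'M[K]_(m, n)) (f' : K)
    (F' : 'M[K]_(m, n)) (s : K) :
  is_derive s 1 f f' ->
  (forall i j, is_derive s 1 (fun z => F z i j) (F' i j)) ->
  forall i j, is_derive s 1 (fun z => (f z *: F z) i j) ((f' *: F s + f s *: F') i j).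
Proof.
move=> df dF i j; rewrite !mxE; under eq_fun do rewrite mxE.
exact: (is_derive1_Mr df (dF i j) erefl).
Qed.

Lemma continuous_mulmx_entry m n p (F : K -> 'M[K]_(m, n)) (H : K -> 'M[K]_(n, p)) (s : K) :
  (forall i j, {for s, continuous (fun z => F z i j)}) ->
  (forall i j, {for s, continuous (fun z => H z i j)}) ->
  forall i j, {for s, continuous (fun z => (F z *m H z) i j)}.
Proof.
move=> cF cH i j; rewrite (_ : (fun z => _) = fun z => \sum_k F z i k * H z k j); last first.
  by apply/funext => z; rewrite mxE.
apply: continuous1_sum => k _; exact: continuous1_M.
Qed.

Lemma continuous_scalemx_entry m n (f : K -> K) (F : K -> 'M[K]_(m, n)) (s : K) :
  {for s, continuous f} ->
  (forall i j, {for s, continuous (fun z => F z i j)}) ->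
  forall i j, {for s, continuous (fun z => (f z *: F z) i j)}.
Proof.
move=> cf cF i j; rewrite (_ : (fun z => _) = fun z => f z * F z i j); last first.
  by apply/funext => z; rewrite mxE.
exact: continuous1_M.
Qed.

Lemma continuous_addmx_entry m n (F H : K -> 'M[K]_(m, n)) (s : K) :
  (forall i j, {for s, continuous (fun z => F z i j)}) ->
  (forall i j, {for s, continuous (fun z => H z i j)}) ->
  forall i j, {for s, continuous (fun z => (F z + H z) i j)}.
Proof.
move=> cF cH i j; rewrite (_ : (fun z => _) = fun z => F z i j + H z i j); last first.
  by apply/funext => z; rewrite mxE.
have h := cvgD (cF i j) (cH i j); exact: h.
Qed.

Lemma continuous_cstmx_entry m n (F : 'M[K]_(m, n)) (s : K) i j :
  {for s, continuous (fun _ : K => F i j)}.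
Proof. exact: cst_continuous. Qed.

Lemma is_derive_near_eq (f g : K -> K) (s d : K) :
  (\forall z \near s, f z = g z) -> is_derive s 1 f d -> is_derive s 1 g d.
Proof. by move=> n; apply: near_eq_is_derive. Qed.

End MatrixCalculus.

(** * The transform of the fundamental matrix without its slow part *)

Section FundamentalTransform.
Import ComplexField.Normc.
Variable R : realType.
Local Notation C := (complex R).
Variables (n : nat) (A B : 'M[R]_n) (tau b0 : R).
Hypotheses (tau0 : 0 < tau) (b01 : 1 < b0).
Local Notation AC := (map_mx (fun r : R => r%:C%C) A).
Local Notation BC := (map_mx (fun r : R => r%:C%C) B).
Local Notation M := (delay_symbol A B tau).
Local Notation M' := (delay_symbol' B tau).
Local Notation G := (delay_resolvent A B tau).
Hypothesis Hdet : forall s : C, b0 <= complex.Re s -> \det (s%:M - M s) != 0.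

Definition resolvent_derivative (s : C) : 'M[C]_n := - (G s *m (1%:M - M' s) *m G s).
Local Notation G' := resolvent_derivative.

(* The Laplace transform (s - M(s))^-1 of the fundamental matrix decays only like
   1/s. Its part 1/s + M(s)/s^2 is inverted by hand, and what remains is
   M(s)^2 (s - M(s))^-1 / s^2, whose inversion integral converges absolutely even
   after multiplication by s. *)
Definition fund_symbol (s : C) : 'M[C]_n := s ^- 2 *: (M s *m M s *m G s).
Definition fund_symbol' (s : C) : 'M[C]_n :=
  (- 2%:R * s ^- 3) *: (M s *m M s *m G s) +
  s ^- 2 *: ((M' s *m M s + M s *m M' s) *m G s + M s *m M s *m G' s).

Let s_neq0 (s : C) : b0 < complex.Re s -> s != 0.
Proof. by move=> h; apply: Re_gt0_neq0; apply: lt_trans h; exact: lt_trans b01. Qed.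

(** Cramer's formula gives differentiability but an unwieldy derivative. Its value comes from
    differentiating [G z *m (z%:M - M z) = 1%:M] near [s]. *)
Lemma is_derive_delay_resolvent (s : C) i j : b0 < complex.Re s ->
  is_derive s 1 (fun z => G z i j) (G' s i j).
Proof.
move=> hs.
have d0 := Hdet (ltW hs).
pose D : 'M[C]_n := \matrix_(i, j) 'D_1 (fun z => G z i j) s.
have dG k l : is_derive s 1 (fun z => G z k l) (D k l).
  by rewrite mxE; apply/derivableP; apply: derivable_delay_resolvent.
have dDel k l : is_derive s 1 (fun z : C => (z%:M - M z) k l) ((1%:M - M' s) k l).
  have h1 : is_derive s 1 (fun z : C => z *+ (k == l)) ((k == l)%:R : C).
    case: (k == l); last by under eq_fun do rewrite mulr0n; exact: is_derive_cst.
    by under eq_fun do rewrite mulr1n; exact: is_derive_id.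
  rewrite (_ : (fun z => _) = fun z => z *+ (k == l) - M z k l); last first.
    by apply/funext => z; rewrite !mxE.
  rewrite (_ : (1%:M - M' s) k l = (k == l)%:R - M' s k l); last by rewrite !mxE.
  exact: (@is_deriveB C C C _ _ _ _ _ _ h1 (is_derive_delay_symbol _ _ _ _ _ _)).
have nb : \forall z \near s, G z *m (z%:M - M z) = 1%:M.
  apply/complex_nbhs; exists (complex.Re s - b0); first by rewrite subr_gt0.
  move=> z hz; apply: mulVmx; rewrite unitmxE unitfE; apply: Hdet.
  by have := le_lt_trans (normc_re _) hz; rewrite raddfB /= => /ltr_normlP[]; lra.
have E : D *m (s%:M - M s) + G s *m (1%:M - M' s) = 0.
  apply/matrixP => k l; have d1 := is_derive_mulmx dG dDel k l.
  have d2 : is_derive s 1 (fun _ : C => (1%:M : 'M[C]_n) k l) 0 by exact: is_derive_cst.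
  have : is_derive s 1 (fun _ : C => (1%:M : 'M[C]_n) k l)
     ((D *m (s%:M - M s) + G s *m (1%:M - M' s)) k l).
    apply: is_derive_near_eq d1; apply: filterS nb => z ->; exact: erefl.
  by case=> _ <-; case: d2 => _ ->; rewrite mxE.
have u : s%:M - M s \in unitmx by rewrite unitmxE unitfE.
have -> : G' s = D; last exact: dG.
move/eqP: E; rewrite addr_eq0 => /eqP /(congr1 (mulmx^~ (G s))).
rewrite -mulmxA mulmxV // mulmx1 => ->.
by rewrite mulNmx.
Qed.

Lemma is_derive_fund_symbol (s : C) i j : b0 < complex.Re s ->
  is_derive s 1 (fun z => fund_symbol z i j) (fund_symbol' s i j).
Proof.
move=> hs.
have dM := @is_derive_delay_symbol R n A B tau s.
apply: (is_derive_scalemx (is_derive_expVn 1 (s_neq0 hs)) _ i j).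
apply: is_derive_mulmx => k l; last exact: is_derive_delay_resolvent.
exact: is_derive_mulmx.
Qed.

Let cM (s : C) i j : {for s, continuous (fun z => M z i j)}.
Proof. exact: is_derive_continuous (is_derive_delay_symbol _ _ _ _ _ _). Qed.

Let cM' (s : C) i j : {for s, continuous (fun z => M' z i j)}.
Proof.
apply: continuous_scalemx_entry => [|k l]; last exact: continuous_cstmx_entry.
apply: (@continuous1_M C); first exact: cst_continuous.
exact: is_derive_continuous (is_derive_cexpN _ _).
Qed.

Let cG (s : C) : b0 < complex.Re s -> forall i j, {for s, continuous (fun z => G z i j)}.
Proof. by move=> hs i j; exact: is_derive_continuous (is_derive_delay_resolvent i j hs). Qed.

Lemma continuous_fund_symbol' (s : C) i j : b0 < complex.Re s ->
  {for s, continuous (fun z => fund_symbol' z i j)}.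
Proof.
move=> hs; have s0 := s_neq0 hs; have cGs := @cG s hs.
have cMM := @continuous_mulmx_entry C n n n M M s (@cM s) (@cM s).
have cc (a : C) : {for s, continuous (fun _ : C => a)} by exact: cst_continuous.
have cI := @continuous_addmx_entry C n n (fun=> 1%:M) (fun z => (-1) *: M' z) s
  (@continuous_cstmx_entry C n n (1%:M) s)
  (@continuous_scalemx_entry C n n (fun=> -1) M' s (cc _) (@cM' s)).
have cGIG := @continuous_mulmx_entry C n n n _ G s
  (@continuous_mulmx_entry C n n n G _ s cGs cI) cGs.
have cG'0 := @continuous_scalemx_entry C n n (fun=> -1) _ s (cc _) cGIG.
have cG' k l : {for s, continuous (fun z => G' z k l)}.
  rewrite (_ : (fun z => _) =
    fun z => ((-1) *: (G z *m (1%:M + (-1) *: M' z) *m G z)) k l); first exact: cG'0.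
  by apply/funext => z; rewrite !scaleN1r.
have cMMG := @continuous_mulmx_entry C n n n _ G s cMM cGs.
have ce2 := is_derive_continuous (is_derive_expVn 1 s0).
have ce3 := is_derive_continuous (is_derive_expVn 2 s0).
have h1 := @continuous_scalemx_entry C n n (fun z : C => - 2%:R * z ^- 3) _ s
  (@continuous1_M C _ _ s (cc (- 2%:R)) ce3) cMMG.
have cM'M := @continuous_mulmx_entry C n n n M' M s (@cM' s) (@cM s).
have cMM' := @continuous_mulmx_entry C n n n M M' s (@cM s) (@cM' s).
have h2 := @continuous_mulmx_entry C n n n _ G s (@continuous_addmx_entry C n n _ _ s cM'M cMM') cGs.
have h3 := @continuous_mulmx_entry C n n n _ G' s cMM cG'.
have h4 := @continuous_scalemx_entry C n n _ _ s ce2 (@continuous_addmx_entry C n n _ _ s h2 h3).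
exact: (@continuous_addmx_entry C n n _ _ s h1 h4 i j).
Qed.

(** On the half plane [M], [M'] and [G] are bounded, so the powers of 1/s supply the decay.
    Multiplication by [s] is harmless because [s *: G s = 1 + G s M s] is bounded as well. *)
Lemma fund_symbol_bounds : exists2 c : R, 0 < c & forall s : C, b0 < complex.Re s -> forall i j,
  [/\ normc (fund_symbol s i j) <= c * (oneDsqr (complex.Im s))^-1,
      normc (fund_symbol' s i j) <= c * (oneDsqr (complex.Im s))^-1,
      normc (s * fund_symbol s i j) <= c * (oneDsqr (complex.Im s))^-1 &
      normc (s ^- 2 * (M s *m M s) i j) <= c * (oneDsqr (complex.Im s))^-1 ].
Proof.
have [K K0 HK] := delay_resolvent_bound tau0 Hdet.
have [m m0 HM] : exists2 m : R, 0 <= m & forall s : C, b0 <= complex.Re s -> mxsum (M s) <= m.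
  exists (mxsum AC + expR (- (b0 * tau)) * mxsum BC).
    by rewrite addr_ge0 ?mulr_ge0 ?expR_ge0 ?mxsum_ge0.
  by move=> s; exact: delay_symbol_bound.
have [m' m'0 HM'] : exists2 m : R, 0 <= m & forall s : C, b0 <= complex.Re s -> mxsum (M' s) <= m.
  exists (tau * expR (- (b0 * tau)) * mxsum BC).
    by rewrite !mulr_ge0 ?expR_ge0 ?mxsum_ge0 ?(ltW tau0).
  by move=> s; exact: delay_symbol'_bound.
have K00 := ltW K0.
pose c1 := m * m * K.
(* [c2] follows the product rule, with [K * (n + m') * K] for the derivative of the resolvent; in
   [c3] the factor [n + K * m] bounds [s *: G s]. *)
pose c2 := 2 * (m * m * K) + ((m' * m + m * m') * K + m * m * (K * (n%:R + m') * K)).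
pose c3 := m * m * (n%:R + K * m).
have nn : 0 <= n%:R :> R by exact: ler0n.
have c10 : 0 <= c1 by rewrite /c1; do ?[apply: addr_ge0 | apply: mulr_ge0].
have c20 : 0 <= c2 by rewrite /c2; do ?[apply: addr_ge0 | apply: mulr_ge0].
have c30 : 0 <= c3 by rewrite /c3; do ?[apply: addr_ge0 | apply: mulr_ge0].
exists (c1 + c2 + c3 + m * m + 1); first by have := mulr_ge0 m0 m0; lra.
move=> s hs i j.
have gM : mxsum (M s) <= m by exact: HM (ltW hs).
have gM' : mxsum (M' s) <= m' by exact: HM' (ltW hs).
have gG : mxsum (G s) <= K by exact: HK (ltW hs).
have re1 : 1 <= complex.Re s by rewrite ltW // (lt_trans b01).
have mulb k l p (X : 'M[C]_(k, l)) (Y : 'M[C]_(l, p)) (x y : R) : mxsum X <= x -> mxsum Y <= y ->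
    mxsum (X *m Y) <= x * y.
  by move=> hx hy; apply: le_trans (mxsumM _ _) _; apply: ler_pM; rewrite ?mxsum_ge0.
have addb k l (X Y : 'M[C]_(k, l)) (x y : R) : mxsum X <= x -> mxsum Y <= y -> mxsum (X + Y) <= x + y.
  by move=> hx hy; apply: le_trans (mxsumD _ _) _; exact: lerD.
have oppb k l (X : 'M[C]_(k, l)) (x : R) : mxsum X <= x -> mxsum (- X) <= x.
  by rewrite -scaleN1r mxsumZ normcN normc1 mul1r.
set o := (oneDsqr (complex.Im s))^-1.
have o0 : 0 <= o by exact: oneDsqrV_ge0.
have b1 : mxsum (M s *m M s *m G s) <= c1 by apply: (mulb _ _ _ _ _ _ _ (mulb _ _ _ _ _ _ _ gM gM) gG).
have bone : mxsum (1%:M : 'M[C]_n) <= n%:R by rewrite mxsum1.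
have bG' : mxsum (G' s) <= K * (n%:R + m') * K.
  by apply: (oppb); apply: (mulb) => //; apply: (mulb) => //; apply: (addb) => //; exact: oppb.
have step (X : 'M[C]_n) (a : C) (x : R) : mxsum X <= x -> normc a <= o -> mxsum (a *: X) <= x * o.
  by move=> hX ha; rewrite mxsumZ mulrC; apply: ler_pM; rewrite ?mxsum_ge0 ?normc_ge0.
have s2 : normc (s ^- 2) <= o by exact: normc_pow_le.
have s3 : normc (s ^- 3) <= o by exact: normc_pow_le.
have fin (X : 'M[C]_n) (x : R) : mxsum X <= x * o -> x <= c1 + c2 + c3 + m * m + 1 ->
    normc (X i j) <= (c1 + c2 + c3 + m * m + 1) * o.
  move=> hX hx; apply: le_trans (normc_le_mxsum _ _ _) _; apply: le_trans hX _.
  by rewrite ler_wpM2r.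
have mm0 : 0 <= m * m by rewrite mulr_ge0.
split.
- by apply: (fin _ c1); [exact: step|lra].
- apply: (fin _ c2); last lra.
  rewrite /c2 mulrDl; apply: (addb).
    rewrite -scalerA mxsumZ normcN -[2%:R](rmorph_nat (real_complex R)) normc_real ger0_norm //.
    by rewrite -mulrA ler_wpM2l //; exact: step.
  apply: (step) => //; apply: (addb); first by apply: (mulb) => //; apply: (addb); exact: mulb.
  by apply: (mulb) => //; exact: mulb.
- have -> : s * fund_symbol s i j = (s ^- 2 *: (M s *m M s *m (s *: G s))) i j.
    by rewrite -scalemxAr [in LHS]mxE [in RHS]mxE [in RHS]mxE mulrCA.
  apply: (fin _ c3); last lra.
  rewrite delay_resolventP ?Hdet ?(ltW hs) //; apply: (step) => //.
  have bGM : mxsum (1%:M + G s *m M s) <= n%:R + K * m := addb _ _ _ _ _ _ bone (mulb _ _ _ _ _ _ _ gG gM).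
  rewrite /c3; apply: le_trans (mxsumM _ _) _; apply: ler_pM; rewrite ?mxsum_ge0 //.
  exact: mulb.
- have -> : s ^- 2 * (M s *m M s) i j = (s ^- 2 *: (M s *m M s)) i j by rewrite [in RHS]mxE.
  by apply: (fin _ (m * m)); [apply: (step) => //; exact: mulb|lra].
Qed.

End FundamentalTransform.

Section LineBounded.
Import ComplexField.Normc.
Variable R : realType.
Local Notation C := (complex R).

Lemma line_boundedD (b c1 c2 : R) (H1 H2 : C -> C) :
  line_bounded b c1 H1 -> line_bounded b c2 H2 ->
  line_bounded b (c1 + c2) (fun s => H1 s + H2 s).
Proof.
move=> [h1 h2] [h3 h4]; split=> w; first exact: (@continuousD C C C _ _ _ (h1 w) (h3 w)).
by rewrite mulrDl; apply: le_trans (le_normcD _ _) _; exact: lerD.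
Qed.

Lemma line_bounded_sum (b : R) (I : Type) (r : seq I) (P : pred I) (c : I -> R) (H : I -> C -> C) :
  (forall i, P i -> line_bounded b (c i) (H i)) ->
  line_bounded b (\sum_(i <- r | P i) c i) (fun s => \sum_(i <- r | P i) H i s).
Proof.
move=> h; split=> w.
  by apply: (@continuous1_sum C C C) => i Pi; exact: (h i Pi).1.
rewrite mulr_suml; apply: le_trans (normc_sum _ _ _) _; apply: ler_sum => i Pi.
exact: (h i Pi).2.
Qed.

Lemma line_bounded_shift (b c u : R) (H : C -> C) : line_bounded b c H ->
  line_bounded b (expR (- (b * u)) * c) (fun s => cexp (- s * u%:C%C) * H s).
Proof.
move=> [cH bH]; split=> w.
  exact: (@continuous1_M C _ H _ (is_derive_continuous (is_derive_cexpN u _)) (cH w)).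
rewrite normcM normc_cexp -mulrA (_ : complex.Re _ = - (b * u)) ?ler_wpM2l ?expR_ge0 //=.
by rewrite mulr0 subr0 mulNr.
Qed.

Lemma left0_eq0 (f : R -> R) (d : R) :
  is_derive (0 : R) 1 f d -> (forall t, t < 0 -> f t = 0) -> f 0 = 0.
Proof.
move=> /is_derive1_realP h f0; apply/eqP; rewrite -normr_le0 leNgt; apply/negP => F0.
have [del d0 hd] := h 1 ltr01.
have d1 : 0 < `|d| + 1 by rewrite ltr_wpDl.
pose z := Num.min (del / 2) (`|f 0| / (`|d| + 1) / 2).
have z0 : 0 < z by rewrite lt_min !divr_gt0.
have zd : z < del by rewrite gt_min; apply/orP; left; lra.
have zf : z <= `|f 0| / (`|d| + 1) / 2 by rewrite ge_min lexx orbT.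
have := hd (- z); rewrite normrN (gtr0_norm z0) add0r => /(_ zd).
rewrite f0 ?oppr_lt0 // sub0r mulrN opprK mul1r => h2.
have : `|f 0| <= z + `|d| * z.
  have -> : f 0 = d * z - (- f 0 + d * z) by ring.
  apply: le_trans (ler_normB _ _) _; rewrite normrM (gtr0_norm z0); lra.
have : z * (`|d| + 1) <= `|f 0| / 2.
  by rewrite -ler_pdivlMr // mulrAC.
lra.
Qed.

Lemma is_derive_ramp (u : R) : u != 0 ->
  is_derive u 1 (fun v => Num.max v 0) (if 0 < u then 1 else 0).
Proof.
case: (ltgtP u 0) => // u0 _ /=.
  have h : is_derive u 1 (fun _ : R => 0 : R) 0 by exact: is_derive_cst.
  apply: is_derive_near_eq h.
  by near=> z; rewrite max_r //; apply: ltW; near: z; exact: lt_nbhsl.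
have h : is_derive u 1 (fun z : R => z) 1 by exact: is_derive_id.
apply: is_derive_near_eq h.
by near=> z; rewrite max_l //; apply: ltW; near: z; exact: lt_nbhsr.
Unshelve. all: by end_near. Qed.

End LineBounded.

(** * Construction of the fundamental matrix *)

Section FundamentalMatrix.
Import ComplexField.Normc.
Variable R : realType.
Local Notation C := (complex R).
Variables (n : nat) (A B : 'M[R]_n) (tau b0 b : R).
Hypotheses (tau0 : 0 < tau) (b01 : 1 < b0) (b0b : b0 < b).
Hypothesis Hdet : forall s : C, b0 <= complex.Re s -> \det (s%:M - delay_symbol A B tau s) != 0.
Local Notation H i j := (fun s : C => fund_symbol A B tau s i j).
Local Notation ramp t := (Num.max t 0).

Let Rm (t : R) : 'M[R]_n := \matrix_(i, j) line_transform b (H i j) t.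

Let lbH : exists c : R, forall i j, line_bounded b c (H i j) /\
  line_bounded b c (fun s => s * fund_symbol A B tau s i j).
Proof.
have [c c0 hc] := fund_symbol_bounds tau0 b01 Hdet; exists c => i j.
have cH w : {for (b +i* w)%C, continuous (H i j)}.
  have d : is_derive (b +i* w)%C 1 (H i j) (fund_symbol' A B tau (b +i* w)%C i j).
    exact: (is_derive_fund_symbol b01 Hdet i j (s := (b +i* w)%C) b0b).
  exact: is_derive_continuous d.
have cid (z : C) : {for z, continuous (fun s : C => s : C)} by move=> P; exact.
split.
  by split; [exact: cH|move=> w; have [] := hc (b +i* w)%C b0b i j].
split=> w; last by have [] := hc (b +i* w)%C b0b i j.
exact: (@continuous1_M C _ _ _ (cid _) (cH w)).
Qed.

Let Rm_neg t : t < 0 -> Rm t = 0.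
Proof.
move=> t0; apply/matrixP => i j; rewrite !mxE.
have [c c0 hc] := fund_symbol_bounds tau0 b01 Hdet.
apply: (@line_transform_eq0 R b0 c t (H i j) (fun s => fund_symbol' A B tau s i j)) => //.
- by move=> s hs; exact: (is_derive_fund_symbol b01 Hdet i j hs).
- by move=> s hs; exact: (continuous_fund_symbol' b01 Hdet hs).
- by move=> s hs; have [] := hc s hs i j.
- by move=> s hs; have [] := hc s hs i j.
Qed.

(** The resolvent identity gives s F = M^2 / s^2 + F M for the symbol F. Expanding M = A + exp(-s
    tau) B turns this into a delay equation, since each factor exp(-s u) becomes a delay by u. *)
Let fund_symbolE (s : C) i j : b0 < complex.Re s ->
  s * fund_symbol A B tau s i j =
  ((((A *m A) i j)%:C%C * s ^- 2 +
    cexp (- s * tau%:C%C) * (((A *m B + B *m A) i j)%:C%C * s ^- 2)) +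
    cexp (- s * (2 * tau)%:C%C) * (((B *m B) i j)%:C%C * s ^- 2)) +
  (\sum_k (A k j)%:C%C * fund_symbol A B tau s i k +
   cexp (- s * tau%:C%C) * \sum_k (B k j)%:C%C * fund_symbol A B tau s i k).
Proof.
move=> hs.
pose AC := map_mx (fun r : R => r%:C%C) A; pose BC := map_mx (fun r : R => r%:C%C) B.
pose e := cexp (- s * tau%:C%C).
have E1 : s *: fund_symbol A B tau s =
    s ^- 2 *: (delay_symbol A B tau s *m delay_symbol A B tau s) +
    fund_symbol A B tau s *m delay_symbol A B tau s.
  rewrite /fund_symbol scalerA mulrC -scalerA [s *: _]scalemxAr.
  by rewrite delay_resolventP ?Hdet ?(ltW hs) // mulmxDr mulmx1 scalerDr -scalemxAl !mulmxA.
have := congr1 (fun X : 'M[C]_n => X i j) E1; rewrite [in LHS]mxE => ->.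
have -> : cexp (- s * (2 * tau)%:C%C) = e * e.
  by rewrite -cexpD; congr cexp; rewrite rmorphM rmorph_nat; ring.
have toC (X Y : 'M[R]_n) : (map_mx (fun r : R => r%:C%C) X *m map_mx (fun r : R => r%:C%C) Y) = map_mx (fun r : R => r%:C%C) (X *m Y).
  apply/matrixP => k l; rewrite !mxE rmorph_sum; apply: eq_bigr => p _.
  by rewrite !mxE rmorphM.
have -> : delay_symbol A B tau s = AC + e *: BC by [].
rewrite -/e; move: (fund_symbol A B tau s) => F.
rewrite mulmxDl !mulmxDr -!scalemxAl -!scalemxAr !toC.
rewrite [LHS]mxE; congr (_ + _).
  move: (A *m A) (A *m B) (B *m A) (B *m B) e (s ^- 2) => X1 X2 X3 X4 x y.
  by rewrite !mxE rmorphD /=; ring.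
rewrite [LHS]mxE; congr (_ + _).
  by rewrite mxE; apply: eq_bigr => k _; rewrite mxE mulrC.
rewrite [LHS]mxE [in LHS]mxE; congr (_ * _).
by apply: eq_bigr => k _; rewrite mxE mulrC.
Qed.

Let is_derive_Rm (kap : R) : 
  (forall t, line_transform b (fun s : C => s ^- 2) t = kap * ramp t) ->
  forall (t : R) i j, is_derive t 1 (fun u => Rm u i j)
   ((kap *: (ramp t *: (A *m A) + ramp (t - tau) *: (A *m B + B *m A) +
     ramp (t - 2 * tau) *: (B *m B)) + (Rm t *m A + Rm (t - tau) *m B)) i j).
Proof.
move=> hk t i j.
have [c hc] := lbH; have [h1 h2] := hc i j.
rewrite (_ : (fun u => Rm u i j) = line_transform b (H i j)); last first.
  by apply/funext => u; rewrite mxE.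
have := is_derive_line_transform t h1 h2.
have b1 : 1 <= b by rewrite ltW // (lt_trans b01).
have k2 := line_bounded_expVn b1 (isT : (1 < 2)%N).
have l1 := line_boundedZ ((A *m A) i j)%:C%C k2.
have l2' := line_boundedZ ((A *m B + B *m A) i j)%:C%C k2.
have l2 := line_bounded_shift tau l2'.
have l3' := line_boundedZ ((B *m B) i j)%:C%C k2.
have l3 := line_bounded_shift (2 * tau) l3'.
have l4 := @line_bounded_sum R b _ (index_enum 'I_n) xpredT _ (fun k s => (A k j)%:C%C * fund_symbol A B tau s i k)
   (fun k _ => line_boundedZ (A k j)%:C%C (hc i k).1).
have l5' := @line_bounded_sum R b _ (index_enum 'I_n) xpredT _ (fun k s => (B k j)%:C%C * fund_symbol A B tau s i k)
   (fun k _ => line_boundedZ (B k j)%:C%C (hc i k).1).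
have l5 := line_bounded_shift tau l5'.
have l12 := line_boundedD l1 l2; have l123 := line_boundedD l12 l3; have l45 := line_boundedD l4 l5.
pose T (s : C) :=
  ((((A *m A) i j)%:C%C * s ^- 2 +
    cexp (- s * tau%:C%C) * (((A *m B + B *m A) i j)%:C%C * s ^- 2)) +
    cexp (- s * (2 * tau)%:C%C) * (((B *m B) i j)%:C%C * s ^- 2)) +
  (\sum_k (A k j)%:C%C * fund_symbol A B tau s i k +
   cexp (- s * tau%:C%C) * \sum_k (B k j)%:C%C * fund_symbol A B tau s i k).
rewrite (@eq_line_transform R b (fun s => s * fund_symbol A B tau s i j) T t
  (fun w => fund_symbolE i j (s := (b +i* w)%C) b0b)) /T.
rewrite (line_transformD t l123 l45) (line_transformD t l12 l3) (line_transformD t l1 l2) (line_transformD t l4 l5).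
rewrite !line_transform_shift (line_transformZ _ _ k2) (line_transformZ _ _ k2) (line_transformZ _ _ k2) !hk.
rewrite (line_transform_sum _ _ (fun k _ => line_boundedZ (A k j)%:C%C (hc i k).1)).
rewrite (line_transform_sum _ _ (fun k _ => line_boundedZ (B k j)%:C%C (hc i k).1)).
set S1 := \sum_k _; set S2 := \sum_k _.
have -> : S1 = (Rm t *m A) i j.
  by rewrite mxE; apply: eq_bigr => k _; rewrite (line_transformZ _ _ (hc i k).1) mxE mulrC.
have -> : S2 = (Rm (t - tau) *m B) i j.
  by rewrite mxE; apply: eq_bigr => k _; rewrite (line_transformZ _ _ (hc i k).1) mxE mulrC.
move: (Rm t *m A) (Rm (t - tau) *m B) (A *m A) (A *m B) (B *m A) (B *m B) => X1 X2 X3 X4 X5 X6.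
by move=> h; apply: (is_derive_eq h); rewrite !mxE; ring.
Qed.

Theorem fundamental_matrix : exists X : R -> 'M[R]_n, exists2 K : R, 0 < K &
  [/\ forall t, t < 0 -> X t = 0,
      X 0 = 1%:M,
      forall i j, continuous (fun t : R => X (ramp t) i j),
      forall (t : R) i j, 0 < t -> t != tau ->
        is_derive t 1 (fun u => X u i j) ((X t *m A + X (t - tau) *m B) i j) &
      forall t i j, `|X t i j| <= K * expR (b * t) ].
Proof.
have b1 : 1 < b by rewrite (lt_trans b01).
have [kap kap0 hk] := line_transform_expV2 b1.
have dRm := is_derive_Rm hk.
have [c hc] := lbH.
(* The inverse transforms of 1/s, of M(s)/s^2 (a ramp and a delayed ramp) and of the remainder, the
   last one normalised by [kap]. *)
pose Y (t : R) : 'M[R]_n := 1%:M + ramp t *: A + ramp (t - tau) *: B + kap^-1 *: Rm t.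
have Rm0 : Rm 0 = 0.
  apply/matrixP => i j; rewrite [RHS]mxE.
  by apply: left0_eq0 (dRm 0 i j) _ => t t0; rewrite Rm_neg // mxE.
have cY i j : continuous (fun t : R => Y t i j).
  move=> t; rewrite (_ : (fun t => _) = fun t =>
    (i == j)%:R + ramp t * A i j + ramp (t - tau) * B i j + kap^-1 * Rm t i j); last first.
    by apply/funext => u; rewrite !mxE.
  have cr (v : R) : {for v, continuous (fun u : R => ramp u)}.
    by apply: continuous_max; [exact: cvg_id|exact: cvg_cst].
  have cr2 : {for t, continuous (fun u : R => ramp (u - tau))}.
    apply: (@continuous_comp _ _ _ (fun u : R => u - tau) (fun u => ramp u)); last exact: cr.
    by apply: continuousB; [exact: cvg_id|exact: cvg_cst].
  have cR : {for t, continuous (fun u => Rm u i j)} := is_derive_continuous (dRm t i j).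
  rewrite /continuous_at; apply: cvgD; last by apply: cvgM; [exact: cvg_cst|exact: cR].
  apply: cvgD; last by apply: cvgM; [exact: cr2|exact: cvg_cst].
  apply: cvgD; first exact: cvg_cst.
  by apply: cvgM; [exact: cr|exact: cvg_cst].
(* For t < 0 the formula [Y] still gives the identity, so the unit step belonging to 1/s is imposed
   by hand. *)
pose X t : 'M[R]_n := if t < 0 then 0 else Y t.
have XY t : 0 <= t -> X t = Y t by rewrite /X ltNge => ->.
pose P := lineint (fun w : R => (oneDsqr w)^-1).
pose K := 1 + mxsum (map_mx (fun r : R => r%:C%C) A) + mxsum (map_mx (fun r : R => r%:C%C) B) + `|kap^-1| * (`|c| * P).
have P0 : 0 <= P := lineint_oneDsqrV_ge0 R.
have K0 : 0 < K.
  have := mxsum_ge0 (map_mx (fun r : R => r%:C%C) A).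
  have := mxsum_ge0 (map_mx (fun r : R => r%:C%C) B).
  have : 0 <= `|kap^-1| * (`|c| * P) by rewrite !mulr_ge0.
  rewrite /K; lra.
exists X, K => //; split.
- by move=> t t0; rewrite /X t0.
- by rewrite XY // /Y Rm0 maxxx sub0r max_r ?oppr_le0 ?(ltW tau0) // !scale0r scaler0 !addr0.
- move=> i j; rewrite (_ : (fun t => _) = fun t => Y (ramp t) i j); last first.
    by apply/funext => t; rewrite XY // le_max lexx orbT.
  move=> t; apply: (@continuous_comp _ _ _ (fun u : R => ramp u) (fun u => Y u i j)); last exact: cY.
  by apply: continuous_max; [exact: cvg_id|exact: cvg_cst].
- move=> t i j t0 tt.
  have dY : is_derive t 1 (fun u => Y u i j)
      ((A + (if 0 < t - tau then 1 else 0) *: B + kap^-1 *: (kap *: (ramp t *: (A *m A) + ramp (t - tau) *: (A *m B + B *m A) +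
     ramp (t - 2 * tau) *: (B *m B)) + (Rm t *m A + Rm (t - tau) *m B))) i j).
    have ts : t - tau != 0 by rewrite subr_eq0.
    have dt : is_derive t 1 (fun u : R => u - tau) 1.
      have := is_deriveB (is_derive_id t (1 : R)) (is_derive_cst tau t (1 : R)).
      by rewrite subr0.
    have := @is_derive1_comp R (fun v => Num.max v 0) _ t _ _ (is_derive_ramp ts) dt.
    rewrite mulr1 => dr; have dB := is_deriveZ (B i j) dr.
    have dA := is_deriveZ (A i j) (is_derive_ramp (lt0r_neq0 t0)).
    have dc : is_derive t 1 (fun _ : R => (i == j)%:R : R) 0 by exact: is_derive_cst.
    move: (dRm t i j); move: (kap *: _ + _) => Z dZ.
    have h := is_deriveD (is_deriveD (is_deriveD dc dA) dB) (is_deriveZ kap^-1 dZ).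
    rewrite (_ : (fun u => _) = fun u : R => (i == j)%:R + A i j * ramp u +
        B i j * ramp (u - tau) + kap^-1 * Rm u i j); last first.
      by apply/funext => u; rewrite !mxE [ramp u * _]mulrC [ramp (u - tau) * _]mulrC.
    apply: (is_derive_eq h); rewrite t0 !scalerE add0r mulr1 ![in RHS]mxE.
    by rewrite [_ * B i j]mulrC.
  have -> : X t *m A + X (t - tau) *m B = A + (if 0 < t - tau then 1 else 0) *: B +
    kap^-1 *: (kap *: (ramp t *: (A *m A) + ramp (t - tau) *: (A *m B + B *m A) +
     ramp (t - 2 * tau) *: (B *m B)) + (Rm t *m A + Rm (t - tau) *m B)).
    rewrite (XY t (ltW t0)) /Y.
    case: (ltgtP (t - tau) 0) => ts.
    + have X0 : X (t - tau) = 0 by rewrite /X ts.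
      rewrite X0 mul0mx addr0 (Rm_neg ts) mul0mx addr0.
      rewrite (_ : ramp (t - 2 * tau) = 0); last by apply: max_r; lra.
      rewrite !scale0r !addr0 !mulmxDl mul1mx -!scalemxAl scalerDr scalerA mulVf // scale1r.
      by rewrite addrA.
    + rewrite (XY _ (ltW ts)) /Y (_ : t - tau - tau = t - 2 * tau); last by ring.
      rewrite !mulmxDl !mul1mx -!scalemxAl.
      move: (Rm t *m A) (Rm (t - tau) *m B) (A *m A) (A *m B) (B *m A) (B *m B) => X1 X2 X3 X4 X5 X6.
      rewrite (max_l (ltW ts)); move: (ramp t) (ramp (t - 2 * tau)) => r1 r2.
      by apply/matrixP => k l; rewrite !mxE; field.
    + by move: tt; rewrite -subr_eq0 ts eqxx.
  apply: is_derive_near_eq dY; near=> u; rewrite XY //.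
  by apply: ltW; near: u; exact: lt_nbhsr.
- move=> t i j; have [t0|t0] := ltP t 0.
    by rewrite /X t0 mxE normr0 mulr_ge0 ?expR_ge0 ?(ltW K0).
  rewrite XY //.
  (* As [b > 1], the exponential dominates both the constant and the ramps. *)
  have bt : t <= b * t by rewrite ler_peMl // ltW.
  have eb : 1 + b * t <= expR (b * t) by exact: expR_ge1Dx.
  have E1 : 1 <= expR (b * t) by lra.
  have Et : t <= expR (b * t) by lra.
  set E := expR (b * t) in E1 Et *.
  have rt u : u <= t -> `|ramp u| <= E.
    by move=> ut; rewrite ger0_norm ?le_max ?lexx ?orbT // ge_max (le_trans ut Et) (le_trans ler01 E1).
  have ab (Z : 'M[R]_n) : `|Z i j| <= mxsum (map_mx (fun r : R => r%:C%C) Z).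
    by have := normc_le_mxsum (map_mx (fun r : R => r%:C%C) Z) i j; rewrite mxE normc_real.
  have tri (p q r s : R) : `|p + q + r + s| <= `|p| + `|q| + `|r| + `|s|.
    by do 2! (apply: le_trans (ler_normD _ _) _; rewrite lerD2r); exact: ler_normD.
  rewrite /Y /K !mxE; apply: le_trans (tri _ _ _ _) _; rewrite !mulrDl.
  apply: lerD; [apply: lerD; [apply: lerD|]|].
  - by rewrite mul1r; apply: le_trans E1; case: (i == j); rewrite ?normr1 ?normr0.
  - by rewrite normrM mulrC; exact: (ler_pM (normr_ge0 _) (normr_ge0 _) (ab A) (rt t (lexx t))).
  - by rewrite normrM mulrC; apply: (ler_pM (normr_ge0 _) (normr_ge0 _) (ab B) (rt _ _)); rewrite gerBl ltW.
  - rewrite normrM -mulrA ler_wpM2l //.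
    apply: le_trans (line_transform_le t (hc i j).1) _; rewrite -/E -/P -mulrA mulrC.
    by rewrite ler_wpM2r ?expR_ge0 // ler_wpM2r // ler_norm.
Unshelve. all: by end_near. Qed.

End FundamentalMatrix.

(** * Exponential decay of the fundamental matrix *)

Section StableFundamentalMatrix.
Variable R : realType.
Local Notation C := (complex R).
Local Notation ramp t := (Num.max t 0).

(** If x solves the equation for (A, B), then exp(a t) x solves it for (A + a, exp(a tau) B), and
    the characteristic roots move by [a]. *)
Lemma delay_symbol_shift (n : nat) (A B : 'M[R]_n) (tau a : R) (s : C) :
  s%:M - delay_symbol (A + a%:M) (expR (a * tau) *: B) tau s =
  (s - a%:C%C)%:M - delay_symbol A B tau (s - a%:C%C).
Proof.
have ee : cexp (- (s - a%:C%C) * tau%:C%C) = cexp (- s * tau%:C%C) * (expR (a * tau))%:C%C.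
  rewrite mulNr mulrBl opprB addrC cexpD mulNr; congr (_ * _).
  rewrite -rmorphM /cexp /= cos0 sin0.
  by rewrite (_ : (1 +i* 0)%C = 1) // mulr1.
have eA : map_mx (fun r : R => r%:C%C) (A + a%:M) = map_mx (fun r : R => r%:C%C) A + a%:C%C%:M.
  by apply/matrixP => i j; rewrite !mxE rmorphD /= rmorphMn.
have eB (e : R) : map_mx (fun r : R => r%:C%C) (e *: B) = e%:C%C *: map_mx (fun r : R => r%:C%C) B.
  by apply/matrixP => i j; rewrite !mxE rmorphM.
rewrite /delay_symbol ee eA eB scalerA [(s - _)%:M]raddfB /=.
move: (map_mx _ A) (_ *: map_mx _ B) => X Y.
by rewrite (addrC X) -addrA opprD addrA.
Qed.

Theorem stable_fundamental_matrix (n : nat) (A B : 'M[R]_n) (tau : R) : 0 < tau ->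
  (forall s : C, \det (s%:M - delay_symbol A B tau s) = 0 -> complex.Re s < 0) ->
  exists (X : R -> 'M[R]_n) (gam K : R),
  [/\ 0 < gam, 0 < K & [/\ forall t, t < 0 -> X t = 0,
      X 0 = 1%:M,
      forall i j, continuous (fun t : R => X (ramp t) i j),
      forall (t : R) i j, 0 < t -> t != tau ->
        is_derive t 1 (fun u => X u i j) ((X t *m A + X (t - tau) *m B) i j) &
      forall t i j, `|X t i j| <= K * expR (- gam * t) ]].
Proof.
move=> tau0 hspec.
have Hdet0 (s : C) : 0 <= complex.Re s -> \det (s%:M - delay_symbol A B tau s) != 0.
  by move=> hs; apply/negP => /eqP /hspec; rewrite ltNge hs.
have [g0 g00 Hg] := delay_resolvent_gap tau0 Hdet0.
(* The root-free half plane Re s >= -g0 is carried to Re s >= 2. Integrating at abscissa 2 + g0/2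
   and undoing the shift leaves the rate g0/2. *)
pose a := 2 + g0.
pose A' := A + a%:M; pose B' := expR (a * tau) *: B.
have Hdet (s : C) : 2 <= complex.Re s -> \det (s%:M - delay_symbol A' B' tau s) != 0.
  move=> hs; pose q := s - a%:C%C.
  rewrite delay_symbol_shift -/q.
  by apply: Hg; rewrite /q raddfB /= /a; lra.
have b1 : 2 < 2 + g0 / 2 by lra.
have l12 : 1 < 2 :> R by lra.
have [Z [K K0 [Z1 Z2 Z3 Z4 Z5]]] := fundamental_matrix tau0 l12 b1 Hdet.
(* The shift by [a] moves the line of integration to the right of 1. *)
pose X (t : R) := expR (- a * t) *: Z t.
exists X, (g0 / 2), K; split => //; first by rewrite divr_gt0.
split.
- by move=> t t0; rewrite /X Z1 // scaler0.
- by rewrite /X mulr0 expR0 scale1r.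
- move=> i j; rewrite (_ : (fun t : R => _) = fun t => expR (- a * ramp t) * Z (ramp t) i j); last first.
    by apply/funext => t; rewrite mxE.
  move=> t; apply: cvgM; last exact: Z3.
  apply: (@continuous_comp _ _ _ (fun u : R => ramp u) (fun u => expR (- a * u))).
    by apply: continuous_max; [exact: cvg_id|exact: cvg_cst].
  exact: is_derive_continuous (is_derive_expRM (- a) _).
- move=> t i j t0 tt.
  rewrite (_ : (fun t : R => _) = fun t => expR (- a * t) * Z t i j); last first.
    by apply/funext => u; rewrite mxE.
  apply: (is_derive1_Mr (is_derive_expRM (- a) t) (Z4 t i j t0 tt)).
  rewrite /X /A' /B' mulmxDr mul_mx_scalar -scalemxAr -!scalemxAl.
  have -> : - a * (t - tau) = - a * t + a * tau by ring.
  rewrite expRD.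
  move: (Z t *m A) (Z (t - tau) *m B) (Z t) => Y1 Y2 Y3.
  by rewrite !mxE; ring.
- move=> t i j; rewrite /X mxE normrM ger0_norm ?expR_ge0 //.
  have -> : - (g0 / 2) * t = - a * t + (2 + g0 / 2) * t by rewrite /a; field.
  by rewrite expRD mulrCA ler_wpM2l ?expR_ge0.
Qed.

End StableFundamentalMatrix.

Section RealLemmas.
Variable R : realType.

(** The interval is split at each exceptional point inside it; continuity there lets the estimates
    of the two halves be added. *)
Lemma mean_value_seq (s : seq R) (f : R -> R) (a b c : R) : a <= b ->
  (forall t, a <= t <= b -> {for t, continuous f}) ->
  (forall t : R, a < t < b -> t \notin s -> exists2 d, is_derive t 1 f d & `|d| <= c) ->
  `|f b - f a| <= c * (b - a).
Proof.
elim: s a b => [|x s IH] a b ab cf df.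
  have [->|ab'] := eqVneq a b; first by rewrite !subrr normr0 mulr0.
  have {}ab : a < b by rewrite lt_neqAle ab'.
  have d1 (t : R) : t \in `]a, b[ -> is_derive t 1 f ('D_1 f t).
    rewrite in_itv /= => h; have [d [dd _] _] := df t h isT.
    exact/derivableP.
  have cw : {within `[a, b], continuous f}.
    apply: continuous_in_subspaceT => t /set_mem; rewrite /= in_itv /= => h; exact: cf.
  have [z zab ->] := MVT ab d1 cw.
  rewrite normrM (@ger0_norm _ (b - a)) ?subr_ge0 ?(ltW ab) // ler_wpM2r ?subr_ge0 ?(ltW ab) //.
  by have [d [_ <-]] := df z ltac:(by rewrite in_itv in zab) isT.
have [/andP[ax xb]|nx] := boolP (a < x < b).
  have h1 : `|f x - f a| <= c * (x - a).
    apply: IH; first exact: ltW.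
      by move=> t /andP[h1 h2]; apply: cf; rewrite h1 (le_trans h2 (ltW xb)).
    move=> t /andP[h1 h2] ts; apply: df; first by rewrite h1 (lt_trans h2).
    by rewrite inE negb_or ts andbT (lt_eqF h2).
  have h2 : `|f b - f x| <= c * (b - x).
    apply: IH; first exact: ltW.
      by move=> t /andP[h2 h3]; apply: cf; rewrite h3 (le_trans (ltW ax) h2).
    move=> t /andP[h2 h3] ts; apply: df; first by rewrite h3 (lt_trans ax).
    by rewrite inE negb_or ts andbT (gt_eqF h2).
  have -> : f b - f a = (f b - f x) + (f x - f a) by ring.
  have -> : c * (b - a) = c * (b - x) + c * (x - a) by ring.
  by apply: le_trans (ler_normD _ _) _; exact: lerD.
apply: IH => // t tab ts; apply: df => //; rewrite inE negb_or ts andbT.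
by apply: contraNneq nx => <-.
Qed.

Lemma antiderivative (v : R -> R) (a : R) : continuous v ->
  exists W : R -> R, forall t : R, a < t -> is_derive t 1 W (v t).
Proof.
move=> cv; exists (fun x => \int[@lebesgue_measure R]_(t in [set` `[a, x]]) v t) => t at_.
have tu : t < t + 1 by rewrite ltrDl.
have iv : (@lebesgue_measure R).-integrable `[a, t + 1] (EFin \o v).
  apply: continuous_compact_integrable; first exact: segment_compact.
  exact: continuous_subspaceT.
have [d1 d2] := continuous_FTC1_closed tu iv at_ (cv t).
apply: DeriveDef; first exact: d1.
by rewrite -derive1E; exact: d2.
Qed.

End RealLemmas.

(** * Variation of constants *)

Section VariationOfConstants.
Variable R : realType.
Local Notation ramp t := (Num.max t 0).
Variables (n : nat) (A B : 'M[R]_n) (tau : R).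
Hypothesis tau0 : 0 < tau.
Variables (X : R -> 'M[R]_n) (gam K : R).
Hypotheses (gam0 : 0 < gam) (K0 : 0 < K)
  (X_neg : forall t, t < 0 -> X t = 0)
  (X_0 : X 0 = 1%:M)
  (X_cont : forall i j, continuous (fun t : R => X (ramp t) i j))
  (X_der : forall (t : R) i j, 0 < t -> t != tau ->
        is_derive t 1 (fun u => X u i j) ((X t *m A + X (t - tau) *m B) i j))
  (X_bound : forall t i j, `|X t i j| <= K * expR (- gam * t)).
Variables (y g : R -> 'cV[R]_n) (M L : R).
Hypotheses (M0 : 0 <= M)
  (y_cont : forall k, continuous (fun t : R => y (Num.max t (- tau)) k 0))
  (y_der : forall (t : R) k, 0 < t -> (forall j : nat, t != j%:R * tau) ->
     is_derive t 1 (fun u => y u k 0) ((A *m y t + B *m y (t - tau) + g t) k 0))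
  (y_init : forall t k, - tau <= t <= 0 -> `|y t k 0| <= M)
  (g_bound : forall t k, 0 < t -> (forall j : nat, t != j%:R * tau) ->
     `|g t k 0| <= L * expR (- gam * t)).

(* The mean value inequality for
   h(s) = X(T-s) y(s) + \int_(s-tau)^(min(s,T-tau)) X(T-tau-u) B y(u) du,
   whose derivative is X(T-s) g(s) off a finite set, and h(T) = y(T). *)
Lemma variation_of_constants_bound (T : R) i : 0 <= T ->
  `|y T i 0| <= (n%:R * K * M + tau * (expR (gam * tau) * K * (\sum_k \sum_l `|B k l|) * M)
                 + n%:R * K * L * T) * expR (- gam * T).
Proof.
move=> T0.
(* The ramp and the truncation at [- tau] make [v] continuous on the whole line; on the range that
   matters it is [X (T - tau - u) B y(u)]. *)
pose v (u : R) := \sum_k \sum_l X (ramp (T - tau - u)) i k * B k l * y (Num.max u (- tau)) l 0.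
have cv : continuous v.
  move=> u; apply: continuous1_sum => k _; apply: continuous1_sum => l _.
  apply: cvgM; last exact: y_cont.
  apply: cvgM; last exact: cvg_cst.
  apply: (@continuous_comp _ _ _ (fun u : R => T - tau - u) (fun z => X (ramp z) i k)); last exact: X_cont.
  by apply: cvgB; [exact: cvg_cst|exact: cvg_id].
(* The base point lies below [- tau], so that [W] is differentiable at [- tau] itself. *)
have [W dW] := antiderivative (- tau - 1) cv.
pose h (s : R) := \sum_k X (ramp (T - s)) i k * y (Num.max s (- tau)) k 0
  + (W (Num.min s (T - tau)) - W (s - tau)).
have cW (t : R) : - tau - 1 < t -> {for t, continuous W}.
  by move=> ht; exact: is_derive_continuous (dW t ht).
have ch t : 0 <= t <= T -> {for t, continuous h}.
  move=> /andP[t0 tT]; rewrite /prop_for /continuous_at /h.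
  apply: cvgD.
    apply: (@continuous1_sum R R R _ (index_enum 'I_n) xpredT (fun k s => X (ramp (T - s)) i k * y (Num.max s (- tau)) k 0)) => k _.
    apply: cvgM; last exact: y_cont.
    apply: (@continuous_comp _ _ _ (fun u : R => T - u) (fun z => X (ramp z) i k)); last exact: X_cont.
    by apply: cvgB; [exact: cvg_cst|exact: cvg_id].
  apply: cvgB.
    apply: (@continuous_comp _ _ _ (fun u : R => Num.min u (T - tau)) W).
      by apply: continuous_min; [exact: cvg_id|exact: cvg_cst].
    by apply: cW; rewrite lt_min; apply/andP; split; have := tau0; lra.
  apply: (@continuous_comp _ _ _ (fun u : R => u - tau) W).
    by apply: cvgB; [exact: cvg_id|exact: cvg_cst].
  by apply: cW; lra.
have hT : h T = y T i 0.
  rewrite /h subrr maxxx X_0 (max_l (_ : - tau <= T)); last by have := tau0; lra.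
  rewrite (min_r (_ : T - tau <= T)) ?subrr ?addr0; last by have := tau0; lra.
  rewrite (bigD1 i) //= big1 ?addr0 ?mxE ?eqxx ?mul1r // => k ki.
  by rewrite mxE eq_sym (negbTE ki) mul0r.
pose c0 := n%:R * K * M * expR (- gam * T).
pose c1 := tau * (expR (gam * tau) * K * (\sum_k \sum_l `|B k l|) * M) * expR (- gam * T).
have h0 : `|h 0| <= c0 + c1.
  rewrite /h; apply: le_trans (ler_normD _ _) _; apply: lerD.
    rewrite subr0 (max_l T0) (max_l (_ : - tau <= 0)); last by have := tau0; lra.
    apply: le_trans (ler_norm_sum _ _ _) _.
    apply: (@le_trans _ _ (\sum_(k < n) (K * expR (- gam * T)) * M)).
      apply: ler_sum => k _; rewrite normrM; apply: ler_pM => //.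
      by apply: y_init; rewrite lexx andbT; have := tau0; lra.
    rewrite sumr_const card_ord /c0 -mulr_natl le_eqVlt; apply/orP; left; apply/eqP; ring.
  rewrite sub0r.
  set m := Num.min 0 (T - tau).
  have m1 : - tau <= m by rewrite le_min; apply/andP; split; have := tau0; lra.
  have m2 : m <= 0 by rewrite ge_min lexx.
  have m3 : m <= T - tau by rewrite ge_min lexx orbT.
  (* A bound for the integrand over the part of the initial interval that enters [h 0]: there u <=
     0, so the delay costs at most exp(gam tau). *)
  pose b := expR (gam * tau) * K * (\sum_k \sum_l `|B k l|) * M * expR (- gam * T).
  have b0 : 0 <= b.
    rewrite /b !mulr_ge0 ?expR_ge0 ?(ltW K0) //.
    by apply: sumr_ge0 => k _; apply: sumr_ge0.
  have := @mean_value_seq R [::] W (- tau) m b m1 _ _; move=> H.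
  apply: le_trans (H _ _) _.
  - by move=> t /andP[t1 t2]; apply: cW; lra.
  - move=> t /andP[t1 t2] _; exists (v t); first by apply: dW; lra.
    apply: le_trans (ler_norm_sum _ _ _) _.
    rewrite /b mulr_sumr !mulr_suml; apply: ler_sum => k _.
    apply: le_trans (ler_norm_sum _ _ _) _.
    rewrite mulr_sumr !mulr_suml; apply: ler_sum => l _.
    rewrite !normrM (max_l (_ : 0 <= T - tau - t)); last by lra.
    rewrite (max_l (ltW t1)).
    have hx : `|X (T - tau - t) i k| <= expR (gam * tau) * K * expR (- gam * T).
      apply: le_trans (X_bound _ _ _) _.
      rewrite (_ : expR (gam * tau) * K * _ = K * expR (gam * tau - gam * T)).
        rewrite ler_wpM2l ?(ltW K0) // ler_expR; have := mulr_ge0 (ltW gam0) (_ : 0 <= - t).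
        by rewrite oppr_ge0 (le_trans (ltW t2) m2) => /(_ isT); lra.
      by rewrite expRD -mulNr; ring.
    have hy : `|y t l 0| <= M by apply: y_init; rewrite (ltW t1) (le_trans (ltW t2) m2).
    rewrite [leRHS](_ : _ = expR (gam * tau) * K * expR (- gam * T) * `|B k l| * M); last by ring.
    by apply: ler_pM => //; rewrite ?mulr_ge0 // ler_wpM2r.
  - rewrite /c1 (_ : tau * _ * _ = b * tau); last by rewrite /b; ring.
    by rewrite ler_wpM2l //; lra.
have [J TJ] : exists J : nat, T <= J%:R * tau.
  exists (Num.truncn (T / tau)).+1; rewrite -ler_pdivrMr //.
  by apply: ltW; apply: truncnS_gt.
pose S : seq R := (T - tau) :: [seq j%:R * tau | j <- iota 0 J.+1].
have hh : `|h T - h 0| <= n%:R * K * L * expR (- gam * T) * (T - 0).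
  apply: (@mean_value_seq R S) => // s /andP[s0 sT]; rewrite inE negb_or => /andP[sTt sg].
  have sj (j : nat) : s != j%:R * tau.
    have [jJ|jJ] := ltnP j J.+1.
      by apply: contraNneq sg => ->; apply/mapP; exists j => //; rewrite mem_iota.
    apply/negP => /eqP sE; have : J%:R * tau <= j%:R * tau.
      by rewrite ler_wpM2r ?(ltW tau0) // ler_nat; exact: ltnW.
    by rewrite -sE leNgt (lt_le_trans sT TJ).
  have Ts0 : 0 < T - s by rewrite subr_gt0.
  have Tst : T - s != tau by apply: contraNneq sTt => <-; rewrite opprB addrC subrK.
  have dTs : is_derive s 1 (fun u : R => T - u) (-1).
    have := is_deriveB (is_derive_cst T s (1 : R)) (is_derive_id s (1 : R)).
    by rewrite sub0r.
  have dX k : is_derive s 1 (fun u => X (ramp (T - u)) i k) (- (X (T - s) *m A + X (T - s - tau) *m B) i k).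
    have dX0 : is_derive s 1 (fun u => X (T - u) i k) (- (X (T - s) *m A + X (T - s - tau) *m B) i k).
      have := @is_derive1_comp R (fun z => X z i k) (fun u => T - u) s _ _ (X_der i k Ts0 Tst) dTs.
      by rewrite mulrN1.
    apply: is_derive_near_eq dX0; near=> z; rewrite max_l // subr_ge0 ltW //.
    by near: z; exact: lt_nbhsl.
  have dy k : is_derive s 1 (fun u => y (Num.max u (- tau)) k 0) ((A *m y s + B *m y (s - tau) + g s) k 0).
    apply: is_derive_near_eq (y_der k s0 sj); near=> z; rewrite max_l // ltW //.
    by near: z; apply: lt_nbhsr; have := tau0; lra.
  have vE u : 0 <= T - tau - u -> - tau <= u -> v u = (X (T - tau - u) *m B *m y u) i 0.
    move=> h1 h2; rewrite /v (max_l h1) (max_l h2) -mulmxA mxE; apply: eq_bigr => k _.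
    by rewrite mxE mulr_sumr; apply: eq_bigr => l _; rewrite mulrA.
  have dW1 : is_derive s 1 (fun u => W (Num.min u (T - tau))) ((X (T - s - tau) *m B *m y s) i 0).
    have [sl|sr|sE] := ltgtP s (T - tau).
    - have d : is_derive s 1 W ((X (T - s - tau) *m B *m y s) i 0).
        have E : T - s - tau = T - tau - s by ring.
        rewrite E -vE; [apply: dW| |]; have := tau0; lra.
      apply: is_derive_near_eq d; near=> z; rewrite min_l // ltW //.
      by near: z; exact: lt_nbhsl.
    (* Beyond [T - tau] the minimum freezes [W], in agreement with [X] being zero at negative
       times. *)
    - rewrite X_neg; last by lra.
      rewrite !mul0mx mxE.
      have d : is_derive s 1 (fun _ : R => W (T - tau)) 0 by exact: is_derive_cst.
      apply: is_derive_near_eq d; near=> z; rewrite min_r // ltW //.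
      by near: z; exact: lt_nbhsr.
    - by rewrite sE eqxx in sTt.
  have dW2 : is_derive s 1 (fun u => W (u - tau)) ((X (T - s) *m B *m y (s - tau)) i 0).
    have d1 : is_derive s 1 (fun u : R => u - tau) 1.
      have := is_deriveB (is_derive_id s (1 : R)) (is_derive_cst tau s (1 : R)).
      by rewrite subr0.
    have E : T - s = T - tau - (s - tau) by ring.
    have d2 : is_derive (s - tau) 1 W ((X (T - s) *m B *m y (s - tau)) i 0).
      by rewrite E -vE; [apply: dW| |]; have := tau0; lra.
    by have := @is_derive1_comp R W (fun u => u - tau) s _ _ d2 d1; rewrite mulr1.
  exists ((X (T - s) *m g s) i 0).
    have dP := @is_derive1_sum R _ (index_enum 'I_n) xpredT
      (fun k u => X (ramp (T - u)) i k * y (Num.max u (- tau)) k 0) _ s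
      (fun k _ => is_derive1_Mr (dX k) (dy k) erefl).
    have dh := is_deriveD dP (is_deriveB dW1 dW2).
    apply: (is_derive_eq dh).
    rewrite (max_l (ltW Ts0)) (max_l (_ : - tau <= s)); last by have := tau0; lra.
    rewrite big_split /=.
    have -> : \sum_k - (X (T - s) *m A + X (T - s - tau) *m B) i k * y s k 0 =
        - ((X (T - s) *m A + X (T - s - tau) *m B) *m y s) i 0.
      by rewrite [in RHS]mxE -sumrN; apply: eq_bigr => k _; rewrite mulNr.
    have -> : \sum_k X (T - s) i k * (A *m y s + B *m y (s - tau) + g s) k 0 =
        (X (T - s) *m (A *m y s + B *m y (s - tau) + g s)) i 0.
      by rewrite [in RHS]mxE.
    rewrite mulmxDl !mulmxDr !mulmxA.
    move: (X (T - s) *m A *m y s) (X (T - s - tau) *m B *m y s) (X (T - s) *m B *m y (s - tau)) (X (T - s) *m g s) => Y1 Y2 Y3 Y4.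
    by rewrite ![in LHS]mxE; ring.
  rewrite mxE; apply: le_trans (ler_norm_sum _ _ _) _.
  apply: (@le_trans _ _ (\sum_(k < n) (K * expR (- gam * (T - s))) * (L * expR (- gam * s)))).
    by apply: ler_sum => k _; rewrite normrM; apply: ler_pM => //; exact: g_bound.
  rewrite sumr_const card_ord -mulr_natl.
  have -> : - gam * T = - gam * (T - s) + - gam * s by ring.
  by rewrite expRD le_eqVlt; apply/orP; left; apply/eqP; ring.
rewrite -hT; have -> : h T = (h T - h 0) + h 0 by ring.
apply: le_trans (ler_normD _ _) _; rewrite addrC.
apply: le_trans (lerD h0 hh) _.
by rewrite /c0 /c1 subr0 le_eqVlt; apply/orP; left; apply/eqP; ring.
Unshelve. all: by end_near. Qed.

End VariationOfConstants.

(** * The algebraic variables *)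

Section PowerBound.
Import ComplexField.Normc.
Variable R : realType.
Local Notation C := (complex R).

Lemma clog_exists (z : C) : z != 0 -> exists w : C, cexp w = z.
Proof.
move=> z0; have n0 := normc_gt0 z0.
pose r := normc z.
have re1 : -1 <= complex.Re z / r <= 1.
  by rewrite -ler_norml normrM normfV [X in _ / X]gtr0_norm // ler_pdivrMr // mul1r normc_re.
have im2 : (complex.Im z / r) ^+ 2 = 1 - (complex.Re z / r) ^+ 2.
  by have := normc_sqr z; rewrite -/r => E; rewrite !exprMn !exprVn -[1](mulfV (lt0r_neq0 (exprn_gt0 2 n0))) -/r E; ring.
pose th := acos (complex.Re z / r).
(* [acos] only reaches [0, pi]; the lower half plane takes the opposite angle. *)
pose th' := if 0 <= complex.Im z then th else - th.
have ct : cos th' = complex.Re z / r.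
  by rewrite /th'; case: ifP => _; rewrite ?cosN acosK.
have st : sin th' = complex.Im z / r.
  have s0 : sin th = `|complex.Im z / r|.
    by rewrite /th sin_acos // -im2 sqrtr_sqr.
  rewrite /th'; case: ifPn => h; rewrite ?sinN s0 normrM normfV (gtr0_norm n0).
    by rewrite ger0_norm.
  by rewrite ltr0_norm ?ltNge // mulNr opprK.
exists (ln r +i* th')%C; rewrite /cexp /= lnK ?posrE // ct st.
case: z z0 n0 @r re1 im2 @th @th' ct st => a b z0 n0 r re1 im2 th th' ct st.
have r0 : r != 0 by rewrite gt_eqF.
by apply/eqP; rewrite eq_complex /=; apply/andP; split; apply/eqP; field.
Qed.

Lemma exists_radius (rs : seq C) : (forall z, z \in rs -> normc z < 1) ->
  exists2 r : R, 0 < r < 1 & forall z, z \in rs -> normc z < r.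
Proof.
elim: rs => [|z rs IH] h; first by exists (1 / 2) => //; lra.
have [r /andP[r0 r1] hr] := IH (fun y yr => h y (mem_behead (s := z :: rs) yr)).
have z1 : normc z < 1 by apply: h; rewrite mem_head.
have zn := normc_ge0 z.
exists (Num.max r ((normc z + 1) / 2)).
  by rewrite lt_max r0 /= gt_max r1 /=; lra.
move=> y; rewrite inE => /orP[/eqP->|/hr yr]; last by rewrite lt_max yr.
by rewrite lt_max; apply/orP; right; lra.
Qed.

Lemma recursion_bound n (u : nat -> 'M[C]_n) (z : C) (r D : R) : 0 < r -> normc z < r ->
  (forall j, mxsum (u j.+1 - z *: u j) <= D * r ^+ j) ->
  exists D', forall j, mxsum (u j) <= D' * r ^+ j.
Proof.
move=> r0 zr hD.
have D0 : 0 <= D by have := hD 0%N; rewrite expr0 mulr1; apply: le_trans; exact: mxsum_ge0.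
have d0 : 0 < r - normc z by rewrite subr_gt0.
(* Chosen so that [D + normc z * D' <= r * D'], which closes the induction; the first summand covers
   index 0. *)
pose D' := mxsum (u 0%N) + D / (r - normc z).
have h1 : D <= D' * (r - normc z).
  by rewrite mulrDl divfK ?gt_eqF // lerDr mulr_ge0 ?mxsum_ge0 // ltW.
exists D'; elim=> [|j IH].
  by rewrite expr0 mulr1 lerDl divr_ge0 // ltW.
have -> : u j.+1 = (u j.+1 - z *: u j) + z *: u j by rewrite subrK.
apply: le_trans (mxsumD _ _) _; rewrite mxsumZ.
apply: le_trans (lerD (hD j) (ler_wpM2l (normc_ge0 z) IH)) _.
rewrite exprSr; have := ler_wpM2r (exprn_ge0 j (ltW r0)) h1; lra.
Qed.

(** By Cayley-Hamilton the product of all [BC - z] over the eigenvalues vanishes. Its factors are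
    removed one at a time: without the factor for [z], the sequence obeys a recursion with
    multiplier [z] and forcing O(r^j), and [normc z < r] preserves the bound. *)
Lemma matrix_power_bound (n : nat) (B : 'M[R]_n) :
  (forall z : C, eigenvalue (map_mx (fun r : R => r%:C%C) B) z -> normc z < 1) ->
  exists r D : R, [/\ 0 < r < 1, 0 <= D & forall j i k, `|(B ^+ j) i k| <= D * r ^+ j].
Proof.
case: n B => [|n] B hB.
  by exists (1 / 2), 0; split => //; [lra|move=> j []].
pose BC := map_mx (fun r : R => r%:C%C) B.
have [rs rsE] := closed_field_poly_normal (char_poly BC).
rewrite (monicP (char_poly_monic BC)) scale1r in rsE.
have rsB z : z \in rs -> normc z < 1.
  by move=> zr; apply: hB; rewrite eigenvalue_root_char rsE root_prod_XsubC.
have [r /andP[r0 r1] hr] := exists_radius rsB.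
have key (s : seq C) : (forall z, z \in s -> normc z < r) -> forall Q : 'M[C]_n.+1,
    (exists D, forall j, mxsum (BC ^+ j * (\prod_(z <- s) (BC - z%:M)) * Q) <= D * r ^+ j) ->
    exists D, forall j, mxsum (BC ^+ j * Q) <= D * r ^+ j.
  elim: s => [|z s IH] hs Q.
    by move=> [D hD]; exists D => j; have := hD j; rewrite big_nil mulr1.
  move=> [D hD]; apply: (IH _ Q); first by move=> y ys; apply: hs; rewrite inE ys orbT.
  have zr : normc z < r by apply: hs; rewrite mem_head.
  apply: (@recursion_bound _ (fun j => BC ^+ j * \prod_(z <- s) (BC - z%:M) * Q) z r D) => // j.
  have -> : BC ^+ j.+1 * \prod_(z <- s) (BC - z%:M) * Q - z *: (BC ^+ j * \prod_(z <- s) (BC - z%:M) * Q)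
     = BC ^+ j * (\prod_(z <- (z :: s)) (BC - z%:M)) * Q.
    have zc (Y : 'M[C]_n.+1) : z%:M * Y = z *: Y by exact: mul_scalar_mx.
    by rewrite big_cons mulrBl zc mulrBr mulrBl -scalerAr -scalerAl exprSr !mulrA.
  exact: hD.
have [D hD] : exists D, forall j, mxsum (BC ^+ j * 1) <= D * r ^+ j.
  apply: (key rs hr); exists 0 => j.
  have -> : \prod_(z <- rs) (BC - z%:M) = 0.
    rewrite -[RHS](Cayley_Hamilton BC) rsE rmorph_prod /=; apply: eq_bigr => z _.
    by rewrite rmorphB /= horner_mx_X horner_mx_C.
  by rewrite mulr0 mul0r mul0r -(scale0r (0 : 'M[C]_n.+1)) mxsumZ normc0 mul0r.
exists r, (Num.max D 0); split; [by rewrite r0|by rewrite le_max lexx orbT|].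
move=> j i k.
have E : BC ^+ j = map_mx (real_complex R) (B ^+ j) by rewrite rmorphXn.
have := le_trans (normc_le_mxsum _ i k) (hD j); rewrite mulr1 E mxE normc_real => /le_trans; apply.
by rewrite ler_wpM2r ?exprn_ge0 ?(ltW r0) // le_max lexx.
Qed.

End PowerBound.

(** * The spectrum of the block system and the algebraic block *)

Section Spectrum.
Import ComplexField.Normc.
Variable R : realType.
Local Notation C := (complex R).
Local Notation toC := (map_mx (fun r : R => r%:C%C)).

Lemma ddae_det_block (n1 n2 : nat) (E2 : 'M[R]_(n1, n2)) (N : 'M[R]_n2)
    (A1 : 'M[R]_n1) (A2 : 'M[R]_(n1, n2)) (B1 : 'M[R]_n1) (B2 : 'M[R]_(n1, n2)) (B4 : 'M[R]_n2)
    (lam c : C) :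
  \det (lam *: toC (block_mx 1%:M E2 0 N) - toC (block_mx A1 A2 0 1%:M)
    - c *: toC (block_mx B1 B2 0 B4)) =
  \det (lam%:M - (toC A1 + c *: toC B1)) * \det (lam *: toC N - 1%:M - c *: toC B4).
Proof.
have c0 m n : toC (0 : 'M[R]_(m, n)) = 0.
  by apply/matrixP => i j; rewrite !mxE.
have c1 m : toC (1%:M : 'M[R]_m) = 1%:M.
  by apply/matrixP => i j; rewrite !mxE; case: (i == j).
rewrite !map_block_mx !scale_block_mx !opp_block_mx !add_block_mx !c0 !c1 !scaler0 !oppr0 !addr0.
by rewrite det_ublock scalemx1 opprD addrA.
Qed.

(** The last nonzero vector among v, v N, v N^2, ... is annihilated by [N] and keeps the eigenvalue,
    since [B] commutes with the powers of [N]. *)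
Lemma nilpotent_common_eigenvector (m nu : nat) (N B : 'M[C]_m) (v : 'rV[C]_m) (z : C) :
  N ^+ nu = 0 -> N *m B = B *m N -> v != 0 -> v *m B = z *: v ->
  exists2 w : 'rV[C]_m, w != 0 & w *m N = 0 /\ w *m B = z *: w.
Proof.
move=> N0 NB v0 vB.
have ex : exists k, v *m N ^+ k == 0 by exists nu; rewrite N0 mulmx0.
case: (ex_minnP ex) => -[|k] /eqP k0 kmin.
  by move: k0 v0; rewrite expr0 mulmx1 => ->; rewrite eqxx.
exists (v *m N ^+ k); first by apply/negP => /kmin; rewrite ltnn.
split; first by rewrite -mulmxA -[N ^+ k *m N]/(N ^+ k * N) -exprSr.
have cB : N ^+ k *m B = B *m N ^+ k.
  by have := @commrX _ B N k (esym NB) => /esym.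
by rewrite -mulmxA cB mulmxA vB scalemxAl.
Qed.

(* A left eigenvector common to N and B4 turns an eigenvalue z = exp(w) of -B4
   into the spectral value w / tau. *)
Lemma unit_disc_of_spectrum (m nu : nat) (N B4 : 'M[R]_m) (tau : R) : 0 < tau ->
  N ^+ nu = 0 -> N *m B4 = B4 *m N ->
  (forall lam : C, \det (lam *: toC N - 1%:M - cexp (- lam * tau%:C%C) *: toC B4) = 0 ->
     complex.Re lam < 0) ->
  forall z : C, eigenvalue (toC (- B4)) z -> normc z < 1.
Proof.
move=> tau0 N0 NB hspec z /eigenvalueP[v vB v0].
have [->|z0] := eqVneq z 0; first by rewrite normc0 ltr01.
have [w wz] := clog_exists z0.
have NC : (toC N) ^+ nu = 0.
  have -> : toC N ^+ nu = toC (N ^+ nu).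
    elim: (nu) => [|k IH]; first by apply/matrixP => i j; rewrite !expr0 !mxE; case: (i == j).
    rewrite !exprS IH; apply/matrixP => i j; rewrite !mxE rmorph_sum; apply: eq_bigr => p _.
    by rewrite !mxE rmorphM.
  by rewrite N0; apply/matrixP => i j; rewrite !mxE.
have toCM (X Y : 'M[R]_m) : toC X *m toC Y = toC (X *m Y).
  apply/matrixP => k l; rewrite !mxE rmorph_sum; apply: eq_bigr => p _.
  by rewrite !mxE rmorphM.
have NBC : toC N *m toC (- B4) = toC (- B4) *m toC N by rewrite !toCM mulmxN mulNmx NB.
have [u u0 [uN uB]] := nilpotent_common_eigenvector NC NBC v0 vB.
have uB4 : u *m toC B4 = - z *: u.
  have E : toC B4 = - toC (- B4) by apply/matrixP => i j; rewrite !mxE rmorphN opprK.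
  by rewrite E mulmxN uB scaleNr.
pose lam := w / tau%:C%C.
have tC : tau%:C%C != 0 :> C by rewrite eq_complex /= gt_eqF.
have lt : - lam * tau%:C%C = - w by rewrite /lam mulNr divfK.
have ew : cexp (- w) * z = 1 by rewrite -wz -cexpD addNr cexp0.
have : complex.Re lam < 0.
  apply: hspec; apply/eqP/det0P; exists u => //; rewrite lt !mulmxBr -!scalemxAr uN uB4 scaler0 mulmx1.
  by rewrite scalerA mulrN ew scaleN1r opprK sub0r addNr.
have -> : complex.Re lam = complex.Re w / tau.
  rewrite /lam -fmorphV; case: (w) => a b /=; ring.
rewrite pmulr_llt0 ?invr_gt0 // -wz normc_cexp => h.
by rewrite -expR0 ltr_expR.
Qed.

End Spectrum.

(** * An explicit formula for the algebraic variables *)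

Section NilpotentPart.
Variable R : realType.

Lemma is_derive_mx_entry (m n : nat) (f : R -> 'M[R]_(m, n)) (t : R) (d : 'M[R]_(m, n)) i j :
  is_derive t 1 f d -> is_derive t 1 (fun s => f s i j) (d i j).
Proof.
move=> [df <-]; have /derivable_mxP dm := df.
by rewrite derive_mx // mxE; exact/derivableP.
Qed.

Lemma is_derive_cst_mx (m n : nat) (F : 'M[R]_(m, n)) (t : R) i j :
  is_derive t 1 (fun _ : R => F i j) ((0 : 'M[R]_(m, n)) i j).
Proof.
have -> : (0 : 'M[R]_(m, n)) i j = 0 by rewrite mxE.
exact: is_derive_cst.
Qed.

(** A single term of the expansion of (1 + q)^n. It trades the polynomial growth of binomial
    coefficients for a slightly larger geometric rate. *)
Lemma binomial_le_power (q : R) (n k : nat) : 0 <= q -> 'C(n, k)%:R * q ^+ k <= (1 + q) ^+ n.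
Proof.
move=> q0; rewrite exprDn.
have [kn|nk] := leqP k n; last first.
  rewrite bin_small // mul0r; apply: sumr_ge0 => i _.
  by rewrite mulrn_wge0 // mulr_ge0 ?exprn_ge0.
have kn' : (k < n.+1)%N by [].
rewrite (bigD1 (Ordinal kn')) //= expr1n mul1r mulr_natl lerDl.
by apply: sumr_ge0 => i _; rewrite mulrn_wge0 // mulr_ge0 ?exprn_ge0.
Qed.

Variables (m nu : nat) (N Bm : 'M[R]_m) (tau : R).
Hypotheses (tau0 : 0 < tau) (N0 : N ^+ nu = 0) (NB : N *m Bm = Bm *m N).

(* x = (N x)' + Bm x(. - tau), so N^p x on one cell follows from N^(p+1) x on the
   same cell and from the previous cell: a descending induction on p, started
   at the nilpotency exponent, inside an induction on the cell. *)
Lemma derivative_chain (x : R -> 'cV[R]_m) (phi : nat -> R -> 'cV[R]_m) :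
  (forall (t : R) i, 0 < t -> (forall j : nat, t != j%:R * tau) ->
     is_derive t 1 (fun s => (N *m x s) i 0) ((x t - Bm *m x (t - tau)) i 0)) ->
  (forall t, - tau <= t <= 0 -> x t = phi 0%N t) ->
  (forall k, (k.+1 < nu)%N -> forall (t : R) i,
     is_derive t 1 (fun s => phi k s i 0) (phi k.+1 t i 0)) ->
  forall (j p : nat) u, - tau < u < 0 ->
  N ^+ p *m x (u + j%:R * tau) =
  \sum_(k < nu) 'C((j + k).-1, k)%:R *: (N ^+ (p + k) *m Bm ^+ j *m phi k u).
Proof.
move=> hx hinit hphi.
have Nge p : (nu <= p)%N -> N ^+ p = 0.
  by move=> h; rewrite -(subnK h) exprD N0 mulr0.
elim=> [|j IHj] p u /andP[u1 u2].
  rewrite mul0r addr0 hinit ?(ltW u1) ?(ltW u2) //.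
  case: (nu) Nge => [|nu'] Nge.
    by rewrite big_ord0 Nge // mul0mx.
  (* At cell 0 the truncated predecessor gives C(0, 0) = 1 for k = 0 and C(k - 1, k) = 0 for k >= 1,
     so only the initial function remains. *)
  rewrite big_ord_recl /= big1 ?addr0 ?addn0.
    by rewrite bin0 scale1r expr0 mulmx1.
  by move=> k _; rewrite /= /bump /= add1n add0n /= bin_small // scale0r.
suff H : forall d p u, - tau < u < 0 -> (nu <= p + d)%N -> N ^+ p *m x (u + j.+1%:R * tau) =
    \sum_(k < nu) 'C((j.+1 + k).-1, k)%:R *: (N ^+ (p + k) *m Bm ^+ j.+1 *m phi k u).
  by apply: (H nu); rewrite ?u1 // leq_addl.
move=> d; elim: d => [|d IHd] {u1 u2}{}p {}u /andP[u1 u2] hp.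
  rewrite addn0 in hp; rewrite Nge // mul0mx big1 // => k _.
  by rewrite Nge ?mul0mx ?scaler0 // (leq_trans hp) // leq_addr.
pose t := u + j.+1%:R * tau.
have jt : j.+1%:R * tau = j%:R * tau + tau by rewrite -natr1 mulrDl mul1r.
have t0 : 0 < t.
  have : 0 <= j%:R * tau by rewrite mulr_ge0 // ltW.
  by rewrite /t jt; lra.
have tg (i : nat) : t != i%:R * tau.
  apply/negP => /eqP E.
  have [ij|ij] := leqP i j.
    have : i%:R * tau <= j%:R * tau by rewrite ler_wpM2r ?(ltW tau0) // ler_nat.
    by move: E; rewrite /t jt; lra.
  have : j.+1%:R * tau <= i%:R * tau by rewrite ler_wpM2r ?(ltW tau0) // ler_nat.
  by move: E; rewrite /t; lra.
have tt : t - tau = u + j%:R * tau by rewrite /t jt; ring.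
apply/matrixP => i l; rewrite (ord1 l) {l}.
have d1 : is_derive t 1 (fun s => (N ^+ p.+1 *m x s) i 0) ((N ^+ p *m (x t - Bm *m x (t - tau))) i 0).
  have h0 a b : is_derive t 1 (fun _ : R => (N ^+ p) a b) ((0 : 'M[R]_m) a b).
    exact: is_derive_cst_mx.
  have h1 (a : 'I_m) (b : 'I_1) : is_derive t 1 (fun s => (N *m x s) a b) ((x t - Bm *m x (t - tau)) a b).
    by rewrite (ord1 b); exact: hx.
  have := is_derive_mulmx h0 h1 i 0; rewrite mul0mx add0r.
  rewrite (_ : (fun z : R => _) = fun s => (N ^+ p.+1 *m x s) i 0) //.
  by apply/funext => s; rewrite exprSr -[in RHS]mulmxA.
pose cst k := 'C((j.+1 + k).-1, k)%:R *: (N ^+ (p.+1 + k) *m Bm ^+ j.+1) : 'M[R]_m.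
have d2 : is_derive t 1 (fun s => (N ^+ p.+1 *m x s) i 0) ((\sum_(k < nu) cst k *m phi k.+1 u) i 0).
  have du : is_derive t 1 (fun s : R => s - j.+1%:R * tau) 1.
    have := is_deriveB (is_derive_id t (1 : R)) (is_derive_cst (j.+1%:R * tau) t (1 : R)).
    by rewrite subr0.
  have tu : t - j.+1%:R * tau = u by rewrite /t addrK.
  have dk (k : 'I_nu) : is_derive t 1 (fun s => (cst k *m phi k (s - j.+1%:R * tau)) i 0) ((cst k *m phi k.+1 u) i 0).
    (* For k = nu - 1 no derivative of [phi k] is given, but its coefficient carries at least [nu]
       factors [N]. *)
    have [kn|kn] := ltnP k.+1 nu; last first.
      have c0 : cst k = 0.
        by rewrite /cst Nge ?mul0mx ?scaler0 // addSn -addnS (leq_trans kn) // leq_addl.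
      by rewrite c0 mul0mx mxE; under eq_fun do rewrite mul0mx mxE; exact: is_derive_cst.
    have h0 a b : is_derive t 1 (fun _ : R => (cst k) a b) ((0 : 'M[R]_m) a b).
      exact: is_derive_cst_mx.
    have h1 (a : 'I_m) (b : 'I_1) : is_derive t 1 (fun s => phi k (s - j.+1%:R * tau) a b) (phi k.+1 u a b).
      rewrite (ord1 b).
      have hk : is_derive (t - j.+1%:R * tau) 1 (fun s => phi k s a 0) (phi k.+1 u a 0).
        by rewrite tu; exact: hphi.
      by have := @is_derive1_comp R (fun s => phi k s a 0) _ t _ _ hk du; rewrite mulr1.
    by have := is_derive_mulmx h0 h1 i 0; rewrite mul0mx add0r.
  have ds := @is_derive1_sum R _ (index_enum 'I_nu) xpredT
    (fun k s => (cst k *m phi k (s - j.+1%:R * tau)) i 0) _ t (fun k _ => dk k).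
  rewrite summxE; apply: is_derive_near_eq ds.
  near=> s.
  have hs : - tau < s - j.+1%:R * tau < 0.
    apply/andP; split.
      by rewrite ltrBrDl; near: s; apply: lt_nbhsr; rewrite /t; lra.
    by rewrite ltrBlDl addr0; near: s; apply: lt_nbhsl; rewrite /t; lra.
  have := IHd p.+1 _ hs; rewrite subrK addSnnS => -> //.
  by rewrite summxE; apply: eq_bigr => k _; rewrite /cst -scalemxAl.
have E : (N ^+ p *m (x t - Bm *m x (t - tau))) i 0 = (\sum_(k < nu) cst k *m phi k.+1 u) i 0.
  by case: d1 => _ <-; case: d2 => _ <-.
have cB : N ^+ p *m Bm = Bm *m N ^+ p.
  by have := @commrX _ Bm N p (esym NB) => /esym.
have E2 : N ^+ p *m (Bm *m x (t - tau)) =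
    \sum_(k < nu) 'C((j + k).-1, k)%:R *: (N ^+ (p + k) *m Bm ^+ j.+1 *m phi k u).
  rewrite mulmxA cB -mulmxA tt IHj ?u1 // mulmx_sumr; apply: eq_bigr => k _.
  rewrite -scalemxAr; congr (_ *: _); rewrite !mulmxA; congr (_ *m _).
  have cBk : N ^+ (p + k) *m Bm = Bm *m N ^+ (p + k).
    by have := @commrX _ Bm N (p + k) (esym NB) => /esym.
  by rewrite -cBk -mulmxA -[Bm *m Bm ^+ j]/(Bm * Bm ^+ j) -exprS.
move: E; rewrite mulmxBr E2 => E.
have {}E : (N ^+ p *m x t) i 0 = (\sum_(k < nu) cst k *m phi k.+1 u) i 0 +
   (\sum_(k < nu) 'C((j + k).-1, k)%:R *: (N ^+ (p + k) *m Bm ^+ j.+1 *m phi k u)) i 0.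
  by rewrite -E [X in _ = X + _]mxE [X in _ + X + _]mxE subrK.
rewrite -/t E.
set S1 := \sum_(k < nu) cst k *m _; set S2 := \sum_(k < nu) _.
transitivity ((S1 + S2) i 0); first by rewrite [RHS]mxE.
congr (fun_of_matrix _ _ _); rewrite /S1 /S2.
case: (nu) Nge @cst {d1 d2 E E2 S1 S2} => [|nu'] Nge cst; first by rewrite !big_ord0 addr0.
rewrite big_ord_recr /=.
have -> : cst nu' = 0 by rewrite /cst Nge ?mul0mx ?scaler0 // addSnnS leq_addl.
rewrite mul0mx addr0 !big_ord_recl /= !bin0 addrCA; congr (_ + _).
(* After the shift of k by 1, terms with the same power of [N] meet and Pascal's rule adds their
   coefficients. *)
rewrite -big_split; apply: eq_bigr => k _ /=; rewrite /bump /= !add1n /cst.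
rewrite (addSnnS p k) -scalemxAl -scalerDl; congr (_ *: _).
have -> : ((j.+1 + k).-1 = j + k)%N by [].
have -> : ((j + k.+1).-1 = j + k)%N by rewrite addnS.
have -> : (j + k.+1 = (j + k).+1)%N by rewrite addnS.
by rewrite binS natrD addrC.
Unshelve. all: by end_near. Qed.

End NilpotentPart.

(** * Decay of the algebraic variables *)

Section AlgebraicPart.
Import ComplexField.Normc.
Variable R : realType.
Local Notation C := (complex R).

Lemma grid_cell (tau t : R) : 0 < tau -> - tau < t -> (forall j : nat, t != j%:R * tau) ->
  exists (j : nat) (u : R), - tau < u < 0 /\ t = u + j%:R * tau.
Proof.
move=> tau0 t1 tg.
have ex : exists j : nat, t < j%:R * tau.
  by exists (Num.truncn (t / tau)).+1; rewrite -ltr_pdivrMr // truncnS_gt.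
case: (ex_minnP ex) => j tj jmin; exists j, (t - j%:R * tau); split; last by rewrite subrK.
rewrite subr_lt0 tj andbT; case: j tj jmin => [|j] tj jmin.
  by rewrite mul0r subr0.
have : j%:R * tau < t.
  rewrite lt_neqAle eq_sym tg /= leNgt; apply/negP => /jmin; by rewrite ltnn.
by rewrite -natr1 mulrDl mul1r; lra.
Qed.

Theorem algebraic_part_decay (m nu : nat) (N Bm : 'M[R]_m) (tau : R) :
  0 < tau -> N ^+ nu = 0 -> N *m Bm = Bm *m N ->
  (forall z : C, eigenvalue (map_mx (fun r : R => r%:C%C) Bm) z -> normc z < 1) ->
  exists g c : R, [/\ 0 < g, 0 <= c & forall (x : R -> 'cV[R]_m) (phi : nat -> R -> 'cV[R]_m) (Phi : R),
  (forall (t : R) i, 0 < t -> (forall j : nat, t != j%:R * tau) ->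
     is_derive t 1 (fun s => (N *m x s) i 0) ((x t - Bm *m x (t - tau)) i 0)) ->
  (forall t, - tau <= t <= 0 -> x t = phi 0%N t) ->
  (forall k, (k.+1 < nu)%N -> forall (t : R) i,
     is_derive t 1 (fun s => phi k s i 0) (phi k.+1 t i 0)) ->
  0 <= Phi ->
  (forall k t i, (k < nu)%N -> - tau <= t <= 0 -> `|phi k t i 0| <= Phi) ->
  forall t i, - tau < t -> (forall j : nat, t != j%:R * tau) ->
    `|x t i 0| <= c * Phi * expR (- g * t) ].
Proof.
move=> tau0 N0 NB hz.
have [r [D [/andP[r0 r1] D0 hD]]] := matrix_power_bound hz.
(* This choice gives [(1 + q) * r < 1], so the binomial growth is absorbed into the geometric
   decay. *)
pose q := (1 - r) / 2.
have q0 : 0 < q by rewrite /q; lra.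
have q1 : q <= 1 by rewrite /q; lra.
pose r2 := (1 + q) * r.
have r20 : 0 < r2 by rewrite mulr_gt0 //; lra.
have r21 : r2 < 1 by rewrite /r2 /q; nra.
pose a := \sum_(k < nu) \sum_(i < m) \sum_(p < m) `|(N ^+ k) i p|.
have a0 : 0 <= a.
  by apply: sumr_ge0 => k _; apply: sumr_ge0 => i _; apply: sumr_ge0.
(* Absorbs (1 + q)^k <= 2^nu and 1/q^k <= 1/q^nu for k < nu. *)
pose cb := 2 ^+ nu / q ^+ nu.
have cb0 : 0 <= cb by rewrite divr_ge0 // exprn_ge0 // ltW.
(* On the j-th cell t < j tau, so r2^j is at most r2^(t / tau) = exp(-g t). *)
pose g := - ln r2 / tau.
have g0 : 0 < g by rewrite divr_gt0 // oppr_gt0 ln_lt0 // r20.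
pose c := nu%:R * (cb * (a * m%:R * D)).
have c0 : 0 <= c.
  by rewrite /c mulr_ge0 // mulr_ge0 // mulr_ge0 // mulr_ge0.
exists g, c; split => // x phi Phi hx hinit hphi Phi0 hPhi t i t1 tg.
have [j [u [ut tE]]] := grid_cell tau0 t1 tg.
have ut2 : - tau <= u <= 0 by case/andP: ut => h1 h2; rewrite !ltW.
have key := derivative_chain tau0 N0 NB hx hinit hphi j 0 ut.
rewrite expr0 mul1mx -tE in key.
have decay : r2 ^+ j <= expR (- g * t).
  rewrite -[r2]lnK ?posrE // -expRM_natl ler_expR.
  have -> : - g * t = ln r2 * (t / tau) by rewrite /g; field; rewrite gt_eqF.
  rewrite -mulrC; apply: ler_wnM2l; first by rewrite ltW // ln_lt0 // r20.
  rewrite ler_pdivrMr // tE; case/andP: ut => _ /ltW; lra.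
have bin (k : 'I_nu) : 'C((j + k).-1, k)%:R * r ^+ j <= cb * r2 ^+ j.
  have h1 := binomial_le_power (j + k).-1 k (ltW q0).
  have h2 : (1 + q) ^+ (j + k).-1 <= (1 + q) ^+ j * 2 ^+ nu.
    apply: (@le_trans _ _ ((1 + q) ^+ (j + k))).
      by rewrite ler_weXn2l ?leq_pred // lerDl ltW.
    rewrite exprD ler_wpM2l ?exprn_ge0 //; first by lra.
    apply: (@le_trans _ _ (2 ^+ k)).
      by apply: lerXn2r; rewrite ?nnegrE //; lra.
    by rewrite ler_weXn2l // ?ler1n // ltnW.
  have h3 : q ^+ nu <= q ^+ k by rewrite ler_wiXn2l ?(ltW q0) ?q1 // ltnW.
  have h4 : 'C((j + k).-1, k)%:R * q ^+ nu <= (1 + q) ^+ j * 2 ^+ nu.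
    apply: le_trans h2; apply: le_trans h1; rewrite ler_wpM2l //.
  have h5 : 'C((j + k).-1, k)%:R <= (1 + q) ^+ j * cb.
    by rewrite /cb mulrA ler_pdivlMr // exprn_gt0.
  have -> : cb * r2 ^+ j = (1 + q) ^+ j * cb * r ^+ j by rewrite /r2 exprMn; ring.
  by rewrite ler_wpM2r // exprn_ge0 // ltW.
apply: (@le_trans _ _ (c * Phi * r2 ^+ j)); last by rewrite ler_wpM2l // mulr_ge0.
rewrite key summxE; apply: le_trans (ler_norm_sum _ _ _) _.
have -> : c * Phi * r2 ^+ j = \sum_(k < nu) (cb * r2 ^+ j) * (a * m%:R * D * Phi).
  by rewrite sumr_const card_ord -mulr_natl /c; ring.
apply: ler_sum => k _; rewrite add0n mxE normrM (@ger0_norm _ _%:R) //.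
have hent : `|(N ^+ k *m Bm ^+ j *m phi k u) i 0| <= a * m%:R * D * Phi * r ^+ j.
  have ha p : `|(N ^+ k) i p| <= \sum_(p < m) `|(N ^+ k) i p|.
    by rewrite (bigD1 p) //= lerDl sumr_ge0.
  have hs : \sum_(p < m) `|(N ^+ k) i p| <= a.
    rewrite /a [leRHS](bigD1 k) //= [X in _ <= X + _](bigD1 i) //= -addrA lerDl addr_ge0 //.
      by apply: sumr_ge0 => ? _; apply: sumr_ge0.
    by apply: sumr_ge0 => ? _; apply: sumr_ge0 => ? _; apply: sumr_ge0.
  rewrite -mulmxA mxE; apply: le_trans (ler_norm_sum _ _ _) _.
  apply: (@le_trans _ _ (\sum_(p < m) `|(N ^+ k) i p| * (m%:R * D * Phi * r ^+ j))).
    apply: ler_sum => p _; rewrite normrM ler_wpM2l // mxE.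
    apply: le_trans (ler_norm_sum _ _ _) _.
    apply: (@le_trans _ _ (\sum_(l < m) (D * r ^+ j) * Phi)).
      by apply: ler_sum => l _; rewrite normrM ler_pM // hPhi.
    by rewrite sumr_const card_ord -mulr_natl le_eqVlt; apply/orP; left; apply/eqP; ring.
  rewrite -mulr_suml; apply: (@le_trans _ _ (a * (m%:R * D * Phi * r ^+ j))).
    by rewrite ler_wpM2r // !mulr_ge0 ?exprn_ge0 ?(ltW r0).
  by rewrite le_eqVlt; apply/orP; left; apply/eqP; ring.
apply: le_trans (ler_wpM2l (ler0n _ _) hent) _.
rewrite mulrCA [leRHS]mulrC ler_wpM2l // !mulr_ge0 //.
Qed.

End AlgebraicPart.

(** * The two implications *)

Section Sufficiency.
Variable R : realType.
Local Notation C := (complex R).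

Lemma mx_entry_le (m n : nat) (M : 'M[R]_(m, n)) i j : `|M i j| <= `|M|.
Proof.
rewrite [leRHS]/Num.Def.normr /= mx_normrE.
exact: (le_bigmax _ (fun ij : 'I_m * 'I_n => `|M ij.1 ij.2|) (i, j)).
Qed.

Lemma mx_norm_le (m n : nat) (M : 'M[R]_(m, n)) (b : R) : 0 <= b ->
  (forall i j, `|M i j| <= b) -> `|M| <= b.
Proof.
by move=> b0 h; rewrite [leLHS]/Num.Def.normr /= mx_normrE; apply: bigmax_le => // -[i j] _; exact: h.
Qed.

Lemma Cp_norm_bound (n p k : nat) (tau : R) (phi : R -> 'cV[R]_n) : 0 < tau ->
  Cp_fun p phi -> (k <= p)%N -> forall t, - tau <= t <= 0 ->
  `|derive1n k phi t| <= Cp_norm p tau phi.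
Proof.
move=> tau0 [_ hc] kp t tt.
pose S (i : nat) : set R := [set `|derive1n i phi t| | t in `[- tau, 0]].
have bS i : (i <= p)%N -> has_ubound (S i).
  move=> ip; have t0 : - tau <= 0 by rewrite oppr_le0 ltW.
  have cf : {within `[- tau, 0], continuous (fun t => `|derive1n i phi t|)}.
    apply: continuous_subspaceT => z; apply: cvg_norm; exact: hc.
  have [c _ hcm] := EVT_max t0 cf.
  by exists `|derive1n i phi c| => _ [z /= zi <-]; exact: hcm.
have le_S i z : (i <= p)%N -> - tau <= z <= 0 -> `|derive1n i phi z| <= sup (S i).
  move=> ip zi; apply: ub_le_sup; first exact: bS.
  by exists z => //=; rewrite in_itv.
have zero : - tau <= 0 <= (0 : R) by apply/andP; split => //; rewrite oppr_le0 ltW.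
apply: le_trans (le_S k t kp tt) _.
have kp1 : (k < p.+1)%N by [].
rewrite /Cp_norm (bigD1 (Ordinal kp1)) //= lerDl; apply: sumr_ge0 => i _.
by apply: le_trans (le_S i 0 _ zero); rewrite // -ltnS.
Qed.

(** A solution is unconstrained to the left of the initial interval; freezing it there yields a
    function continuous on the whole line. *)
Lemma continuous_extend_left (V : normedModType R) (f : R -> V) (a : R) :
  {within `[a, +oo[, continuous f} -> continuous (fun t => f (Num.max t a)).
Proof.
move=> /subspace_continuousP cf t P hP.
have am : `[a, +oo[%classic (Num.max t a) by rewrite /= in_itv /= andbT le_max lexx orbT.
have := cf _ am _ hP; rewrite /fmap /= /nbhs /= => hw.
have cm : {for t, continuous (fun u : R => Num.max u a)}.
  by apply: continuous_max; [exact: cvg_id|exact: cvg_cst].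
have h2 := cm _ hw.
apply: (@filterS R (nbhs t) (nbhs_filter t) _ _ _ h2) => u /=; apply.
by rewrite /= in_itv /= andbT le_max lexx orbT.
Qed.

Variables (n1 n2 nu : nat) (tau : R) (E2 : 'M[R]_(n1, n2)) (N : 'M[R]_n2)
    (A1 : 'M[R]_n1) (A2 : 'M[R]_(n1, n2))
    (B1 : 'M[R]_n1) (B2 : 'M[R]_(n1, n2)) (B4 : 'M[R]_n2).
Hypotheses (tau0 : 0 < tau) (N0 : N ^+ nu = 0) (NB : N *m B4 = B4 *m N).
Let E : 'M[R]_(n1 + n2) := block_mx 1%:M E2 0 N.
Let A : 'M[R]_(n1 + n2) := block_mx A1 A2 0 1%:M.
Let B : 'M[R]_(n1 + n2) := block_mx B1 B2 0 B4.

Section Solution.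
Variables (phi x : R -> 'cV[R]_(n1 + n2)).
Hypotheses (hphi : Cp_fun nu phi) (hx : is_solution E A B tau phi x).
Let x1 t := usubmx (x t).
Let x2 t := dsubmx (x t).
(** The first block of [E *m x]. This combination is differentiable off the grid, while [x1] and
    [x2] separately need not be. *)
Let y t := x1 t + E2 *m x2 t.
Let Phi := Cp_norm nu tau phi.

Let xE t : x t = col_mx (x1 t) (x2 t).
Proof. by rewrite vsubmxK. Qed.

Let solE (t : R) i : 0 < t -> (forall j : nat, t != j%:R * tau) ->
  is_derive t 1 (fun s => (E *m x s) i 0) ((A *m x t + B *m x (t - tau)) i 0).
Proof.
move=> t0 tg; case: hx => _ [_ [/(_ t (ltW t0) tg) [d1 d2] _]].
by apply: is_derive_mx_entry; apply: DeriveDef; [exact: d1|rewrite -derive1E; exact: d2].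
Qed.

(** Substituting [x1 = y - E2 x2] moves every occurrence of [x2] into the forcing. *)
Lemma differential_part_eq (t : R) k : 0 < t -> (forall j : nat, t != j%:R * tau) ->
  is_derive t 1 (fun s => y s k 0)
   ((A1 *m y t + B1 *m y (t - tau) +
    ((A2 - A1 *m E2) *m x2 t + (B2 - B1 *m E2) *m x2 (t - tau))) k 0).
Proof.
move=> t0 tg; have := solE (lshift n2 k) t0 tg.
have e1 s : (E *m x s) (lshift n2 k) 0 = y s k 0.
  by rewrite xE /E mul_block_col mul1mx col_mxEu.
under eq_fun do rewrite e1.
rewrite !xE /A /B !mul_block_col add_col_mx col_mxEu.
congr (is_derive _ _ _ (fun_of_matrix _ _ _)).
rewrite /y !mulmxDr !mulmxDl !mulNmx !mulmxA.
move: (A1 *m x1 t) (A2 *m x2 t) (A1 *m E2 *m x2 t) => a b c.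
move: (B1 *m x1 (t - tau)) (B2 *m x2 (t - tau)) (B1 *m E2 *m x2 (t - tau)) => d e f.
by apply/matrixP => i j; rewrite !mxE; ring.
Qed.

Lemma algebraic_part_eq (t : R) i : 0 < t -> (forall j : nat, t != j%:R * tau) ->
  is_derive t 1 (fun s => (N *m x2 s) i 0) ((x2 t - (- B4) *m x2 (t - tau)) i 0).
Proof.
move=> t0 tg; have := solE (rshift n1 i) t0 tg.
have e1 s : (E *m x s) (rshift n1 i) 0 = (N *m x2 s) i 0.
  by rewrite xE /E mul_block_col mul0mx add0r col_mxEd.
under eq_fun do rewrite e1.
by rewrite !xE /A /B !mul_block_col add_col_mx col_mxEd !mul0mx !add0r mul1mx mulNmx opprK.
Qed.

Lemma Cp_norm_ge0 : 0 <= Phi.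
Proof.
apply: le_trans (Cp_norm_bound tau0 hphi (leq0n nu) (t := 0) _) => //.
by apply/andP; split => //; rewrite oppr_le0 ltW.
Qed.

Lemma init_entry_le t i : - tau <= t <= 0 -> `|x t i 0| <= Phi.
Proof.
move=> tt; case: hx => _ [_ [_ /(_ t tt) ->]].
apply: le_trans (mx_entry_le _ _ _) _.
exact: (Cp_norm_bound tau0 hphi (leq0n nu) tt).
Qed.

Lemma algebraic_entry_le (g c : R) :
  (forall (x : R -> 'cV[R]_n2) (phi : nat -> R -> 'cV[R]_n2) (Phi : R),
  (forall (t : R) i, 0 < t -> (forall j : nat, t != j%:R * tau) ->
     is_derive t 1 (fun s => (N *m x s) i 0) ((x t - (- B4) *m x (t - tau)) i 0)) ->
  (forall t, - tau <= t <= 0 -> x t = phi 0%N t) ->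
  (forall k, (k.+1 < nu)%N -> forall (t : R) i,
     is_derive t 1 (fun s => phi k s i 0) (phi k.+1 t i 0)) ->
  0 <= Phi ->
  (forall k t i, (k < nu)%N -> - tau <= t <= 0 -> `|phi k t i 0| <= Phi) ->
  forall t i, - tau < t -> (forall j : nat, t != j%:R * tau) ->
    `|x t i 0| <= c * Phi * expR (- g * t)) ->
  forall t i, - tau < t -> (forall j : nat, t != j%:R * tau) ->
    `|x2 t i 0| <= c * Phi * expR (- g * t).
Proof.
move=> key; apply: (key x2 (fun k t => dsubmx (derive1n k phi t)) Phi).
- by move=> t i; exact: algebraic_part_eq.
- by move=> t tt; case: hx => _ [_ [_ /(_ t tt) h]]; rewrite /x2 h.
- move=> k kn t i; case: hphi => /(_ k (ltnW kn)) /(_ t) d _.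
  have h : is_derive t 1 (derive1n k phi) (derive1n k.+1 phi t).
    by apply: DeriveDef; [exact: d|rewrite derive1nS derive1E].
  have := is_derive_mx_entry (rshift n1 i) 0 h; rewrite [in X in _ -> X]mxE.
  by under [in X in _ -> X]eq_fun do rewrite mxE.
- exact: Cp_norm_ge0.
- move=> k t i kn tt; rewrite mxE; apply: le_trans (mx_entry_le _ _ _) _.
  exact: (Cp_norm_bound tau0 hphi (ltnW kn) tt).
Qed.

Lemma solution_extension_continuous i : continuous (fun t => x (Num.max t (- tau)) i 0).
Proof.
case: hx => cx _ t; have c1 := continuous_extend_left cx.
apply: (@continuous_comp _ _ _ (fun t => x (Num.max t (- tau))) (fun M => M i 0)); first exact: c1.
exact: coord_continuous.
Qed.

Lemma differential_extension_continuous k : continuous (fun t => y (Num.max t (- tau)) k 0).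
Proof.
move=> t; rewrite (_ : (fun t => _) = fun t => x (Num.max t (- tau)) (lshift n2 k) 0 +
    \sum_l E2 k l * x (Num.max t (- tau)) (rshift n1 l) 0); last first.
  apply/funext => s; rewrite /y !mxE; congr (_ + _); apply: eq_bigr => l _; by rewrite mxE.
apply: cvgD; first exact: solution_extension_continuous.
apply: continuous1_sum => l _; apply: cvgM; first exact: cvg_cst.
exact: solution_extension_continuous.
Qed.

(** Immediately to the right of a multiple of [tau], 0 included, there is no further multiple, so
    the bound passes to the limit by continuity of the solution. *)
Lemma bound_from_off_grid (d g : R) : 0 <= d ->
  (forall t, 0 < t -> (forall j : nat, t != j%:R * tau) -> forall i, `|x t i 0| <= d * expR (- g * t)) ->
  forall t, 0 <= t -> `|x t| <= d * expR (- g * t).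
Proof.
move=> d0 h t t0; apply: mx_norm_le; first by rewrite mulr_ge0 ?expR_ge0.
move=> i l; rewrite (ord1 l) {l}.
have [[j tj]|ng] := pselect (exists j : nat, t = j%:R * tau); last first.
  apply: h => [|j]; last by apply/eqP => tj; apply: ng; exists j.
  by rewrite lt_neqAle t0 andbT; apply/eqP => t00; apply: ng; exists 0%N; rewrite mul0r.
have mt s : 0 <= s -> Num.max s (- tau) = s.
  by move=> s0; rewrite max_l // (le_trans _ s0) // oppr_le0 ltW.
have c1 : `|x (Num.max s (- tau)) i 0| @[s --> t^'+] --> `|x t i 0|.
  rewrite -[in X in _ --> X](mt t t0); apply: cvg_norm.
  by apply: cvg_at_right_filter; exact: solution_extension_continuous.
have c2 : d * expR (- g * s) @[s --> t^'+] --> d * expR (- g * t).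
  apply: cvgM; first exact: cvg_cst.
  by apply: cvg_at_right_filter; exact: is_derive_continuous (is_derive_expRM (- g) t).
apply: (ler_cvg_to c1 c2); near=> s.
have ts : t < s by near: s; exact: nbhs_right_gt.
have st : s < t + tau by near: s; apply: nbhs_right_lt; rewrite ltrDl.
have s0 : 0 < s by exact: le_lt_trans ts.
rewrite mt ?(ltW s0) //; apply: h => // k; apply/eqP => sk.
have : (k < j.+1)%N by rewrite -(ltr_nat R) -(ltr_pM2r tau0) -natr1 mulrDl mul1r -tj -sk.
have : (j < k)%N by rewrite -(ltr_nat R) -(ltr_pM2r tau0) -tj -sk.
by move=> h1; rewrite ltnS leqNgt h1.
Unshelve. all: by end_near. Qed.

End Solution.

(** From 1 + g t / 2 <= exp(g t / 2). It removes the factor [t] that arises when forcing and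
    fundamental matrix are estimated at the same rate. *)
Lemma time_exp_le (g t : R) : 0 < g -> 0 <= t ->
  t * expR (- g * t) <= 2 / g * expR (- (g / 2) * t).
Proof.
move=> g0 t0.
have -> : - g * t = - (g / 2) * t + - (g / 2 * t) by field.
rewrite expRD mulrCA mulrC ler_wpM2r ?expR_ge0 //.
rewrite expRN ler_pdivrMr ?expR_gt0 //.
have := expR_ge1Dx (g / 2 * t) => h.
have g2 : 0 < 2 / g by rewrite divr_gt0.
apply: le_trans (ler_wpM2l (ltW g2) h).
have -> : 2 / g * (1 + g / 2 * t) = 2 / g + t by field; rewrite gt_eqF.
by rewrite lerDr ltW.
Qed.

Theorem spectrum_sufficient :
  (forall lam : C, ddae_spectrum E A B tau lam -> complex.Re lam < 0) ->
  Cp_weakly_exp_stable nu E A B tau.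
Proof.
move=> hspec.
have hdet (lam : C) : \det (lam%:M - delay_symbol A1 B1 tau lam) *
   \det (lam *: map_mx (fun r : R => r%:C%C) N - 1%:M - cexp (- lam * tau%:C%C) *: map_mx (fun r : R => r%:C%C) B4) = 0 ->
   complex.Re lam < 0.
  by move=> h; apply: hspec; rewrite /ddae_spectrum /= ddae_det_block.
have h1 (s : C) : \det (s%:M - delay_symbol A1 B1 tau s) = 0 -> complex.Re s < 0.
  by move=> h; apply: hdet; rewrite h mul0r.
have h2 (s : C) : \det (s *: map_mx (fun r : R => r%:C%C) N - 1%:M -
    cexp (- s * tau%:C%C) *: map_mx (fun r : R => r%:C%C) B4) = 0 -> complex.Re s < 0.
  by move=> h; apply: hdet; rewrite h mulr0.
have NB' : N *m (- B4) = (- B4) *m N by rewrite mulmxN mulNmx NB.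
have [g [c [g0 c0 halg]]] := algebraic_part_decay tau0 N0 NB' (unit_disc_of_spectrum tau0 N0 NB h2).
have [X [gx [K [gx0 K0 [X1 X2 X3 X4 X5]]]]] := stable_fundamental_matrix tau0 h1.
pose gam := Num.min g gx.
have gam0 : 0 < gam by rewrite lt_min g0.
have gamg : gam <= g by rewrite ge_min lexx.
have gamx : gam <= gx by rewrite ge_min lexx orbT.
have X5' t i j : `|X t i j| <= K * expR (- gam * t).
  have [t0|t0] := ltP t 0; first by rewrite X1 // mxE normr0 mulr_ge0 ?expR_ge0 ?(ltW K0).
  apply: le_trans (X5 t i j) _; rewrite ler_wpM2l ?(ltW K0) // ler_expR !mulNr lerN2.
  exact: ler_wpM2r.
pose sE2 := \sum_k \sum_l `|E2 k l|.
pose P1 := A2 - A1 *m E2; pose P2 := B2 - B1 *m E2.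
pose sP1 := \sum_k \sum_l `|P1 k l|; pose sP2 := \sum_k \sum_l `|P2 k l|.
have sum0 p q (Z : 'M[R]_(p, q)) : 0 <= \sum_k \sum_l `|Z k l|.
  by apply: sumr_ge0 => k _; apply: sumr_ge0.
have mulb p q (Z : 'M[R]_(p, q)) (v : 'cV[R]_q) (b : R) i : 0 <= b -> (forall l, `|v l 0| <= b) ->
    `|(Z *m v) i 0| <= (\sum_k \sum_l `|Z k l|) * b.
  move=> b0 hv; rewrite mxE; apply: le_trans (ler_norm_sum _ _ _) _.
  apply: (@le_trans _ _ (\sum_l `|Z i l| * b)).
    by apply: ler_sum => l _; rewrite normrM ler_wpM2l.
  rewrite -mulr_suml ler_wpM2r // [leRHS](bigD1 i) //= lerDl.
  by apply: sumr_ge0 => k _; apply: sumr_ge0.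
(* The constant of the forcing; its delayed term pays exp(g tau). *)
pose l0 := sP1 * c + sP2 * (c * expR (g * tau)).
have l00 : 0 <= l0.
  by rewrite addr_ge0 // mulr_ge0 ?sum0 // mulr_ge0 // expR_ge0.
(* [c1] and [c2] are the coefficients of the variation of constants bound for [M = (1 + sE2) * Phi]
   and [L = l0 * Phi], with [Phi] factored out; the [2 / gam] in [c3] absorbs the factor [t]. *)
pose c1 := n1%:R * K * (1 + sE2) + tau * (expR (gam * tau) * K * (\sum_k \sum_l `|B1 k l|) * (1 + sE2)).
pose c2 := n1%:R * K * l0.
pose c3 := c1 + c2 * (2 / gam).
have K00 := ltW K0.
have sE20 : 0 <= sE2 by exact: sum0.
have e10 : 0 <= 1 + sE2 by lra.
have c10 : 0 <= c1.
  have b10 : 0 <= \sum_k \sum_l `|B1 k l| by exact: sum0.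
  have eg0 := expR_ge0 (gam * tau).
  by rewrite /c1; apply: addr_ge0; do ?[apply: mulr_ge0 => //]; exact: ltW.
have c20 : 0 <= c2 by rewrite /c2; do ?[apply: mulr_ge0 => //].
have c30 : 0 <= c3.
  by rewrite /c3 addr_ge0 // mulr_ge0 // divr_ge0 // ltW.
(* [c3] serves [y], [sE2 * c] serves [E2 *m x2], [c] serves [x2], and 1 makes the constant
   positive. *)
pose del := c3 + sE2 * c + c + 1.
have sEc : 0 <= sE2 * c by rewrite mulr_ge0.
exists del, (gam / 2); split; first by rewrite /del; lra.
split; first by rewrite divr_gt0.
move=> phi hphi _ x hx.
pose Phi := Cp_norm nu tau phi.
have Phi0 : 0 <= Phi by exact: Cp_norm_ge0 hphi.
pose x2 t := dsubmx (x t); pose y t := usubmx (x t) + E2 *m x2 t.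
have hx2 := algebraic_entry_le hphi hx halg; rewrite -/Phi -/x2 in hx2.
have hy t k : 0 <= t -> `|y t k 0| <= c3 * Phi * expR (- (gam / 2) * t).
  move=> t0.
  have M0 : 0 <= (1 + sE2) * Phi by rewrite mulr_ge0.
  have yinit s i : - tau <= s <= 0 -> `|y s i 0| <= (1 + sE2) * Phi.
    move=> ss; rewrite mxE; apply: le_trans (ler_normD _ _) _; rewrite mulrDl mul1r; apply: lerD.
      by rewrite mxE; exact: (init_entry_le hphi hx).
    by apply: (mulb) => // l; rewrite mxE; exact: (init_entry_le hphi hx).
  pose gf s := P1 *m x2 s + P2 *m x2 (s - tau).
  have hg s i : 0 < s -> (forall j : nat, s != j%:R * tau) -> `|gf s i 0| <= l0 * Phi * expR (- gam * s).
    move=> s0 sg; rewrite mxE; apply: le_trans (ler_normD _ _) _.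
    have rate : expR (- g * s) <= expR (- gam * s).
      by rewrite ler_expR !mulNr lerN2 ler_wpM2r // ltW.
    have b1 : `|(P1 *m x2 s) i 0| <= sP1 * (c * Phi * expR (- gam * s)).
      apply: (mulb) => [|l]; first by rewrite !mulr_ge0 ?expR_ge0.
      apply: le_trans (hx2 s l _ sg) _; first by rewrite (lt_trans _ s0) // oppr_lt0.
      by rewrite ler_wpM2l // mulr_ge0.
    have sg' (j : nat) : s - tau != j%:R * tau.
      by apply: contraNneq (sg j.+1) => E'; rewrite -natr1 mulrDl mul1r -E' subrK.
    have b2 : `|(P2 *m x2 (s - tau)) i 0| <= sP2 * (c * expR (g * tau) * Phi * expR (- gam * s)).
      apply: (mulb) => [|l]; first by rewrite !mulr_ge0 ?expR_ge0.
      apply: le_trans (hx2 (s - tau) l _ sg') _; first by rewrite ltrBrDl subrr.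
      rewrite (_ : - g * (s - tau) = g * tau + - g * s); last by ring.
      rewrite expRD [leLHS](_ : _ = c * expR (g * tau) * Phi * expR (- g * s)); last by ring.
      by rewrite ler_wpM2l // !mulr_ge0 ?expR_ge0.
    apply: le_trans (lerD b1 b2) _.
    by rewrite /l0 le_eqVlt; apply/orP; left; apply/eqP; ring.
  have := @variation_of_constants_bound R n1 A1 B1 tau tau0 X gam K gam0 K0 X1 X2 X3 X4 X5' y gf
    ((1 + sE2) * Phi) (l0 * Phi) M0 (differential_extension_continuous hx)
    (fun t k => differential_part_eq hx k (t := t)) yinit hg t k t0.
  move=> /le_trans; apply.
  have ex1 : expR (- gam * t) <= expR (- (gam / 2) * t).
    rewrite ler_expR !mulNr lerN2 ler_wpM2r //; lra.
  have ex2 := time_exp_le gam0 t0.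
  rewrite [leLHS](_ : _ = Phi * (c1 * expR (- gam * t) + c2 * (t * expR (- gam * t)))); last first.
    by rewrite /c1 /c2; ring.
  rewrite /c3 [leRHS](_ : _ = Phi * (c1 * expR (- (gam / 2) * t) + c2 * (2 / gam * expR (- (gam / 2) * t)))); last by ring.
  by rewrite ler_wpM2l // lerD // ler_wpM2l.
move=> t t0.
have dP : 0 <= del * Phi by rewrite mulr_ge0 // /del; lra.
rewrite -/Phi mulrAC; apply: (bound_from_off_grid hx dP) => // {t0}{}t t0 tg i.
have t1 : - tau < t by rewrite (lt_trans _ t0) // oppr_lt0.
set e := expR (- (gam / 2) * t).
have e0 : 0 <= e by exact: expR_ge0.
have ex : expR (- g * t) <= e.
  rewrite ler_expR !mulNr lerN2 ler_wpM2r ?(ltW t0) //; lra.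
have hx2e l : `|x2 t l 0| <= c * Phi * e.
  by apply: le_trans (hx2 t l t1 tg) _; rewrite ler_wpM2l // mulr_ge0.
have cPe : 0 <= c * Phi * e by rewrite !mulr_ge0.
have Pe : 0 <= Phi * e by rewrite mulr_ge0.
have -> : del * Phi * e = c3 * Phi * e + sE2 * (c * Phi * e) + c * Phi * e + Phi * e.
  by rewrite /del; ring.
have c3e : 0 <= c3 * Phi * e by rewrite !mulr_ge0.
have sEce : 0 <= sE2 * (c * Phi * e) by rewrite mulr_ge0.
case: (split_ordP i) => k ->; last first.
  have -> : x t (rshift n1 k) 0 = x2 t k 0 by rewrite mxE.
  by apply: le_trans (hx2e k) _; lra.
have -> : x t (lshift n2 k) 0 = y t k 0 - (E2 *m x2 t) k 0.
  by rewrite /y [X in _ = X - _]mxE addrK mxE.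
apply: le_trans (ler_normB _ _) _.
have := hy t k (ltW t0); rewrite -/e.
have := mulb _ _ E2 (x2 t) _ k cPe hx2e; rewrite -/sE2; lra.
Qed.

End Sufficiency.

(** * Necessity of the spectral condition *)

Section Necessity.
Import ComplexField.Normc.
Variable R : realType.
Local Notation C := (complex R).
Local Notation toC := (map_mx (fun r : R => r%:C%C)).

Lemma is_derive_mx (m n : nat) (f : R -> 'M[R]_(m, n)) (t : R) (d : 'M[R]_(m, n)) :
  (forall i j, is_derive t 1 (fun s => f s i j) (d i j)) -> is_derive t 1 f d.
Proof.
move=> h; have df : derivable f t 1.
  by apply/derivable_mxP => i j; case: (h i j).
apply: DeriveDef; first exact: df.
by rewrite derive_mx //; apply/matrixP => i j; rewrite mxE; case: (h i j).
Qed.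

Variables (n : nat) (lam : C).

(** With [w] as a parameter the family is closed under derivatives, matrix products and delays, each
    of which acts on [w] alone. *)
Definition exp_mode (w : 'cV[C]_n) (t : R) : 'cV[R]_n :=
  map_mx (@complex.Re R) (cexp (lam * t%:C%C) *: w).

Lemma exp_mode_entry w t i j : exp_mode w t i j = complex.Re (cexp (lam * t%:C%C) * w i j).
Proof. by rewrite !mxE. Qed.

Lemma is_derive_exp_mode (w : 'cV[C]_n) (t : R) :
  is_derive t 1 (exp_mode w) (exp_mode (lam *: w) t).
Proof.
apply: is_derive_mx => i j; rewrite exp_mode_entry mxE.
under eq_fun do rewrite exp_mode_entry.
move: (w i j) => k.
have hd : is_derive (0 + t%:C%C * lam : C) 1 (fun z => k *: cexp z) (k *: cexp (0 + t%:C%C * lam)).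
  by apply: is_deriveZ; exact: is_derive_cexp.
have := is_derive_Re_line hd; rewrite !scalerE add0r.
have e1 (u : R) : u%:C%C * lam = lam * u%:C%C :> C by rewrite mulrC.
under eq_fun do rewrite add0r scalerE e1 mulrC.
by rewrite e1 (_ : k * _ * _ = cexp (lam * t%:C%C) * (lam * k)) //; ring.
Qed.

Lemma continuous_exp_mode w : continuous (exp_mode w).
Proof. by move=> t; exact: is_derive_continuous (is_derive_exp_mode w t). Qed.

Lemma derive1_exp_mode w : derive1 (exp_mode w) = exp_mode (lam *: w).
Proof. by apply/funext => t; rewrite derive1E; case: (is_derive_exp_mode w t). Qed.

Lemma derive1n_exp_mode w i : derive1n i (exp_mode w) = exp_mode (lam ^+ i *: w).
Proof.
elim: i => [|i IH]; first by rewrite derive1n0 expr0 scale1r.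
by rewrite derive1nS IH derive1_exp_mode scalerA -exprS.
Qed.

Lemma Cp_fun_exp_mode p w : Cp_fun p (exp_mode w).
Proof.
split=> i _; rewrite derive1n_exp_mode; last exact: continuous_exp_mode.
by move=> t; case: (is_derive_exp_mode (lam ^+ i *: w) t).
Qed.

Lemma mulmx_exp_mode (E : 'M[R]_n) w t : E *m exp_mode w t = exp_mode (toC E *m w) t.
Proof.
apply/matrixP => i j; rewrite mxE exp_mode_entry mxE mulr_sumr raddf_sum.
apply: eq_bigr => k _; rewrite exp_mode_entry mxE.
by case: (cexp _) (w k j) => a b [c d] /=; ring.
Qed.

Lemma exp_modeD w1 w2 t : exp_mode w1 t + exp_mode w2 t = exp_mode (w1 + w2) t.
Proof. by apply/matrixP => i j; rewrite mxE !exp_mode_entry mxE mulrDr raddfD. Qed.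

Lemma exp_mode_shift (tau : R) w t :
  exp_mode w (t - tau) = exp_mode (cexp (- lam * tau%:C%C) *: w) t.
Proof.
apply/matrixP => i j; rewrite !exp_mode_entry mxE mulrA -cexpD.
by congr (complex.Re (cexp _ * _)); rewrite rmorphB; ring.
Qed.

Lemma exp_mode_solution (E A B : 'M[R]_n) (tau : R) w :
  (lam *: toC E - toC A - cexp (- lam * tau%:C%C) *: toC B) *m w = 0 ->
  is_solution E A B tau (exp_mode w) (exp_mode w).
Proof.
move=> hw.
have EE : (fun t => E *m exp_mode w t) = exp_mode (toC E *m w).
  by apply/funext => t; rewrite mulmx_exp_mode.
split; first by apply: continuous_subspaceT => t; exact: continuous_exp_mode.
split; last split=> //.
  exists set0; rewrite EE derive1_exp_mode; split; first by move=> b; rewrite set0I; exact: finite_set0.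
  split.
    move=> t _ _; split; last exact: continuous_exp_mode.
    by case: (is_derive_exp_mode (toC E *m w) t).
  split=> // s _ _; apply/cvg_ex; eexists.
  by apply: cvg_at_right_filter; exact: continuous_exp_mode.
move=> t _ _; rewrite EE derive1_exp_mode; split.
  by case: (is_derive_exp_mode (toC E *m w) t).
rewrite !mulmx_exp_mode exp_mode_shift exp_modeD; congr (exp_mode _ t).
apply/eqP; rewrite -subr_eq0 opprD addrA; apply/eqP.
by rewrite -[RHS]hw !mulmxBl -!scalemxAl.
Qed.

Lemma spectrum_necessary (E A B : 'M[R]_n) (tau : R) (p : nat) :
  Cp_weakly_exp_stable p E A B tau -> ddae_spectrum E A B tau lam -> complex.Re lam < 0.
Proof.
move=> [del [gam [del0 [gam0 hst]]]]; rewrite /ddae_spectrum /= => hdet.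
rewrite ltNge; apply/negP => lam0.
(* [det0P] yields left null vectors, hence the transpose. *)
have : \det (lam *: toC E - toC A - cexp (- lam * tau%:C%C) *: toC B)^T == 0.
  by rewrite det_tr hdet.
move=> /det0P [v v0 hv].
have hw : (lam *: toC E - toC A - cexp (- lam * tau%:C%C) *: toC B) *m v^T = 0.
  by apply: trmx_inj; rewrite trmx_mul trmxK hv trmx0.
have hw2 : (lam *: toC E - toC A - cexp (- lam * tau%:C%C) *: toC B) *m (- 'i%C *: v^T) = 0.
  by rewrite -scalemxAr hw scaler0.
have bnd w : (lam *: toC E - toC A - cexp (- lam * tau%:C%C) *: toC B) *m w = 0 ->
    forall t j, 0 <= t -> `|exp_mode w t j 0| <= del * Cp_norm p tau (exp_mode w) * expR (- gam * t).
  move=> h t j t0; have sol := exp_mode_solution h.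
  apply: le_trans (mx_entry_le _ _ _) _; rewrite mulrAC.
  by apply: hst => //; [exact: Cp_fun_exp_mode|exists (exp_mode w)].
have [j vj] : exists j, v 0 j != 0.
  apply/existsP; rewrite -negb_forall; apply: contra v0 => /forallP h.
  by apply/eqP/matrixP => i j; rewrite (ord1 i) mxE; apply/eqP; exact: h.
pose K := del * Cp_norm p tau (exp_mode v^T) + del * Cp_norm p tau (exp_mode (- 'i%C *: v^T)).
(* If Re lam >= 0, the modulus of the complex mode never falls below its initial value, while its
   real and imaginary parts are both decaying solutions. *)
have hK t : 0 <= t -> normc (v 0 j) <= K * expR (- gam * t).
  move=> t0.
  apply: (@le_trans _ _ (normc (cexp (lam * t%:C%C) * v 0 j))).
    rewrite normcM normc_cexp ler_peMl ?normc_ge0 // (_ : complex.Re _ = complex.Re lam * t).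
      have := expR_ge1Dx (complex.Re lam * t); have := mulr_ge0 lam0 t0; lra.
    by case: (lam) => a b /=; ring.
  apply: le_trans (normc_le_reim _) _; rewrite /K mulrDl; apply: lerD.
    by have := bnd _ hw t j t0; rewrite exp_mode_entry mxE.
  have := bnd _ hw2 t j t0; rewrite exp_mode_entry 2!mxE.
  rewrite (_ : complex.Re _ = complex.Im (cexp (lam * t%:C%C) * v 0 j)) //.
  by case: (cexp _) (v 0 j) => a b [c d] /=; ring.
have n0 := normc_gt0 vj.
set q := normc (v 0 j) in hK n0.
have K0 : 0 < K.
  have := hK 0 (lexx _); rewrite mulr0 expR0 mulr1; exact: lt_le_trans.
(* Then exp(gam t) >= 1 + K / q > K / q, which contradicts [hK] at this time. *)
pose t := K / q / gam.
have t0 : 0 <= t by rewrite ltW // !divr_gt0.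
have := hK t t0; apply/negP; rewrite -ltNge mulNr expRN ltr_pdivrMr ?expR_gt0 //.
rewrite mulrC -ltr_pdivrMr //; apply: lt_le_trans (expR_ge1Dx _).
have -> : gam * t = K / q by rewrite /t mulrC divfK // gt_eqF.
by rewrite ltrDr.
Qed.

End Necessity.

Theorem theorem4 (R : realType) (n1 n2 : nat) (tau : R) (nu : nat)
    (E2 : 'M[R]_(n1, n2)) (N : 'M[R]_n2)
    (A1 : 'M[R]_n1) (A2 : 'M[R]_(n1, n2))
    (B1 : 'M[R]_n1) (B2 : 'M[R]_(n1, n2)) (B4 : 'M[R]_n2) :
  0 < tau ->
  nilpotency_index N nu ->
  N *m B4 = B4 *m N ->
  let E : 'M[R]_(n1 + n2) := block_mx 1%:M E2 0 N in
  let A : 'M[R]_(n1 + n2) := block_mx A1 A2 0 1%:M in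
  let B : 'M[R]_(n1 + n2) := block_mx B1 B2 0 B4 in
  Cp_weakly_exp_stable nu E A B tau <->
  (forall lam : complex R, ddae_spectrum E A B tau lam -> complex.Re lam < 0).
Proof.
move=> tau0 [N0 _] NB E A B; split=> [h lam|]; first exact: spectrum_necessary h.
exact: spectrum_sufficient.
Qed.
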